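(* Let $d\ge1$ and let $\mu$ be a compactly supported Radon measure on $\mathbb{R}^{2d}$. Assume there exist $\beta>0$ and a constant $C>0$ such that $$|\mathcal{F}_\sigma(\mu)(\zeta)|\leq C(1+|\zeta|)^{-\frac{\beta}{2}}\quad\text{for all }\zeta\in\mathbb{R}^{2d}.$$ Then $L_{\mathcal{F}_\sigma(\mu)}=\int\rho(z)\,d\mu(z)\in\mathcal{S}^p$ for every $p\in[1,\infty]$ with $p>4d/\beta$.
   Context: Measures may be complex-valued. Symplectic form on $\mathbb{R}^{2d}=\mathbb{R}^d\times\mathbb{R}^d$: $\sigma((x,\xi),(y,\eta))=y\cdot\xi-x\cdot\eta$. Symplectic Fourier transform of a finite Borel measure: $\mathcal{F}_\sigma(\mu)(\zeta)=\int e^{-2\pi i\sigma(\zeta,z)}\,d\mu(z)$. Schrödinger representation: for $z=(x,\xi)\in\mathbb{R}^{2d}$, $\rho(z)$ is the unitary operator on $L^2(\mathbb{R}^d)$ given by $\rho(x,\xi)g(t)=e^{-\pi i x\cdot\xi}e^{2\pi i t\cdot\xi}g(t-x)$. The operator $L_{\mathcal{F}_\sigma(\mu)}=\int\rho(z)\,d\mu(z)$ (the Weyl quantization of $\mathcal{F}_\sigma(\mu)$) is the bounded operator on $L^2(\mathbb{R}^d)$ defined weakly by $\langle L_{\mathcal{F}_\sigma(\mu)}f,g\rangle=\int\langle\rho(z)f,g\rangle\,d\mu(z)$. $\mathcal{S}^p$, $1\le p<\infty$, is the Schatten class of compact operators on $L^2(\mathbb{R}^d)$ with singular values in $\ell^p$;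 $\mathcal{S}^\infty=\mathcal{B}(L^2(\mathbb{R}^d))$. *)

(* Defs.v *)
From HB Require Import structures.
From mathcomp Require Import all_boot all_order all_algebra.
From mathcomp Require Import all_classical all_reals all_analysis.
From mathcomp Require Import measurable_realfun complex.

Set Implicit Arguments.
Unset Strict Implicit.
Unset Printing Implicit Defensive.

Import Order.TTheory GRing.Theory Num.Theory.
Import numFieldNormedType.Exports.

Local Open Scope classical_set_scope.
Local Open Scope ring_scope.

(* The sigma-algebra of 'rV[R]_n is the product one, generated by the
   coordinates; on R^n it coincides with the Borel sigma-algebra
   (measurable_rV_open). *)
Definition rV_display : measure_display -> measure_display.
Proof. exact. Qed.

Section rV_measurable.
Context {R : realType} (n : nat).

Definition rV_coord (i : 'I_n) (v : 'rV[R]_n) : R := v ord0 i.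

Let rV_set0 : g_sigma_preimage rV_coord set0.
Proof. exact: sigma_algebra0. Qed.

Let rV_setC A : g_sigma_preimage rV_coord A -> g_sigma_preimage rV_coord (~` A).
Proof. exact: sigma_algebraC. Qed.

Let rV_bigcup (F : (set 'rV[R]_n)^nat) :
  (forall i, g_sigma_preimage rV_coord (F i)) ->
  g_sigma_preimage rV_coord (\bigcup_i (F i)).
Proof. exact: sigma_algebra_bigcup. Qed.

HB.instance Definition _ := @isMeasurable.Build
  (rV_display default_measure_display) 'rV[R]_n
  (g_sigma_preimage rV_coord) rV_set0 rV_setC rV_bigcup.

End rV_measurable.

Lemma measurable_rV_coord {R : realType} n (i : 'I_n) :
  measurable_fun [set: 'rV[R]_n] (rV_coord i).
Proof.
move=> _ Y mY; rewrite setTI; apply: sub_sigma_algebra => /=.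
rewrite -bigcup_seq/=; exists i => /=; first by rewrite mem_index_enum.
by exists Y => //; rewrite setTI.
Qed.

Lemma measurable_fun_rVP d (T : measurableType d) {R : realType} n
    (f : T -> 'rV[R]_n) :
  measurable_fun [set: T] f <->
  forall i, measurable_fun [set: T] (rV_coord i \o f).
Proof.
apply: (@iff_trans _ (g_sigma_preimage (fun i => rV_coord i \o f)
    `<=` measurable)).
  rewrite g_sigma_preimage_comp; split=> [mf A [/= C preC <-]|prefS].
    exact: mf.
  by move=> _ A mA; apply: prefS; exists A.
split=> [fS i|mf].
- move=> _ A mA.
  apply: fS; apply: sub_sigma_algebra.
  rewrite -bigcup_seq/=; exists i => /=; first by rewrite mem_index_enum.
  by exists A.
- apply: smallest_sub; first exact: sigma_algebra_measurable.
  rewrite -bigcup_seq/=; apply: bigcup_sub => i _.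
  by move=> A [B mB <-]; exact: mf.
Qed.

Section rV_borel.
Context {R : realType} (n : nat).

Let box (ab : 'rV[rat]_n * 'rV[rat]_n) : set 'rV[R]_n :=
  [set v | forall i, ratr (ab.1 ord0 i) < v ord0 i < ratr (ab.2 ord0 i)].

Let measurable_box ab : measurable (box ab).
Proof.
rewrite (_ : box ab = \big[setI/setT]_(i < n)
    (rV_coord i @^-1` `]ratr (ab.1 ord0 i), ratr (ab.2 ord0 i)[)).
  apply: bigsetI_measurable => i _; rewrite -[X in measurable X]setTI.
  exact: measurable_rV_coord.
rewrite -bigcap_seq; apply/seteqP; split => v /=.
  by move=> h i _ /=; rewrite in_itv/=; exact: h.
by move=> h i; have := h i (mem_index_enum i); rewrite /= in_itv.
Qed.

Let open_box (U : set 'rV[R]_n) : open U ->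
  U = \bigcup_(ab in [set ab | box ab `<=` U]) box ab.
Proof.
move=> oU; apply/seteqP; split => [x Ux|x [ab/= abU]]; last exact: abU.
have [P xP PU] := open_nbhs_nbhs (conj oU Ux).
have H i : exists ab : rat * rat, ratr ab.1 < x ord0 i < ratr ab.2 /\
    forall y, ratr ab.1 < y < ratr ab.2 -> P ord0 i y.
  have /nbhs_ballP[e /= e0 xeP] := xP ord0 i.
  have /rat_in_itvoo[a] : x ord0 i - e < x ord0 i by rewrite ltrBlDr ltrDl.
  have /rat_in_itvoo[b] : x ord0 i < x ord0 i + e by rewrite ltrDl.
  rewrite !in_itv/= => /andP[xb be] /andP[ea ax].
  exists (a, b); split => [/=|y /= /andP[ay yb]]; first by rewrite ax xb.
  apply: xeP; rewrite /ball/= ltr_distlC.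
  by rewrite (lt_trans ea ay) (lt_trans yb be).
have [f fP] := choice H.
exists (\row_i (f i).1, \row_i (f i).2) => /=; last first.
  by move=> i; rewrite !mxE; exact: (fP i).1.
move=> y yf; apply: PU => i j; rewrite (ord1 i).
by apply: (fP j).2; have := yf j; rewrite !mxE.
Qed.

Lemma measurable_rV_open :
  measurable = <<s [set U : set 'rV[R]_n | open U] >>.
Proof.
apply/seteqP; split.
- apply: smallest_sub; first exact: smallest_sigma_algebra.
  rewrite -bigcup_seq/=; apply: bigcup_sub => i _ _ [B mB <-].
  rewrite setTI.
  have {}mB : (@RGenOpens.G R).-sigma.-measurable B.
    by rewrite -RGenOpens.measurableE.
  suff /(_ _ mB) : <<s @RGenOpens.G R >> `<=` [set B : set R |
      <<s [set U : set 'rV[R]_n | open U] >> (rV_coord i @^-1` B)] by [].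
  apply: smallest_sub.
    split => /= [|A hA|F hF].
    + by rewrite preimage_set0; exact: sigma_algebra0.
    + by rewrite setTD preimage_setC; exact: sigma_algebraC.
    + by rewrite preimage_bigcup; exact: sigma_algebra_bigcup.
  move=> _ [x [y ->]] /=; apply: sub_sigma_algebra => /=.
  apply: open_comp; last exact: interval_open.
  by move=> v _; exact: coord_continuous.
- apply: smallest_sub; first exact: sigma_algebra_measurable.
  move=> U /open_box ->; rewrite bigcup_mkcond.
  by apply: countable_bigcupT_measurable => // ab; case: ifP.
Qed.

End rV_borel.

Section rV_lebesgue.
Context {R : realType}.

Definition rV_cons n (p : R * 'rV[R]_n) : 'rV[R]_n.+1 :=
  row_mx (const_mx p.1 : 'rV_1) p.2.

Definition rV_uncons n (v : 'rV[R]_n.+1) : R * 'rV[R]_n :=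
  (v ord0 ord0, \row_i v ord0 (lift ord0 i)).

Lemma rV_cons0 n (p : R * 'rV[R]_n) : rV_cons p ord0 ord0 = p.1.
Proof. by rewrite mxE; case: splitP => j //= _; rewrite mxE. Qed.

Lemma rV_cons_lift n (p : R * 'rV[R]_n) (i : 'I_n) :
  rV_cons p ord0 (lift ord0 i) = p.2 ord0 i.
Proof.
rewrite mxE; case: splitP => j /=; first by rewrite (ord1 j).
by rewrite /bump/= => -[ij]; congr (p.2 _ _); exact/val_inj.
Qed.

Lemma rV_consK n : cancel (@rV_cons n) (@rV_uncons n).
Proof.
move=> p; rewrite /rV_uncons rV_cons0 [RHS]surjective_pairing; congr pair.
by apply/rowP => i; rewrite mxE rV_cons_lift.
Qed.

Lemma measurable_rV_cons n : measurable_fun setT (@rV_cons n).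
Proof.
apply/measurable_fun_rVP => i; rewrite /comp /rV_coord.
case: (unliftP ord0 i) => [j|] ->.
  under eq_fun do rewrite rV_cons_lift.
  exact: measurableT_comp (measurable_rV_coord j) measurable_snd.
under eq_fun do rewrite rV_cons0.
exact: measurable_fst.
Qed.

Lemma measurable_rV_uncons n : measurable_fun setT (@rV_uncons n).
Proof.
apply/measurable_fun_pairP; split; first exact: measurable_rV_coord.
apply/measurable_fun_rVP => i; rewrite /comp /rV_coord.
under eq_fun do rewrite /= mxE.
exact: measurable_rV_coord.
Qed.

Section step.
Variables (n : nat) (m : {sigma_finite_measure set 'rV[R]_n -> \bar R}).

Definition rV_lebesgueS : set 'rV[R]_n.+1 -> \bar R :=
  pushforward (lebesgue_measure \x m)%E (@rV_cons n).

Let rV_lebesgueS0 : rV_lebesgueS set0 = 0%E.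
Proof. by rewrite /rV_lebesgueS /pushforward preimage_set0 measure0. Qed.

Let rV_lebesgueS_ge0 A : (0 <= rV_lebesgueS A)%E.
Proof. by rewrite /rV_lebesgueS /pushforward; exact: measure_ge0. Qed.

Let rV_lebesgueS_sigma_additive : semi_sigma_additive rV_lebesgueS.
Proof.
move=> F mF tF mUF; rewrite /rV_lebesgueS /pushforward preimage_bigcup.
apply: measure_semi_sigma_additive.
- by move=> k; rewrite -[X in measurable X]setTI; exact: measurable_rV_cons.
- apply/trivIsetP => /= i j _ _ ij; rewrite -preimage_setI.
  by move/trivIsetP : tF => /(_ _ _ _ _ ij) ->//; rewrite preimage_set0.
- rewrite -preimage_bigcup -[X in measurable X]setTI.
  exact: measurable_rV_cons.
Qed.

HB.instance Definition _ := isMeasure.Build _ _ _ rV_lebesgueS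
  rV_lebesgueS0 rV_lebesgueS_ge0 rV_lebesgueS_sigma_additive.

Let rV_lebesgueS_sigma_finite : sigma_finite setT rV_lebesgueS.
Proof.
have /sigma_finiteP[F [FT ndF Foo]] := sigma_finiteT (@lebesgue_measure R).
have /sigma_finiteP[G [GT ndG Goo]] := sigma_finiteT m.
exists (fun k => @rV_uncons n @^-1` (F k `*` G k)).
  apply/esym; rewrite -subTset => v _.
  have [i _ Fi] : (\bigcup_i F i) (rV_uncons v).1 by rewrite -FT.
  have [j _ Gj] : (\bigcup_i G i) (rV_uncons v).2 by rewrite -GT.
  exists (maxn i j) => //; split.
    by move: Fi; exact/subsetPset/ndF/leq_maxl.
  by move: Gj; exact/subsetPset/ndG/leq_maxr.
move=> k; have [mF Fk] := Foo k; have [mG Gk] := Goo k; split.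
  rewrite -[X in measurable X]setTI.
  by apply: measurable_rV_uncons => //; exact: measurableX.
rewrite /rV_lebesgueS /pushforward -comp_preimage.
rewrite (_ : _ \o _ = id) ?preimage_id; last first.
  by apply/funext => p; exact: rV_consK.
by rewrite product_measure1E// lte_mul_pinfty// ge0_fin_numE.
Qed.

HB.instance Definition _ := Measure_isSigmaFinite.Build _ _ _ rV_lebesgueS
  rV_lebesgueS_sigma_finite.
End step.

Fixpoint rV_lebesgue n : {sigma_finite_measure set 'rV[R]_n -> \bar R} :=
  match n with
  | 0 => \d_(0 : 'rV[R]_0)
  | k.+1 => rV_lebesgueS (rV_lebesgue k)
  end.

Lemma rV_lebesgue_box n (a b : 'rV[R]_n) : (forall i, a ord0 i <= b ord0 i) ->
  rV_lebesgue n [set v : 'rV[R]_n | forall i, a ord0 i <= v ord0 i <= b ord0 i] =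
  (\prod_(i < n) (b ord0 i - a ord0 i))%:E.
Proof.
elim: n a b => [|n IH] a b ab /=.
  rewrite big_ord0 diracE mem_set//= => i; by case: i.
rewrite big_ord_recl /rV_lebesgueS /pushforward.
set B := (X in product_measure1 _ _ X).
pose a' := (rV_uncons a).2; pose b' := (rV_uncons b).2.
have -> : B = `[a ord0 ord0, b ord0 ord0] `*`
    [set v : 'rV[R]_n | forall i, a' ord0 i <= v ord0 i <= b' ord0 i].
  apply/seteqP; split => p; rewrite /B /= in_itv/=.
    move=> h; split; first by have := h ord0; rewrite rV_cons0.
    by move=> i; have := h (lift ord0 i); rewrite rV_cons_lift !mxE.
  move=> [h1 h2] i; case: (unliftP ord0 i) => [j|] ->; last by rewrite rV_cons0.
  by have := h2 j; rewrite rV_cons_lift !mxE.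
rewrite product_measure1E//=; last first.
  rewrite (_ : [set _ | _] = \big[setI/setT]_(i < n) (rV_coord i @^-1` `[a' ord0 i, b' ord0 i])); last first.
    rewrite -bigcap_seq; apply/seteqP; split => v /=.
      by move=> h i _ /=; rewrite in_itv/=; exact: h.
    by move=> h i; have := h i (mem_index_enum i); rewrite /= in_itv.
  apply: bigsetI_measurable => i _; rewrite -[X in measurable X]setTI.
  exact: measurable_rV_coord.
rewrite lebesgue_measure_itv/= lte_fin IH; last by move=> i; rewrite !mxE.
rewrite EFinM; congr (_ * _)%E; last by congr EFin; apply: eq_bigr => i _; rewrite !mxE.
case: ltP => [//|ba].
by apply/esym/eqP; rewrite eqe subr_eq0 eq_le ba ab.
Qed.

End rV_lebesgue.

Section complex_measure.
Context d (T : measurableType d) {R : realType}.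

(* The value does not depend on the Hahn decomposition that is chosen. *)
Definition charge_integral (nu : {charge set T -> \bar R}) (f : T -> R) : R :=
  let: exist P exN := cid (Hahn_decomposition nu) in
  let: exist N nuPN := cid exN in
  \int[jordan_pos nuPN]_x f x - \int[jordan_neg nuPN]_x f x.

(* The complex measure cm_Re + i cm_Im. Charges are finite on every measurable
   set, as a compactly supported Radon measure is; conversely a finite complex
   Borel measure on R^n is automatically Radon. *)
Record complex_measure := ComplexMeasure {
  cm_Re : {charge set T -> \bar R} ;
  cm_Im : {charge set T -> \bar R} }.

Definition cm_integral (mu : complex_measure) (f : T -> R[i]) : R[i] :=
  Complex
  (charge_integral (cm_Re mu) (fun x => complex.Re (f x)) -
   charge_integral (cm_Im mu) (fun x => complex.Im (f x)))
  (charge_integral (cm_Re mu) (fun x => complex.Im (f x)) +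
   charge_integral (cm_Im mu) (fun x => complex.Re (f x))).

Definition cmeasurable (f : T -> R[i]) : Prop :=
  measurable_fun setT (fun x => complex.Re (f x)) /\
  measurable_fun setT (fun x => complex.Im (f x)).

Definition cintegral (m : {measure set T -> \bar R}) (f : T -> R[i]) : R[i] :=
  Complex (\int[m]_x complex.Re (f x)) (\int[m]_x complex.Im (f x)).

End complex_measure.
Arguments complex_measure {d} T R.

(* Operators on L^2(R^n) are functions on representatives: the equalities
   below are almost everywhere, and bounded_operator makes an operator
   compatible with almost everywhere equality (apply linearity and the bound
   to f - g). *)
Section L2.
Context {R : realType} (n : nat).
Local Notation C := R[i].
Local Notation fn := ('rV[R]_n -> C).
Local Notation leb := (rV_lebesgue (R := R) n).
Implicit Types (f g : fn) (T S : fn -> fn).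

Definition L2norm f : \bar R := ('N[leb]_2%:E [EFin \o (fun t => Normc.normc (f t))])%E.

Definition L2 : set fn := [set f | cmeasurable f /\ (L2norm f < +oo)%E].

Definition L2inner f g : C := cintegral leb (fun t => f t * (g t)^*).

Definition bounded_operator T : Prop :=
  [/\ forall f, L2 f -> L2 (T f),
      forall (a : C) f g, L2 f -> L2 g ->
        ae_eq leb setT (T (fun t => a * f t + g t)) (fun t => a * T f t + T g t)
    & exists M : R, forall f, L2 f -> (L2norm (T f) <= M%:E * L2norm f)%E].

Definition compact_operator T : Prop :=
  bounded_operator T /\
  forall u : nat -> fn, (forall k, L2 (u k)) ->
    (exists M : R, forall k, (L2norm (u k) <= M%:E)%E) ->
    exists2 phi : nat -> nat, {homo phi : i j / (i < j)%N} &
    exists2 g, L2 g &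
      L2norm (fun t => T (u (phi k)) t - g t) @[k --> \oo] --> 0%E.

Definition is_adjoint T S : Prop :=
  bounded_operator S /\
  forall f g, L2 f -> L2 g -> L2inner (T f) g = L2inner f (S g).

Definition L2eigenspace T (lam : C) : set fn :=
  [set v | L2 v /\ ae_eq leb setT (T v) (fun t => lam * v t)].

Definition L2dim (E : set fn) (k : nat) : Prop :=
  exists e : 'I_k -> fn,
  [/\ forall i, E (e i),
      forall c : 'I_k -> C,
        ae_eq leb setT (fun t => \sum_i c i * e i t) (fun=> 0) ->
        forall i, c i = 0
    & forall v, E v -> exists c : 'I_k -> C,
        ae_eq leb setT v (fun t => \sum_i c i * e i t)].

(* s lists the singular values of a compact operator T, i.e. the eigenvalues
   of |T| = sqrt (T^* T), in nonincreasing order: every r > 0 occurs in s as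
   many times as its multiplicity as an eigenvalue of |T|, which is
   dim ker (T^* T - r^2). If T has finite rank, s is padded with zeros. *)
Definition singular_values T (s : nat -> R) : Prop :=
  [/\ forall k, 0 <= s k,
      nonincreasing_seq s
    & exists2 S, is_adjoint T S &
      forall r : R, 0 < r -> exists2 k : nat,
        ([set j | s j = r] #= `I_k)%card &
        L2dim (L2eigenspace (S \o T) (r ^+ 2)%:C%C) k].

Definition schatten (p : \bar R) T : Prop :=
  match p with
  | r%:E => compact_operator T /\
      exists2 s, singular_values T s &
        (\sum_(0 <= k <oo) (s k `^ r)%:E < +oo)%E
  | +oo%E => bounded_operator T
  | -oo%E => False
  end.

End L2.

Section schrodinger.
Context {R : realType} (n : nat).
Local Notation C := R[i].
Local Notation phase := ('rV[R]_n * 'rV[R]_n)%type.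

(* e^(i a) *)
Definition expi (a : R) : C := Complex (cos a) (sin a).

Definition dotv (x y : 'rV[R]_n) : R := \sum_i x ord0 i * y ord0 i.

(* A point z of R^n x R^n is (x, xi) = (z.1, z.2). *)
Definition phase_norm (z : phase) : R := Num.sqrt (dotv z.1 z.1 + dotv z.2 z.2).

Definition symplectic (z w : phase) : R := dotv w.1 z.2 - dotv z.1 w.2.

Definition symplectic_fourier (mu : complex_measure phase R) (zeta : phase) : C :=
  cm_integral mu (fun z => expi (- 2 * pi * symplectic zeta z)).

Definition rho (z : phase) (g : 'rV[R]_n -> C) : 'rV[R]_n -> C :=
  fun t => expi (- pi * dotv z.1 z.2) * expi (2 * pi * dotv t z.2) * g (t - z.1).

Definition compactly_supported (mu : complex_measure phase R) : Prop :=
  exists2 K : set phase, compact K &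
    forall A, measurable A -> A `<=` ~` K ->
      cm_Re mu A = 0%E /\ cm_Im mu A = 0%E.

(* L is the weak integral of rho(z) d mu(z), the Weyl quantization of the
   symplectic Fourier transform of mu; L2inner being nondegenerate, this
   determines L f up to almost everywhere equality. *)
Definition is_weyl_operator (mu : complex_measure phase R)
    (L : ('rV[R]_n -> C) -> ('rV[R]_n -> C)) : Prop :=
  bounded_operator L /\
  forall f g, L2 f -> L2 g ->
    L2inner (L f) g = cm_integral mu (fun z => L2inner (rho z f) g).

End schrodinger.

(* Main.v *)
Require Import Defs.
From HB Require Import structures.
From mathcomp Require Import all_boot all_order all_algebra.
From mathcomp Require Import all_classical all_reals all_analysis complex.
From mathcomp Require Import measurable_realfun ring lra zify.

(* Write T for the operator int rho(z) dmu(z) and a for F_sigma(mu). A bounded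
   operator T is in S^p as soon as sum_k |<T e_k, f_k>|^p is bounded uniformly
   over finite orthonormal families (e_k) and (f_k): T is then compact, and its
   singular vectors turn the bound into sum_k s_k^p < oo.
   To get this bound, cut f along the cubes y + [0,1[^d and expand e in Fourier
   series on the boxes |t_j - y_j| < L, where L exceeds the size of the support
   of mu. On such a cube, the phase of rho(x, xi) is
   exp(2 pi i y.xi) exp(2 pi i (tau - x/2).xi) with tau = t - y, and the last
   factor is, for bounded (x, xi, tau), a uniform limit of sums of characters
   sum_m c_m exp(2 pi i (k_m.xi - l_m.x + w_m.tau)) with sum_m |c_m| bounded.
   Integrating against mu, <T e, f> becomes a limit of sums of the terms
   c_m a(zeta) <e, g> <h, f> over the points zeta = (y + k_m, eta/(2L) + l_m) of
   translated lattices, where the families g and h satisfy Bessel inequalities.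
   Jensen's inequality bounds sum_k |<T e_k, f_k>|^p by the sum of |a(zeta)|^p
   over the lattice, which is finite when p beta / 2 > 2 d. *)

Set Implicit Arguments.
Unset Strict Implicit.
Unset Printing Implicit Defensive.

Import Order.TTheory GRing.Theory Num.Theory.
Import numFieldNormedType.Exports.

Local Open Scope classical_set_scope.
Local Open Scope ring_scope.

(** The sizes of cubes and boxes are dictated by translations: if |x_j| <= lam and t lies in a unit
    cube, then t - x lies in the box of half-width L = lam + 1 around it, so that [rho] sends an
    exponential on the box, seen from the cube, to itself times phases. The phase that depends on z
    alone is a character exp(-2 pi i sigma(zeta, z)), which integrates to a(zeta). The remaining
    phase is bilinear and couples x, xi and tau; the obstacle is to separate these variables with
    coefficients whose total mass stays bounded as the precision improves. This is done in a Wiener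
    algebra: a rescaled coordinate th has |th| <= 1 and equals asin (sin th), hence is a limit of
    trigonometric polynomials of bounded mass, and sums, products and exponentials preserve this
    property. The lattice has dimension 2d and |a|^p decays with exponent p beta / 2, whence the
    threshold 4d / beta. Since the estimates concern finite families, with constants independent of
    their length, a uniform approximation by finite sums is enough. *)

Notation nc := Normc.normc.

(** * Modulus, conjugation and unimodular exponentials *)

Section complex_facts.
Variable R : realType.
Implicit Types (x y z : R[i]) (a b : R).

Lemma ncE x : nc x = Num.sqrt (complex.Re x ^+ 2 + complex.Im x ^+ 2).
Proof. by case: x. Qed.

Lemma nc_ge0 x : 0 <= nc x.
Proof. by rewrite ncE sqrtr_ge0. Qed.

Lemma sqr_nc x : nc x ^+ 2 = complex.Re x ^+ 2 + complex.Im x ^+ 2.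
Proof. by rewrite ncE sqr_sqrtr// addr_ge0// sqr_ge0. Qed.

Lemma ncM x y : nc (x * y) = nc x * nc y. Proof. exact: Normc.normcM. Qed.
Lemma ncN x : nc (- x) = nc x. Proof. exact: normcN. Qed.
Lemma nc0 : nc (0 : R[i]) = 0. Proof. exact: Normc.normc0. Qed.
Lemma nc1 : nc (1 : R[i]) = 1. Proof. exact: Normc.normc1. Qed.
Lemma nc_eq0 x : nc x = 0 -> x = 0. Proof. exact: Normc.eq0_normc. Qed.

Lemma conjcE x : x^* = Complex (complex.Re x) (- complex.Im x).
Proof. by case: x. Qed.

Lemma ncJ x : nc (x^*) = nc x.
Proof. by rewrite conjcE !ncE /= sqrrN. Qed.

Lemma ncD x y : nc (x + y) <= nc x + nc y.
Proof. exact: le_normcD. Qed.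

Lemma ncB x y : nc (x - y) <= nc x + nc y.
Proof. by rewrite -(ncN y) ncD. Qed.

Lemma nc_distC x y : nc (x - y) = nc (y - x).
Proof. by rewrite -ncN opprB. Qed.

Lemma nc_real a : nc (a%:C)%C = `|a|.
Proof. by rewrite ncE /= expr0n addr0 sqrtr_sqr. Qed.

Lemma nc_sum I (r : seq I) (P : pred I) (F : I -> R[i]) :
  nc (\sum_(i <- r | P i) F i) <= \sum_(i <- r | P i) nc (F i).
Proof.
elim/big_ind2: _ => [|x1 x2 y1 y2 h1 h2|//]; first by rewrite nc0.
by rewrite (le_trans (ncD _ _))// lerD.
Qed.

Lemma ncX x n : nc (x ^+ n) = nc x ^+ n.
Proof. by elim: n => [|n IH]; rewrite ?nc1// !exprS ncM IH. Qed.

Lemma nc_prod I (r : seq I) (P : pred I) (F : I -> R[i]) :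
  nc (\prod_(i <- r | P i) F i) = \prod_(i <- r | P i) nc (F i).
Proof.
by elim/big_ind2: _ => [|x1 x2 y1 y2 <- <-|//]; rewrite ?nc1 ?ncM.
Qed.

Lemma cReD x y : complex.Re (x + y) = complex.Re x + complex.Re y.
Proof. by case: x => ? ?; case: y. Qed.
Lemma cImD x y : complex.Im (x + y) = complex.Im x + complex.Im y.
Proof. by case: x => ? ?; case: y. Qed.
Lemma cReN x : complex.Re (- x) = - complex.Re x. Proof. by case: x. Qed.
Lemma cImN x : complex.Im (- x) = - complex.Im x. Proof. by case: x. Qed.
Lemma cReB x y : complex.Re (x - y) = complex.Re x - complex.Re y.
Proof. by rewrite cReD cReN. Qed.
Lemma cImB x y : complex.Im (x - y) = complex.Im x - complex.Im y.
Proof. by rewrite cImD cImN. Qed.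
Lemma cReM x y : complex.Re (x * y) =
  complex.Re x * complex.Re y - complex.Im x * complex.Im y.
Proof. by case: x => ? ?; case: y. Qed.
Lemma cImM x y : complex.Im (x * y) =
  complex.Re x * complex.Im y + complex.Im x * complex.Re y.
Proof. by case: x => ? ?; case: y. Qed.
Lemma cReJ x : complex.Re (x^*) = complex.Re x. Proof. by case: x. Qed.
Lemma cImJ x : complex.Im (x^*) = - complex.Im x. Proof. by case: x. Qed.

Lemma normr_Re x : `|complex.Re x| <= nc x.
Proof.
rewrite -(ler_pXn2r (_ : 0 < 2)%N) ?nnegrE ?nc_ge0//.
by rewrite sqr_nc real_normK ?num_real// lerDl sqr_ge0.
Qed.

Lemma normr_Im x : `|complex.Im x| <= nc x.
Proof.
rewrite -(ler_pXn2r (_ : 0 < 2)%N) ?nnegrE ?nc_ge0//.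
by rewrite sqr_nc real_normK ?num_real// lerDr sqr_ge0.
Qed.

Lemma Re_le_nc x : complex.Re x <= nc x.
Proof. exact: le_trans (ler_norm _) (normr_Re x). Qed.

Lemma nc_le_ReIm x : nc x <= `|complex.Re x| + `|complex.Im x|.
Proof.
rewrite -(ler_pXn2r (_ : 0 < 2)%N) ?nnegrE ?nc_ge0 ?addr_ge0//.
rewrite sqr_nc sqrrD !real_normK ?num_real//.
by rewrite lerD2r lerDl mulrn_wge0// mulr_ge0.
Qed.

Lemma mulcJ x : x * x^* = (nc x ^+ 2)%:C%C.
Proof.
rewrite sqr_nc conjcE; case: x => a b.
by apply/eqP; rewrite eq_complex /= mulrN opprK -!expr2 mulrN mulrC addNr !eqxx.
Qed.

Lemma conj_realc a : (a%:C%C : R[i])^* = a%:C%C.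
Proof. by rewrite conjcE /= oppr0. Qed.

Lemma eq_complexP x y : complex.Re x = complex.Re y ->
  complex.Im x = complex.Im y -> x = y.
Proof. by case: x => ? ?; case: y => ? ? /= -> ->. Qed.

Lemma expiD a b : expi (a + b) = expi a * expi b.
Proof.
by apply: eq_complexP; rewrite ?cReM ?cImM /= ?cosD ?sinD// addrC.
Qed.

Lemma expi0 : expi (0 : R) = 1.
Proof. by rewrite /expi cos0 sin0. Qed.

Lemma nc_expi a : nc (expi a) = 1.
Proof. by rewrite ncE /= cos2Dsin2 sqrtr1. Qed.

Lemma conj_expi a : (expi a)^* = expi (- a).
Proof. by rewrite conjcE /expi /= cosN sinN. Qed.

Lemma expiN a : expi (- a) * expi a = 1.
Proof. by rewrite -expiD addNr expi0. Qed.

Lemma expi_sum I (r : seq I) (P : pred I) (F : I -> R) :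
  expi (\sum_(i <- r | P i) F i) = \prod_(i <- r | P i) expi (F i).
Proof. by elim/big_ind2: _ => [|x1 x2 y1 y2 <- <-|//]; rewrite ?expi0 ?expiD. Qed.

End complex_facts.

(** * Semi-inner product spaces *)

(* Positive semidefinite: the elements of L2type below are functions, so that a
   vector of norm 0 need not be 0. *)
Record semi_inner (R : realType) (V : lmodType R[i]) := SemiInner {
  sip :> V -> V -> R[i] ;
  sip_linear : forall a u v w, sip (a *: u + v) w = a * sip u w + sip v w ;
  sip_conj : forall u v, sip v u = (sip u v)^* ;
  sip_ge0 : forall u, 0 <= complex.Re (sip u u) }.

Section hilbert.
Context {R : realType} {V : lmodType R[i]}.
Variable ip : semi_inner V.
Local Notation C := R[i].
Implicit Types (u v w : V) (a b : C).

Lemma ipDl u v w : ip (u + v) w = ip u w + ip v w.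
Proof. by rewrite -[u]scale1r sip_linear mul1r scale1r. Qed.

Lemma ip0l w : ip 0 w = 0.
Proof. by apply: (addIr (ip 0 w)); rewrite -ipDl !add0r. Qed.

Lemma ipZl a u w : ip (a *: u) w = a * ip u w.
Proof. by rewrite -[_ *: u]addr0 sip_linear ip0l addr0. Qed.

Lemma ipNl u w : ip (- u) w = - ip u w.
Proof. by rewrite -scaleN1r ipZl mulN1r. Qed.

Lemma ipBl u v w : ip (u - v) w = ip u w - ip v w.
Proof. by rewrite ipDl ipNl. Qed.

Lemma ipDr u v w : ip w (u + v) = ip w u + ip w v.
Proof. by rewrite sip_conj ipDl rmorphD/= -!sip_conj. Qed.

Lemma ip0r w : ip w 0 = 0.
Proof. by rewrite sip_conj ip0l rmorph0. Qed.

Lemma ipZr a u w : ip w (a *: u) = a^* * ip w u.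
Proof. by rewrite sip_conj ipZl rmorphM/= -sip_conj. Qed.

Lemma ipNr u w : ip w (- u) = - ip w u.
Proof. by rewrite sip_conj ipNl rmorphN/= -sip_conj. Qed.

Lemma ipBr u v w : ip w (u - v) = ip w u - ip w v.
Proof. by rewrite ipDr ipNr. Qed.

Lemma ip_suml I (r : seq I) (P : pred I) (F : I -> V) w :
  ip (\sum_(i <- r | P i) F i) w = \sum_(i <- r | P i) ip (F i) w.
Proof.
by elim/big_ind2: _ => [|x1 x2 y1 y2 <- <-|//]; rewrite ?ip0l ?ipDl.
Qed.

Lemma ip_sumr I (r : seq I) (P : pred I) (F : I -> V) w :
  ip w (\sum_(i <- r | P i) F i) = \sum_(i <- r | P i) ip w (F i).
Proof.
by elim/big_ind2: _ => [|x1 x2 y1 y2 <- <-|//]; rewrite ?ip0r ?ipDr.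
Qed.

Lemma Im_ip u : complex.Im (ip u u) = 0.
Proof.
have := congr1 (@complex.Im R) (sip_conj ip u u); rewrite cImJ; lra.
Qed.

Definition nrm2 u : R := complex.Re (ip u u).
Definition nrm u : R := Num.sqrt (nrm2 u).

Lemma nrm2_Re u : nrm2 u = complex.Re (ip u u). Proof. by []. Qed.
Lemma nrm_Re u : nrm u = Num.sqrt (complex.Re (ip u u)). Proof. by []. Qed.

Lemma nrm2_ge0 u : 0 <= nrm2 u. Proof. exact: sip_ge0. Qed.
Lemma nrm_ge0 u : 0 <= nrm u. Proof. exact: sqrtr_ge0. Qed.
Lemma sqr_nrm u : nrm u ^+ 2 = nrm2 u. Proof. exact: sqr_sqrtr (nrm2_ge0 u). Qed.
Lemma ip_nrm2 u : ip u u = (nrm2 u)%:C%C.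
Proof. by apply: eq_complexP => //=; rewrite Im_ip. Qed.

Lemma nrm2D u v : nrm2 (u + v) = nrm2 u + nrm2 v + 2 * complex.Re (ip u v).
Proof.
rewrite /nrm2 ipDl !ipDr !cReD (sip_conj ip u v) cReJ; lra.
Qed.

Lemma nrm2Z a u : nrm2 (a *: u) = nc a ^+ 2 * nrm2 u.
Proof.
by rewrite /nrm2 ipZl ipZr mulrA mulcJ ip_nrm2 cReM /= mul0r subr0.
Qed.

Lemma nrm2N u : nrm2 (- u) = nrm2 u.
Proof. by rewrite /nrm2 ipNl ipNr opprK. Qed.

Lemma nrm2B u v : nrm2 (u - v) = nrm2 u + nrm2 v - 2 * complex.Re (ip u v).
Proof. by rewrite nrm2D nrm2N ipNr cReN mulrN. Qed.

Lemma nrmZ a u : nrm (a *: u) = nc a * nrm u.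
Proof.
by rewrite /nrm nrm2Z sqrtrM ?sqr_ge0// sqrtr_sqr ger0_norm ?nc_ge0.
Qed.

Lemma nrmN u : nrm (- u) = nrm u. Proof. by rewrite /nrm nrm2N. Qed.

Lemma nrm0 : nrm 0 = 0.
Proof. by rewrite /nrm /nrm2 ip0l /= sqrtr0. Qed.

Lemma nrm_distC u v : nrm (u - v) = nrm (v - u).
Proof. by rewrite -nrmN opprB. Qed.

(** The vector u - t <u, v> v has a nonnegative square norm for every real t. A vector of norm 0
    need not pair to 0 by definition, so the minimizing t = 1 / |v|^2 serves only when |v| is
    nonzero. *)
Lemma cauchy_schwarz u v : nc (ip u v) <= nrm u * nrm v.
Proof.
have key (t : R) : 0 <= nrm2 u + t ^+ 2 * nc (ip u v) ^+ 2 * nrm2 v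
    - 2 * t * nc (ip u v) ^+ 2.
  have := nrm2_ge0 (u - (t%:C%C * ip u v) *: v).
  rewrite nrm2B nrm2Z ncM nc_real ipZr rmorphM/=.
  rewrite -mulrA (mulrC (ip u v)^*) mulcJ exprMn real_normK ?num_real//.
  rewrite cReM cReJ /= mulr0 subr0; lra.
rewrite -(ler_pXn2r (_ : 0 < 2)%N) ?nnegrE ?nc_ge0 ?mulr_ge0 ?nrm_ge0//.
rewrite exprMn !sqr_nrm.
have u0 := nrm2_ge0 u; have v0 := nrm2_ge0 v.
set X := nc _ ^+ 2 in key *.
have X0 : 0 <= X by rewrite sqr_ge0.
have [v00|v00] := eqVneq (nrm2 v) 0.
  (* Here the inequality is affine in t, and this t makes it read 0 <= - nrm2 u - 2 unless X = 0. *)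
  have := key ((nrm2 u + 1) / X); rewrite v00 !mulr0 addr0.
  have [->//|X00] := eqVneq X 0.
  by rewrite -mulrA divfK//; lra.
have vp : 0 < nrm2 v by lra.
have := key (nrm2 v)^-1.
rewrite (_ : _ ^+ 2 * X * nrm2 v = (nrm2 v)^-1 * X); last by field.
by rewrite -ler_pdivrMr// mulrC; lra.
Qed.

Lemma Re_ip_le u v : complex.Re (ip u v) <= nrm u * nrm v.
Proof. exact: le_trans (Re_le_nc _) (cauchy_schwarz u v). Qed.

Lemma nrmD u v : nrm (u + v) <= nrm u + nrm v.
Proof.
rewrite -(ler_pXn2r (_ : 0 < 2)%N) ?nnegrE ?addr_ge0 ?nrm_ge0//.
rewrite sqrrD !sqr_nrm nrm2D; have := Re_ip_le u v; lra.
Qed.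

Lemma nrmB u v : nrm (u - v) <= nrm u + nrm v.
Proof. by rewrite -(nrmN v) nrmD. Qed.

Lemma nrm_dist_add w u v : nrm (u - v) <= nrm (u - w) + nrm (w - v).
Proof. by apply: le_trans (nrmD _ _); rewrite addrA subrK. Qed.

Lemma nrm_sum I (r : seq I) (P : pred I) (F : I -> V) :
  nrm (\sum_(i <- r | P i) F i) <= \sum_(i <- r | P i) nrm (F i).
Proof.
elim/big_ind2: _ => [|x1 x2 y1 y2 h1 h2|//]; first by rewrite nrm0.
by rewrite (le_trans (nrmD _ _))// lerD.
Qed.

Lemma nrm_ip0l u v : nrm u = 0 -> ip u v = 0.
Proof.
move=> u0; apply: nc_eq0; apply/eqP; rewrite eq_le nc_ge0 andbT.
by have := cauchy_schwarz u v; rewrite u0 mul0r.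
Qed.

Lemma nrm_ip0r u v : nrm v = 0 -> ip u v = 0.
Proof. by move=> v0; rewrite sip_conj nrm_ip0l// rmorph0. Qed.

Lemma nrm_eq0 u : ip u u = 0 -> nrm u = 0.
Proof. by move=> u0; rewrite /nrm /nrm2 u0 /= sqrtr0. Qed.

Lemma nrm1_ip u : nrm u = 1 -> ip u u = 1.
Proof. by move=> u1; rewrite ip_nrm2 -sqr_nrm u1 expr1n. Qed.

Definition orthonormal (I : eqType) (P : pred I) (e : I -> V) :=
  {in P &, forall i j, ip (e i) (e j) = (i == j)%:R}.

Lemma nrm2_proj_dist (I : eqType) (r : seq I) (P : pred I) (e : I -> V) v :
  uniq r -> {in r, forall i, P i} -> orthonormal P e ->
  nrm2 (v - \sum_(i <- r) ip v (e i) *: e i) =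
  nrm2 v - \sum_(i <- r) nc (ip v (e i)) ^+ 2.
Proof.
move=> ur rP oe; rewrite nrm2B.
have -> : complex.Re (ip v (\sum_(i <- r) ip v (e i) *: e i)) =
    \sum_(i <- r) nc (ip v (e i)) ^+ 2.
  rewrite ip_sumr (eq_bigr (fun i => (nc (ip v (e i)) ^+ 2)%:C%C)).
    by elim/big_ind2: _ => [|x1 x2 y1 y2 <- <-|//]; rewrite // cReD.
  by move=> i _; rewrite ipZr mulrC mulcJ.
suff -> : nrm2 (\sum_(i <- r) ip v (e i) *: e i) =
    \sum_(i <- r) nc (ip v (e i)) ^+ 2 by lra.
rewrite /nrm2 ip_suml.
rewrite (eq_big_seq (fun i => (nc (ip v (e i)) ^+ 2)%:C%C)).
  by elim/big_ind2: _ => [|x1 x2 y1 y2 <- <-|//]; rewrite // cReD.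
move=> i ri /=; rewrite ip_sumr (bigD1_seq i)//= ipZr ipZl big1_seq.
  by rewrite [X in _ * (_ * X)]oe ?unfold_in ?rP// eqxx mulr1 addr0 mulrC mulcJ.
move=> j /andP[ji rj]; rewrite ipZr ipZl oe ?unfold_in ?rP//.
by rewrite eq_sym (negbTE ji) !mulr0.
Qed.

Lemma bessel (I : eqType) (r : seq I) (P : pred I) (e : I -> V) v :
  uniq r -> {in r, forall i, P i} -> orthonormal P e ->
  \sum_(i <- r) nc (ip v (e i)) ^+ 2 <= nrm2 v.
Proof.
move=> ur rP oe; have := nrm2_ge0 (v - \sum_(i <- r) ip v (e i) *: e i).
by rewrite (nrm2_proj_dist v ur rP oe) subr_ge0.
Qed.

Lemma ip_proj_orth (I : eqType) (r : seq I) (P : pred I) (e : I -> V) v j :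
  uniq r -> {in r, forall i, P i} -> orthonormal P e -> j \in r ->
  ip (v - \sum_(i <- r) ip v (e i) *: e i) (e j) = 0.
Proof.
move=> ur rP oe rj; rewrite ipBl ip_suml (bigD1_seq j)//= ipZl oe ?unfold_in ?rP//.
rewrite eqxx mulr1 big1_seq ?addr0 ?subrr// => i /andP[ij ri].
by rewrite ipZl oe ?unfold_in ?rP// (negbTE ij) mulr0.
Qed.

Definition orth N (e : nat -> V) := orthonormal (fun i => i < N)%N e.

Lemma orth_ext N (e : nat -> V) v : orth N e ->
  (forall i, (i < N)%N -> ip v (e i) = 0) -> nrm v = 1 ->
  orth N.+1 (fun i => if (i < N)%N then e i else v).
Proof.
move=> oe ve v1 i j; rewrite !unfold_in !ltnS => iN jN.
case: ifPn => iN'; case: ifPn => jN'.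
- exact: oe.
- have -> : (i == j) = false by apply/negbTE; lia.
  by rewrite sip_conj ve// rmorph0.
- have -> : (i == j) = false by apply/negbTE; lia.
  by rewrite ve.
- have -> : (i == j) = true by apply/eqP; lia.
  exact: nrm1_ip.
Qed.

Definition ncinv (r : R) : C := (r^-1)%:C%C.

Lemma nrm_normalize u : nrm u != 0 -> nrm (ncinv (nrm u) *: u) = 1.
Proof.
by move=> u0; rewrite nrmZ nc_real ger0_norm ?invr_ge0 ?nrm_ge0// mulVf.
Qed.

(** The conclusion is about orthogonal vectors instead of spans: this is all that the later greedy
    choice needs. A vector of [L] whose residual after projection has norm 0 adds nothing to the
    family, so dependent vectors are allowed. *)
Lemma gram_schmidt (L : seq V) : exists N e, orth N e /\
  forall u, (forall i, (i < N)%N -> ip u (e i) = 0) ->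
  {in L, forall v, ip u v = 0}.
Proof.
elim: L => [|v L [N [e [oe eL]]]]; first by exists 0%N, (fun=> 0).
pose v' := v - \sum_(i <- iota 0 N) ip v (e i) *: e i.
have uv u : (forall i, (i < N)%N -> ip u (e i) = 0) -> ip u v = ip u v'.
  move=> ue; rewrite ipBr ip_sumr big1_seq ?subr0// => i /=.
  by rewrite mem_iota add0n => iN; rewrite ipZr ue// mulr0.
have [v'0|v'0] := eqVneq (nrm v') 0.
  exists N, e; split => // u ue x; rewrite inE => /predU1P[->|xL].
    by rewrite uv// nrm_ip0r.
  exact: eL.
pose w := ncinv (nrm v') *: v'.
have we i : (i < N)%N -> ip w (e i) = 0.
  move=> iN; rewrite ipZl (@ip_proj_orth _ _ (fun i => i < N)%N) ?mulr0//.
    exact: iota_uniq.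
  by move=> k; rewrite mem_iota.
  by rewrite mem_iota.
exists N.+1, (fun i => if (i < N)%N then e i else w); split.
  by apply: orth_ext => //; exact: nrm_normalize.
move=> u ue.
have ueN i : (i < N)%N -> ip u (e i) = 0.
  by move=> iN; have := ue i (ltnW iN); rewrite iN.
have uw : ip u v' = 0.
  have := ue N (ltnSn N); rewrite ltnn ipZr => /eqP; rewrite mulf_eq0.
  case/orP => [|/eqP//]; rewrite conjcE eq_complex /= invr_eq0.
  by rewrite (negbTE v'0).
move=> x; rewrite inE => /predU1P[->|xL]; first by rewrite uv.
exact: eL.
Qed.

End hilbert.

(** * Completeness: Riesz representation and orthogonal expansions *)

Section complete.
Context {R : realType} {V : lmodType R[i]}.
Variable ip : semi_inner V.
Local Notation C := R[i].
Local Notation nrm := (nrm ip).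
Local Notation nrm2 := (nrm2 ip).
Implicit Types (u v w : V) (a b : C).

Definition half_pow (j : nat) : R := (2^-1) ^+ j.

Lemma half_pow_gt0 j : 0 < half_pow j.
Proof. by rewrite exprn_gt0// invr_gt0. Qed.

Lemma half_pow_ge0 j : 0 <= half_pow j.
Proof. exact/ltW/half_pow_gt0. Qed.

Lemma half_powS j : half_pow j = 2 * half_pow j.+1.
Proof. by rewrite /half_pow exprS mulrA divff ?mul1r. Qed.

Lemma half_pow_lt (e : R) : 0 < e -> exists j, half_pow j < e.
Proof.
move=> e0; have h2 : `|2^-1 : R| < 1 by rewrite ger0_norm; lra.
have /cvgrPdist_lt/(_ e e0) [N _ /(_ N (leqnn N))] := cvg_expr h2.
by rewrite sub0r normrN ger0_norm ?half_pow_ge0// => h; exists N.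
Qed.

Lemma half_pow_le i j : (i <= j)%N -> half_pow j <= half_pow i.
Proof.
move=> ij; rewrite /half_pow ler_wiXn2l//; lra.
Qed.

(** Completeness with a rate: steps of size 2^-j, and the tail 2 * 2^-j of the geometric series as
    distance to the limit. No topology on [V] is involved, and [g] is determined only up to norm
    0. *)
Definition complete_ip := forall v : nat -> V,
  (forall j, nrm (v j.+1 - v j) <= half_pow j) ->
  exists g, forall j, nrm (v j - g) <= 2 * half_pow j.

Hypothesis cpl : complete_ip.

Lemma le0_half_pow (x K : R) : (forall j, x <= K * half_pow j) -> x <= 0.
Proof.
move=> h; rewrite leNgt; apply/negP => x0.
have K0 : 0 < K by have := h 0%N; rewrite /half_pow expr0 mulr1; exact: lt_le_trans.
have [j] := half_pow_lt (divr_gt0 x0 K0).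
by rewrite ltr_pdivlMr// mulrC ltNge h.
Qed.

Lemma eq0_half_pow (x K : R) : 0 <= x -> (forall j, x <= K * half_pow j) -> x = 0.
Proof. by move=> x0 /le0_half_pow x1; apply/eqP; rewrite eq_le x0 x1. Qed.

(** Variational proof: J(w) = |w|^2 - 2 Re phi(w) is bounded below by - K^2, the parallelogram
    identity turns a minimizing sequence into a Cauchy sequence, and the first variation of J along
    this sequence identifies phi with the pairing. *)
Lemma riesz (phi : V -> C) (K : R) :
  (forall a u v, phi (a *: u + v) = a * phi u + phi v) ->
  (forall u, nc (phi u) <= K * nrm u) -> exists w, forall u, phi u = ip u w.
Proof.
move=> phil phiK.
have phi0 : phi 0 = 0.
  by have := phil 1 0 0; rewrite scale1r addr0 mul1r => /eqP; rewrite -subr_eq subrr => /eqP.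
have phiZ a u : phi (a *: u) = a * phi u by rewrite -[_ *: u]addr0 phil phi0 addr0.
have phiD u v : phi (u + v) = phi u + phi v by rewrite -[u]scale1r phil mul1r scale1r.
pose J w := nrm2 w - 2 * complex.Re (phi w).
have Jge w : - K ^+ 2 <= J w.
  have h1 := le_trans (Re_le_nc _) (phiK w).
  have h2 := sqr_ge0 (nrm w - K); rewrite sqrrB sqr_nrm in h2.
  rewrite /J; lra.
pose S := range J.
have infS : has_inf S.
  split; first by exists (J 0); exists 0.
  by exists (- K ^+ 2) => _ [w _ <-].
have minS w : inf S <= J w by apply: ge_inf; [exact: infS.2 | exists w].
(* Since |w_{j+1} - w_j|^2 <= 2 (del j + del j.+1) <= 4 del j, this value gives steps of size
   2^-j. *)
pose del j : R := half_pow j ^+ 2 / 4.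
have del0 j : 0 < del j by rewrite divr_gt0// exprn_gt0// half_pow_gt0.
have /choice[w wP] j : exists w, J w < inf S + del j.
  by have [_ [w _ <-]] := inf_adherent (del0 j) infS; exists w.
have JD u v : J (u + v) = J u + nrm2 v + 2 * complex.Re (ip v u - phi v).
  rewrite /J nrm2D phiD !cReD !cReN (sip_conj ip v u) cReJ; lra.
have par u v : nrm2 (u - v) = 2 * (J u + J v - 2 * J ((1/2)%:C%C *: (u + v))).
  rewrite /J !phiZ !phiD !nrm2Z nrm2B nrm2D nc_real cReM /= mul0r subr0 cReD.
  rewrite ger0_norm; last by lra.
  by field.
have [|g gP] := cpl (v := w).
  move=> j; rewrite -(ler_pXn2r (_ : 0 < 2)%N) ?nnegrE ?nrm_ge0 ?half_pow_ge0//.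
  rewrite sqr_nrm par; have h1 := wP j; have h2 := wP j.+1.
  have h3 := minS ((1/2)%:C%C *: (w j.+1 + w j)).
  have h4 : del j.+1 <= del j.
    rewrite /del ler_pM2r// ler_pXn2r ?nnegrE ?half_pow_ge0//.
    exact: half_pow_le.
  have h5 : half_pow j ^+ 2 = 4 * del j by rewrite /del; field.
  lra.
exists g => h; apply/eqP; rewrite -subr_eq0; apply/eqP/nc_eq0.
(* Moving w_j in the direction h by - t conj(X) cannot bring J below its infimum. The optimal t is 1
   / |h|^2; the added 1 covers |h| = 0. *)
have psi j : nc (ip h (w j) - phi h) ^+ 2 <= del j * (nrm2 h + 1).
  set X := ip h (w j) - phi h.
  pose t := (nrm2 h + 1)^-1.
  have h0 := nrm2_ge0 ip h.
  have t0 : 0 < t by rewrite invr_gt0; lra.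
  have th : t * nrm2 h <= 1 by rewrite mulrC ler_pdivrMr; lra.
  have := minS (w j + (- t%:C%C * X^*) *: h).
  rewrite JD nrm2Z ncM ncN nc_real ncJ ipZl phiZ -mulrBr -/X.
  rewrite (_ : - t%:C%C * X^* * X = (- t * nc X ^+ 2)%:C%C); last first.
    by rewrite rmorphM rmorphN /= -mulcJ; ring.
  rewrite exprMn real_normK ?num_real//.
  have := wP j => h1 h2.
  have X0 : 0 <= nc X ^+ 2 by exact: sqr_ge0.
  have h3 : t ^+ 2 * nc X ^+ 2 * nrm2 h <= t * nc X ^+ 2.
    rewrite (_ : _ * _ * _ = t * nc X ^+ 2 * (t * nrm2 h)); last by ring.
    by rewrite ler_piMr// mulr_ge0// ltW.
  have h4 : t * nc X ^+ 2 <= del j by rewrite /= in h2; lra.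
  by rewrite -ler_pdivrMr 1?mulrC//; lra.
apply: (@eq0_half_pow _ (nrm2 h + 1 + 2 * nrm h)); first exact: nc_ge0.
move=> j; rewrite nc_distC.
have -> : ip h g - phi h = (ip h (w j) - phi h) - ip h (w j - g).
  rewrite ipBr; ring.
apply: le_trans (ncB _ _) _; rewrite mulrDl; apply: lerD; last first.
  apply: le_trans (cauchy_schwarz _ _ _) _.
  rewrite (mulrC 2) -mulrA ler_wpM2l ?nrm_ge0//.
have h0 := nrm2_ge0 ip h.
have hp := half_pow_gt0 j.
have hh : 0 <= nrm2 h + 1 by rewrite addr_ge0.
rewrite -(ler_pXn2r (_ : 0 < 2)%N) ?nnegrE ?nc_ge0 ?mulr_ge0 ?half_pow_ge0//.
apply: le_trans (psi j) _; rewrite /del exprMn.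
have h1 : nrm2 h + 1 <= (nrm2 h + 1) ^+ 2 by rewrite expr2 ler_peMr//; lra.
have h2 : 0 <= half_pow j ^+ 2 by rewrite exprn_ge0// ltW.
rewrite [leRHS]mulrC; apply: ler_pM => //; lra.
Qed.

(** The hypothesis on v says that v lies in the closed span of the family, without asking the family
    to be total: exponentials on a box span only functions supported there. The partial sums
    converge to some g, and v - g is orthogonal to both v and g. *)
Lemma fourier_expansion (e : nat -> V) v :
  orthonormal ip xpredT e ->
  (forall w, (forall i, ip w (e i) = 0) -> ip w v = 0) ->
  forall eps, 0 < eps -> exists N0, forall N, (N0 <= N)%N ->
  nrm (v - \sum_(i < N) ip v (e i) *: e i) <= eps.
Proof.
move=> oe vP eps eps0.
pose S N := \sum_(i <- iota 0 N) ip v (e i) *: e i.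
have SE N : \sum_(i < N) ip v (e i) *: e i = S N by rewrite -(big_mkord xpredT (fun i => ip v (e i) *: e i)) /S /index_iota subn0.
pose s N : R := \sum_(i <- iota 0 N) nc (ip v (e i)) ^+ 2.
have sD N k : s (N + k)%N = s N + \sum_(i <- iota N k) nc (ip v (e i)) ^+ 2.
  by rewrite /s iotaD big_cat.
have SD N k : S (N + k)%N = S N + \sum_(i <- iota N k) ip v (e i) *: e i.
  by rewrite /S iotaD big_cat.
have sb N : s N <= nrm2 v by apply: (bessel _ _ _ oe) => //; exact: iota_uniq.
have smono N M : (N <= M)%N -> s N <= s M.
  by move=> /subnKC <-; rewrite sD lerDl sumr_ge0// => i _; exact: sqr_ge0.
have dS N k : nrm2 (S (N + k)%N - S N) = s (N + k)%N - s N.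
  rewrite SD sD [S N + _]addrC addrK [s N + _]addrC addrK.
  set X := \sum_(i <- _) _ *: _.
  rewrite !nrm2_Re ip_suml.
  rewrite (eq_big_seq (fun i => (nc (ip v (e i)) ^+ 2)%:C%C)).
    by elim/big_ind2: _ => [|x1 x2 y1 y2 <- <-|//]; rewrite // cReD.
  move=> i ri /=; rewrite /X ip_sumr (bigD1_seq i)//= ?iota_uniq//.
  rewrite ipZr ipZl big1_seq.
    by rewrite oe// eqxx mulr1 addr0 mulrC mulcJ.
  move=> j /andP[ji rj]; rewrite ipZr ipZl oe//.
  by rewrite eq_sym (negbTE ji) !mulr0.
have cs : has_sup (range s).
  by split; [exists (s 0%N); exists 0%N | exists (nrm2 v) => _ [N _ <-]].
have /choice[n nP] j : exists N, sup (range s) - half_pow j ^+ 2 < s N.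
  by have [_ [N _ <-]] := sup_adherent (exprn_gt0 2 (half_pow_gt0 j)) cs; exists N.
have sle N : s N <= sup (range s) by apply: ub_le_sup; [exact: cs.2|exists N].
(* The cutoffs n j need not increase with j; these sums do, and they exceed n j as well as every
   index up to j. *)
pose m j := (\sum_(i < j.+1) (n i).+1)%N.
have jm i j : (i <= j)%N -> (i < m j)%N.
  by move=> ij; rewrite (leq_ltn_trans ij)// -[X in (X <= _)%N]card_ord -sum1_card leq_sum.
have mle j : (m j <= m j.+1)%N by rewrite /m [leqRHS]big_ord_recr leq_addr.
have nm j : (n j <= m j)%N by rewrite /m big_ord_recr/= (leq_trans (leqnSn _))// leq_addl.
have [|g gP] := cpl (v := S \o m).
  move=> j /=; rewrite -(ler_pXn2r (_ : 0 < 2)%N) ?nnegrE ?nrm_ge0 ?half_pow_ge0//.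
  rewrite sqr_nrm -(subnKC (mle j)) dS subnKC//.
  have h1 := nP j; have h2 := smono _ _ (nm j); have h3 := sle (m j.+1).
  lra.
pose w := v - g.
have we i : ip w (e i) = 0.
  apply/nc_eq0/(@eq0_half_pow _ 2); first exact: nc_ge0.
  move=> j; have ij := jm i (i + j)%N (leq_addr _ _).
  have -> : ip w (e i) = ip (S (m (i + j)%N) - g) (e i).
    rewrite /w -[v - g](subrKA (S (m (i + j)%N))) ipDl (ip_proj_orth _ _ _ oe) ?add0r//.
      exact: iota_uniq.
    by rewrite mem_iota.
  apply: le_trans (cauchy_schwarz _ _ _) _.
  rewrite [X in _ * X](_ : _ = 1); last by rewrite nrm_Re oe// eqxx sqrtr1.
  by rewrite mulr1 (le_trans (gP _))// ler_pM2l// half_pow_le// leq_addl.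
have wv : ip w v = 0 by exact: vP we.
have wg : ip w g = 0.
  apply/nc_eq0/(@eq0_half_pow _ (2 * nrm w)); first exact: nc_ge0.
  move=> j; have -> : ip w g = ip w (g - S (m j)).
    rewrite ipBr [X in _ - X](_ : _ = 0) ?subr0// ip_sumr big1_seq// => i _.
    by rewrite ipZr we mulr0.
  apply: le_trans (cauchy_schwarz _ _ _) _.
  have h := gP j; rewrite nrm_distC in h.
  apply: le_trans (ler_wpM2l (nrm_ge0 ip w) h) _; lra.
have w0 : nrm w = 0 by apply: nrm_eq0; rewrite {2}/w ipBr wv wg subrr.
have [j hj] := half_pow_lt (divr_gt0 eps0 (ltr0n R 2)).
exists (m j) => N jN; rewrite SE.
(* By Pythagoras the distance from v to its projections decreases with N. *)
apply: (@le_trans _ _ (nrm (v - S (m j)))).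
  rewrite -(ler_pXn2r (_ : 0 < 2)%N) ?nnegrE ?nrm_ge0// !sqr_nrm.
  rewrite !(nrm2_proj_dist _ _ _ oe) ?iota_uniq// lerB//.
  exact: smono.
apply: le_trans (nrm_dist_add ip g _ _) _.
rewrite -/w w0 add0r nrm_distC (le_trans (gP _))//.
by rewrite ltr_pdivlMr// in hj; lra.
Qed.

End complete.

(** * Operators and singular values *)

(** The limit along the ultrafilter is the supremum of the levels that f reaches on a set of [U];
    for a higher level, the complement belongs to [U]. *)
Lemma ultra_real_limit (R : realType) (U : set_system nat) (f : nat -> R) (B : R) :
  UltraFilter U -> (forall k, `|f k| <= B) ->
  exists c, forall eps, 0 < eps -> U [set k | `|f k - c| < eps].
Proof.
move=> UU fB; pose S := [set x | U [set k | x <= f k]].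
have hS : has_sup S.
  split.
    exists (- B); rewrite /S /=; apply: filterS filterT => k _ /=.
    by have := fB k; rewrite ler_norml => /andP[].
  exists B => x /= /filter_ex[k /= xk].
  by rewrite (le_trans xk)// (le_trans (ler_norm _)).
exists (sup S) => e e0.
have [x Sx xS] := sup_adherent e0 hS.
have US : U (~` [set k | sup S + e / 2 <= f k]).
  have [h|//] := in_ultra_setVsetC [set k | sup S + e / 2 <= f k] UU.
  have : sup S + e / 2 <= sup S by apply: ub_le_sup => //; exact: hS.2.
  lra.
apply: filterS (filterI Sx US) => k /= [xk /negP]; rewrite -ltNge => fk.
by rewrite ltr_norml; apply/andP; split; lra.
Qed.

Lemma ultra_complex_cauchy (R : realType) (U : set_system nat) (f : nat -> R[i]) (B : R) :
  UltraFilter U -> (forall k, nc (f k) <= B) ->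
  forall eps, 0 < eps ->
  exists2 A, U A & forall k l, A k -> A l -> nc (f k - f l) < eps.
Proof.
move=> UU fB e e0.
have [c1 c1P] : exists c, forall eps, 0 < eps ->
    U [set k | `|complex.Re (f k) - c| < eps].
  by apply: (ultra_real_limit (B := B)) => k; exact: le_trans (normr_Re _) _.
have [c2 c2P] : exists c, forall eps, 0 < eps ->
    U [set k | `|complex.Im (f k) - c| < eps].
  by apply: (ultra_real_limit (B := B)) => k; exact: le_trans (normr_Im _) _.
have e40 : 0 < e / 4 by rewrite divr_gt0.
exists ([set k | `|complex.Re (f k) - c1| < e / 4] `&`
        [set k | `|complex.Im (f k) - c2| < e / 4]).
  by apply: filterI; [exact: c1P|exact: c2P].
move=> k l /= [k1 k2] [l1 l2].
apply: le_lt_trans (nc_le_ReIm _) _; rewrite cReB cImB.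
have h1 := ler_distD c1 (complex.Re (f k)) (complex.Re (f l)).
have h2 := ler_distD c2 (complex.Im (f k)) (complex.Im (f l)).
rewrite (distrC c1) in h1; rewrite (distrC c2) in h2; lra.
Qed.

(** Ultrafilter limits provide countably many large sets at once; this turns them into an ordinary
    subsequence and replaces a diagonal extraction. *)
Lemma ultra_subsequence (U : set_system nat) (A : nat -> set nat) :
  Filter U -> (forall B, U B -> forall n, exists2 k, (n < k)%N & B k) ->
  (forall j, U (A j)) ->
  exists2 phi : nat -> nat, {homo phi : i j / (i < j)%N} &
    forall i j, (i <= j)%N -> A i (phi j).
Proof.
move=> UF Uinf UA.
pose A' j := [set k | forall i, (i <= j)%N -> A i k].
have UA' j : U (A' j).
  elim: j => [|j IH].
    by apply: filterS (UA 0%N) => k A0 i; rewrite leqn0 => /eqP ->.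
  apply: filterS (filterI IH (UA j.+1)) => k [/= h1 h2] i.
  by rewrite leq_eqVlt => /predU1P[->//|]; exact: h1.
have /choice[g gP] (jn : nat * nat) : exists k, (jn.2 < k)%N /\ A' jn.1 k.
  by have [k h1 h2] := Uinf _ (UA' jn.1) jn.2; exists k.
pose phi := fix F j := if j is i.+1 then g (j, F i) else g (0, 0)%N.
exists phi.
  apply: homo_ltn; first exact: ltn_trans.
  by move=> i /=; exact: (gP (i.+1, phi i)).1.
move=> i j ij; have : A' j (phi j).
  by case: (j) => [|k]; [exact: (gP (0, 0)%N).2|exact: (gP (k.+1, phi k)).2].
exact.
Qed.

Section operator.
Context {R : realType} {V : lmodType R[i]}.
Variable ip : semi_inner V.
Local Notation C := R[i].
Local Notation nrm := (nrm ip).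
Local Notation nrm2 := (nrm2 ip).
Local Notation orth := (orth ip).
Implicit Types (u v w : V) (a b : C).

Lemma eq_ip_nrm x y : (forall w, ip x w = ip y w) -> nrm (x - y) = 0.
Proof. by move=> xy; apply: nrm_eq0; rewrite {1}ipBl xy subrr. Qed.

Lemma nrmB0_nrm x y : nrm (x - y) = 0 -> nrm x = nrm y.
Proof.
move=> xy; apply/eqP; rewrite eq_le.
have h1 := nrm_dist_add ip y x 0; have h2 := nrm_dist_add ip x y 0.
move: h1 h2; rewrite !subr0 xy (nrm_distC ip y x) xy !add0r => -> ->//.
Qed.

Lemma eq_ip_eq_nrm x y : (forall w, ip x w = ip y w) -> nrm x = nrm y.
Proof. by move=> /eq_ip_nrm/nrmB0_nrm. Qed.

Variables (T S : V -> V) (K : R).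
Hypothesis adj : forall u v, ip (T u) v = ip u (S v).
Hypothesis TK : forall u, nrm (T u) <= K * nrm u.

(** [T] acts on representatives and may come from a choice, so it is linear only after pairing, that
    is up to vectors of norm 0. The adjoint relation is what yields this. *)
Lemma op_lin a u v w : ip (T (a *: u + v)) w = a * ip (T u) w + ip (T v) w.
Proof. by rewrite !adj ipDl ipZl. Qed.

Lemma op_scale a u w : ip (T (a *: u)) w = a * ip (T u) w.
Proof. by rewrite !adj ipZl. Qed.

Lemma op_sub u v w : ip (T (u - v)) w = ip (T u - T v) w.
Proof. by rewrite ipBl !adj ipBl. Qed.

Lemma nrm_op_scale a u : nrm (T (a *: u)) = nc a * nrm (T u).
Proof. by rewrite -nrmZ; apply: eq_ip_eq_nrm => w; rewrite op_scale ipZl. Qed.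

Lemma nrm_op_sub u v : nrm (T (u - v)) = nrm (T u - T v).
Proof. by apply: eq_ip_eq_nrm => w; exact: op_sub. Qed.

Lemma nrm_opD u v : nrm (T (u + v)) <= nrm (T u) + nrm (T v).
Proof.
rewrite (@eq_ip_eq_nrm _ (T u + T v)) ?nrmD// => w.
by rewrite ipDl !adj ipDl.
Qed.

Lemma nrm_op_sum I (r : seq I) (F : I -> V) :
  nrm (T (\sum_(i <- r) F i)) <= \sum_(i <- r) nrm (T (F i)).
Proof.
elim: r => [|i r IH].
  by rewrite !big_nil (le_trans (TK _))// nrm0 mulr0.
by rewrite !big_cons (le_trans (nrm_opD _ _))// lerD2l.
Qed.

Lemma op_eq0 u : nrm u = 0 -> nrm (T u) = 0.
Proof.
by move=> u0; apply/eqP; rewrite eq_le nrm_ge0 andbT (le_trans (TK _))// u0 mulr0.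
Qed.

Lemma adj_sym u v : ip (S u) v = ip u (T v).
Proof. by rewrite sip_conj -adj -sip_conj. Qed.

Lemma adj_bound u : nrm (S u) <= K * nrm u.
Proof.
have [S0|S0] := eqVneq (nrm (S u)) 0.
  rewrite S0; have [->|u0] := eqVneq (nrm u) 0; first by rewrite mulr0.
  have := TK u; have := nrm_ge0 ip (T u); lra.
have Sp : 0 < nrm (S u) by rewrite lt_neqAle eq_sym S0 nrm_ge0.
rewrite -(ler_pM2l Sp) -expr2 sqr_nrm !nrm2_Re adj_sym.
apply: le_trans (Re_ip_le _ _ _) _.
rewrite mulrC mulrCA mulrA; apply: ler_wpM2r; first exact: nrm_ge0.
exact: TK.
Qed.

Definition schatten_bound (p M : R) := forall N e f, orth N e -> orth N f ->
  \sum_(k < N) nc (ip (T (e k)) (f k)) `^ p <= M.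

(** Otherwise one picks greedily unit vectors e_k with |T e_k| > eps, orthogonal to the previous e_i
    and to the previous S f_i, and sets f_k = T e_k / |T e_k|. Orthogonality to S f_i makes f_k
    orthogonal to f_i, so that N terms give a sum of at least N eps^p. *)
Lemma schatten_finite_codim p M : 0 < p -> schatten_bound p M ->
  forall eps, 0 < eps -> exists N e, orth N e /\
  forall u, (forall i, (i < N)%N -> ip u (e i) = 0) -> nrm (T u) <= eps * nrm u.
Proof.
move=> p0 SP eps eps0; apply: contrapT => H.
have step (L : seq V) : exists u, (forall v, v \in L -> ip u v = 0) /\
    eps * nrm u < nrm (T u).
  have [N [e [oe eL]]] := gram_schmidt ip L.
  apply: contrapT => H2; apply: H; exists N, e; split => // u ue.
  rewrite leNgt; apply/negP => Tu; apply: H2; exists u; split => //.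
  exact: eL.
have chain N : exists e f, [/\ orth N e, orth N f &
    forall k, (k < N)%N -> eps <= nc (ip (T (e k)) (f k))].
  elim: N => [|N [e [f [oe ff ef]]]]; first by exists (fun=> 0), (fun=> 0).
  have [u [uL Tu]] := step ([seq e i | i <- iota 0 N] ++ [seq S (f i) | i <- iota 0 N]).
  have u0 : nrm u != 0.
    by apply: contraTneq Tu => u0; rewrite u0 mulr0 op_eq0// ltxx.
  have up : 0 < nrm u by rewrite lt_neqAle eq_sym u0 nrm_ge0.
  pose u' := ncinv (nrm u) *: u.
  have u'1 : nrm u' = 1 by exact: nrm_normalize.
  have Tu' : eps < nrm (T u').
    rewrite nrm_op_scale nc_real ger0_norm ?invr_ge0 ?nrm_ge0// mulrC.
    by rewrite ltr_pdivlMr.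
  have Tu'0 : nrm (T u') != 0 by rewrite gt_eqF// (lt_trans eps0).
  pose g := ncinv (nrm (T u')) *: T u'.
  exists (fun i => if (i < N)%N then e i else u').
  exists (fun i => if (i < N)%N then f i else g); split.
  - apply: orth_ext => // i iN; rewrite ipZl uL ?mulr0// mem_cat; apply/orP; left.
    by apply/map_f; rewrite mem_iota.
  - apply: orth_ext => //; last exact: nrm_normalize.
    move=> i iN; rewrite ipZl op_scale adj uL ?mulr0// mem_cat; apply/orP; right.
    by apply/(map_f (S \o f)); rewrite mem_iota.
  - move=> k; rewrite ltnS leq_eqVlt => /predU1P[->|kN]; last by rewrite kN ef.
    rewrite ltnn /g ipZr ncM ncJ nc_real ger0_norm ?invr_ge0 ?nrm_ge0//.
    rewrite ip_nrm2 nc_real -sqr_nrm ger0_norm ?sqr_ge0// expr2 mulrA mulVf//.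
    by rewrite mul1r ltW.
have bnd N : N%:R * eps `^ p <= M.
  have [e [f [oe ff ef]]] := chain N.
  apply: le_trans (SP N e f oe ff).
  rewrite mulr_natl -[N in leLHS]card_ord -sumr_const; apply: ler_sum => k _.
  by rewrite ge0_ler_powR ?nnegrE ?nc_ge0 ?ef// ltW.
have ep0 : 0 < eps `^ p by rewrite powR_gt0.
have M0 : 0 <= M by have := bnd 0%N; rewrite mul0r.
have := bnd (Num.truncn (M / eps `^ p)).+1.
rewrite leNgt -ltr_pdivrMr//.
have /andP[_ ->] := truncn_itv (divr_ge0 M0 (ltW ep0)).
by [].
Qed.

End operator.

(** * Compactness and the norm-attaining vector *)

Section spectral.
Context {R : realType} {V : lmodType R[i]}.
Variable ip : semi_inner V.
Local Notation C := R[i].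
Local Notation nrm := (nrm ip).
Local Notation nrm2 := (nrm2 ip).
Local Notation orth := (orth ip).
Implicit Types (u v w : V) (a b : C).
Variables (T S : V -> V) (K : R).
Hypothesis cpl : complete_ip ip.
Hypothesis adj : forall u v, ip (T u) v = ip u (S v).
Hypothesis TK : forall u, nrm (T u) <= K * nrm u.

Definition sequentially_compact := forall (u : nat -> V) (B : R),
  (forall k, nrm (u k) <= B) ->
  exists2 phi : nat -> nat, {homo phi : i j / (i < j)%N} &
  exists g, forall j, nrm (T (u (phi j)) - g) <= 2 * @half_pow R j.

(** Along an ultrafilter finer than [\oo] all coordinates <u_k, e_i> converge at once. In the
    difference of two terms, T is small on the part orthogonal to the e_i by hypothesis, and on the
    projection because the coordinates nearly agree. *)
Lemma finite_codim_compact :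
  (forall eps, 0 < eps -> exists N e, orth N e /\
    forall u, (forall i, (i < N)%N -> ip u (e i) = 0) -> nrm (T u) <= eps * nrm u) ->
  sequentially_compact.
Proof.
move=> H u B uB.
have B0 : 0 <= B := le_trans (nrm_ge0 _ _) (uB 0%N).
have [U [UU ooU]] := ultraFilterLemma (F := \oo) _.
have cauchy eps : 0 < eps ->
    exists2 A, U A & forall k l, A k -> A l -> nrm (T (u k) - T (u l)) <= eps.
  move=> eps0.
  (* As |u k - u l| <= 2 B, the two parts contribute at most del * (2 B) and eta * Z <= del. *)
  pose del := eps / (1 + 2 * B).
  have del0 : 0 < del by rewrite divr_gt0//; lra.
  have [N [e [oe eT]]] := H _ del0.
  pose Z := \sum_(i <- iota 0 N) nrm (T (e i)).
  have Z0 : 0 <= Z by rewrite sumr_ge0// => i _; exact: nrm_ge0.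
  pose eta := del / (1 + Z).
  have eta0 : 0 < eta by rewrite divr_gt0//; lra.
  have /choice[A AP] i : exists A, U A /\ (forall k l, A k -> A l ->
      (i < N)%N -> nc (ip (u k) (e i) - ip (u l) (e i)) < eta).
    have [iN|iN] := ltnP i N; last first.
      by exists setT; split => //; exact: filterT.
    have ub k : nc (ip (u k) (e i)) <= B.
      apply: le_trans (cauchy_schwarz _ _ _) _.
      rewrite [X in _ * X](_ : _ = 1) ?mulr1//.
      by rewrite nrm_Re (oe i i)// eqxx sqrtr1.
    have [A UA AP] := ultra_complex_cauchy UU ub eta0.
    by exists A; split => // k l Ak Al _; exact: AP.
  exists (fun k => forall i, (i < N)%N -> A i k).
    elim: (N) => [|n IH]; first by apply: filterS filterT => k _ i.
    apply: filterS (filterI IH (AP n).1) => k [h1 h2] i.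
    by rewrite ltnS leq_eqVlt => /predU1P[->//|]; exact: h1.
  move=> k l Ak Al.
  rewrite -(nrm_op_sub adj); set w := u k - u l.
  pose w1 := \sum_(i <- iota 0 N) ip w (e i) *: e i.
  have iN : {in iota 0 N, forall i, (i < N)%N} by move=> i; rewrite mem_iota.
  have h1 : nrm (T (w - w1)) <= del * nrm w.
    apply: le_trans (eT _ _) _.
      by move=> i ii; apply: (ip_proj_orth _ _ iN oe); rewrite ?iota_uniq ?mem_iota.
    rewrite ler_pM2l// -(ler_pXn2r (_ : 0 < 2)%N) ?nnegrE ?nrm_ge0//.
    rewrite !sqr_nrm (nrm2_proj_dist _ _ iN oe) ?iota_uniq// gerBl.
    by rewrite sumr_ge0// => i _; exact: sqr_ge0.
  have h2 : nrm (T w1) <= eta * Z.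
    apply: le_trans (nrm_op_sum adj TK _ _) _.
    rewrite /Z mulr_sumr big_seq [leRHS]big_seq; apply: ler_sum => i ii.
    rewrite (nrm_op_scale adj) ler_wpM2r ?nrm_ge0// ltW//.
    by rewrite /w ipBl (AP i).2 ?iN//; [apply: Ak|apply: Al]; exact: iN.
  have h3 : nrm w <= 2 * B.
    by apply: le_trans (nrmB _ _ _) _; have := uB k; have := uB l; lra.
  have h4 : nrm (T w) <= nrm (T (w - w1)) + nrm (T w1).
    by apply: le_trans (nrm_opD adj _ _); rewrite subrK.
  have h5 : eta * Z <= del.
    by rewrite /eta mulrAC ler_pdivrMr ?ler_pM2l//; lra.
  have h6 : del * nrm w <= del * (2 * B) by rewrite ler_pM2l.
  have h7 : del * (1 + 2 * B) = eps by rewrite /del divfK// gt_eqF//; lra.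
  lra.
have /choice[A AP] j : exists A, U A /\
    forall k l, A k -> A l -> nrm (T (u k) - T (u l)) <= @half_pow R j.
  by have [A UA AP] := cauchy _ (@half_pow_gt0 R j); exists A.
have Uinf D : U D -> forall n, exists2 k, (n < k)%N & D k.
  move=> UD n.
  have Un : U [set k | (n < k)%N] by apply: ooU; exists n.+1.
  by have [k [/= Dk nk]] := filter_ex (filterI UD Un); exists k.
have [phi phi_incr phiA] := ultra_subsequence _ Uinf (fun j => (AP j).1).
exists phi => //; apply: (cpl (v := fun j => T (u (phi j)))) => j.
by apply: (AP j).2; exact: phiA.
Qed.

Hypothesis cT : sequentially_compact.

Definition eigen_pairs (L : seq (V * R)) :=
  forall p, p \in L -> nrm (S (T p.1) - ((p.2 ^+ 2)%:C)%C *: p.1) = 0.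

Definition perp (L : seq (V * R)) u := forall p, p \in L -> ip u p.1 = 0.

Lemma nrmB0_ip x y w : nrm (x - y) = 0 -> ip w x = ip w y.
Proof.
by move=> xy; apply/eqP; rewrite -subr_eq0 -ipBr (nrm_ip0r _ xy).
Qed.

Lemma perp_normal L u : eigen_pairs L -> perp L u -> perp L (S (T u)).
Proof.
move=> eL uL p pL; rewrite (adj_sym adj) adj.
by rewrite (nrmB0_ip _ (eL p pL)) ipZr uL// mulr0.
Qed.

Let adjS u v : ip (S u) v = ip u (T v). Proof. exact: adj_sym. Qed.
Let SK u : nrm (S u) <= K * nrm u. Proof. exact: adj_bound. Qed.

Let K_ge0 u : nrm u != 0 -> 0 <= K.
Proof.
move=> u0; have up : 0 < nrm u by rewrite lt_neqAle eq_sym u0 nrm_ge0.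
by rewrite -(pmulr_lge0 _ up); apply: le_trans (TK u); exact: nrm_ge0.
Qed.

(** The norm s of T on the complement of [L], which S T preserves, is attained. For |v| <= 1 there,
    |S T v - s^2 v|^2 <= s^2 (s^2 - |T v|^2), so along a maximizing subsequence S T v and s^2 v have
    the same limit w, which is therefore an eigenvector. When s = 0 the pair (0, 0) serves as
    padding. *)
Lemma next_eigen_pair L : eigen_pairs L -> exists p : V * R,
  [/\ 0 <= p.2, perp L p.1, p.2 != 0 -> nrm p.1 = 1,
      nrm (S (T p.1) - ((p.2 ^+ 2)%:C)%C *: p.1) = 0 &
      forall u, perp L u -> nrm (T u) <= p.2 * nrm u].
Proof.
move=> eL.
have [K0|K0] := ltP K 0.
  have nrm_eq0 u : nrm u = 0.
    apply/eqP; apply/negPn/negP => /K_ge0; lra.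
  exists (0, 0); split => //=; first by move=> p pL; rewrite ip0l.
  - by rewrite eqxx.
  - by move=> u _; rewrite !nrm_eq0 mulr0.
pose Sg := [set nrm (T u) | u in [set u | perp L u /\ nrm u <= 1]].
have hSg : has_sup Sg.
  split.
    exists (nrm (T 0)), 0 => //; split; last by rewrite nrm0.
    by move=> p _; rewrite ip0l.
  exists K => _ [u [_ u1] <-]; rewrite (le_trans (TK u))//.
  by rewrite ler_piMr.
pose s := sup Sg.
have sub u : perp L u -> nrm u <= 1 -> nrm (T u) <= s.
  by move=> uL u1; apply: ub_le_sup; [exact: hSg.2|exists u].
have s0 : 0 <= s.
  apply: le_trans (nrm_ge0 ip (T 0)) (sub 0 _ _); last by rewrite nrm0.
  by move=> p _; rewrite ip0l.
have sle u : perp L u -> nrm (T u) <= s * nrm u.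
  move=> uL; have [u0|u0] := eqVneq (nrm u) 0.
    by rewrite (op_eq0 TK)// u0 mulr0.
  have up : 0 < nrm u by rewrite lt_neqAle eq_sym u0 nrm_ge0.
  have := sub (ncinv (nrm u) *: u).
  rewrite nrm_normalize// lexx => /(_ _ isT).
  rewrite (nrm_op_scale adj) nc_real ger0_norm ?invr_ge0 ?nrm_ge0//.
  rewrite mulrC ler_pdivrMr//; apply.
  by move=> p pL; rewrite ipZl uL// mulr0.
have [s00|s00] := eqVneq s 0.
  exists (0, 0) => /=; split => //; first by move=> p pL; rewrite ip0l.
  - by rewrite eqxx.
  - by rewrite scaler0 subr0 (op_eq0 SK)// (op_eq0 TK)// nrm0.
  - by move=> u uL; have := sle u uL; rewrite s00.
have sp : 0 < s by rewrite lt_neqAle eq_sym s00.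
have /choice[u uP] k : exists u, [/\ perp L u, nrm u <= 1 &
    s - @half_pow R k < nrm (T u)].
  by have [_ [u [uL u1] <-]] := sup_adherent (@half_pow_gt0 R k) hSg; exists u.
have u1 k : nrm (u k) <= 1 by have [] := uP k.
have [phi phi_incr [g gP]] := cT u1.
pose w := S g.
have phi_ge j : (j <= phi j)%N.
  by elim: j => // j IH; apply: leq_ltn_trans IH (phi_incr _ _ (ltnSn j)).
have approx eps : 0 < eps -> exists v, [/\ perp L v, nrm (S (T v) - w) <= eps,
    nrm (w - ((s ^+ 2)%:C)%C *: v) <= eps & s - eps <= nrm (T v)].
  move=> eps0.
  (* The first bound gives K * (2 h) <= eps / 2, the last one 2 s^3 (s - |T v|) <= eps^2 / 8. *)
  pose c := Num.min (eps / (1 + 4 * K)) (Num.min (s / 2) (Num.min eps (eps ^+ 2 / (16 * s ^+ 3)))).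
  have c0 : 0 < c.
    have s3 : 0 < 16 * s ^+ 3 by rewrite mulr_gt0// exprn_gt0.
    have k4 : 0 < 1 + 4 * K by lra.
    by rewrite !lt_min !divr_gt0// ?exprn_gt0// eps0.
  have [j jc] := half_pow_lt c0.
  exists (u (phi j)); have [v1 v2 v3] := uP (phi j).
  set v := u (phi j) in v1 v2 v3 *.
  have hle : @half_pow R (phi j) <= c.
    by rewrite (le_trans _ (ltW jc))// half_pow_le.
  have [c1 [c2 [c3 c4]]] : c <= eps / (1 + 4 * K) /\ c <= s / 2 /\ c <= eps /\
      c <= eps ^+ 2 / (16 * s ^+ 3).
    by rewrite /c !ge_min !lexx ?orbT.
  set h := @half_pow R j in jc.
  have h0 : 0 < h by exact: half_pow_gt0.
  have STw : nrm (S (T v) - w) <= K * (2 * h).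
    rewrite -(nrm_op_sub adjS); apply: le_trans (SK _) _.
    by rewrite ler_wpM2l//; exact: gP.
  have hK : K * (2 * h) <= eps / 2.
    have : h <= eps / (1 + 4 * K) by exact/ltW/(lt_le_trans jc).
    rewrite ler_pdivlMr; last by lra.
    have : 0 <= K * h by rewrite mulr_ge0// ltW.
    lra.
  set y := nrm (T v) in v3 *.
  have ys : y <= s by exact: sub.
  have y0 : 0 <= y by exact: nrm_ge0.
  have STvy : nrm (S (T v)) <= s * y.
    have [->|STv0] := eqVneq (nrm (S (T v))) 0; first by rewrite mulr_ge0.
    have STvp : 0 < nrm (S (T v)) by rewrite lt_neqAle eq_sym STv0 nrm_ge0.
    rewrite -(ler_pM2l STvp) -expr2 sqr_nrm !nrm2_Re adjS.
    apply: le_trans (Re_ip_le _ _ _) _.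
    have := sle _ (perp_normal eL v1) => h1.
    by apply: le_trans (ler_wpM2l y0 h1) _; lra.
  have X2 : nrm2 (S (T v) - ((s ^+ 2)%:C)%C *: v) <= (eps / 2) ^+ 2.
    rewrite nrm2B nrm2Z nc_real ipZr conj_realc cReM /= mul0r subr0.
    rewrite adjS -/(nrm2 _) -!sqr_nrm -/y ger0_norm ?sqr_ge0//.
    have a1 : nrm (S (T v)) ^+ 2 <= (s * y) ^+ 2.
      by rewrite ler_pXn2r ?nnegrE ?nrm_ge0 ?mulr_ge0.
    have a2 : (s ^+ 2) ^+ 2 * nrm v ^+ 2 <= (s ^+ 2) ^+ 2.
      by rewrite ler_piMr ?sqr_ge0// exprn_ile1// nrm_ge0.
    have a3 : 16 * s ^+ 3 * c <= eps ^+ 2.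
      by rewrite mulrC -ler_pdivlMr// mulr_gt0// exprn_gt0.
    have a4 : s ^+ 3 * (s - y) <= s ^+ 3 * c by rewrite ler_pM2l ?exprn_gt0//; lra.
    have a5 : s ^+ 2 * (s - y) * y <= s ^+ 2 * (s - y) * s.
      by rewrite ler_wpM2l// mulr_ge0 ?sqr_ge0//; lra.
    have a6 := sqr_ge0 eps.
    lra.
  have X1 : nrm (S (T v) - ((s ^+ 2)%:C)%C *: v) <= eps / 2.
    have e2 : 0 <= eps / 2 by lra.
    by rewrite -(ler_pXn2r (_ : 0 < 2)%N) ?nnegrE ?nrm_ge0 ?e2// sqr_nrm.
  split => //; [lra| |lra].
  apply: le_trans (nrm_dist_add ip (S (T v)) _ _) _.
  rewrite (nrm_distC ip w); lra.
have small (x c : R) : 0 <= x -> (forall eps : R, 0 < eps -> x <= c * eps) -> x = 0.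
  move=> x0 xc; apply: (@eq0_half_pow _ _ c) => // j.
  by apply: xc; exact: half_pow_gt0.
(* If w had norm 0, then s^2 v would be small, whereas s - del <= |T v| <= s |v| keeps |v| at least
   1 / 2. *)
have w0 : nrm w != 0.
  apply/eqP => w0.
  pose del := Num.min (s / 2) (s ^+ 2 / 4).
  have del0 : 0 < del by rewrite lt_min !divr_gt0// exprn_gt0.
  have [v [vL _ wv Tv]] := approx del del0.
  have d1 : del <= s / 2 by rewrite ge_min lexx.
  have d2 : del <= s ^+ 2 / 4 by rewrite ge_min lexx orbT.
  have v12 : 1 / 2 <= nrm v.
    rewrite -(ler_pM2l sp); have := sle _ vL; lra.
  have : nrm (((s ^+ 2)%:C)%C *: v) <= nrm w + nrm (w - ((s ^+ 2)%:C)%C *: v).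
    rewrite -[X in nrm X <= _](subKr w); exact: nrmB.
  rewrite nrmZ nc_real ger0_norm ?sqr_ge0// w0 add0r.
  have : 0 < s ^+ 2 by rewrite exprn_gt0.
  nra.
have wp : 0 < nrm w by rewrite lt_neqAle eq_sym w0 nrm_ge0.
have wL : perp L w.
  move=> p pL; apply/nc_eq0/(small _ (nrm p.1)); first exact: nc_ge0.
  move=> eps eps0; have [v [vL wv _ _]] := approx eps eps0.
  have -> : ip w p.1 = - ip (S (T v) - w) p.1.
    by rewrite ipBl (perp_normal eL vL)// sub0r opprK.
  by rewrite ncN (le_trans (cauchy_schwarz _ _ _))// mulrC ler_wpM2l// nrm_ge0.
have STw : nrm (S (T w) - ((s ^+ 2)%:C)%C *: w) = 0.
  apply: (small _ (K * K + s ^+ 2)); first exact: nrm_ge0.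
  move=> eps eps0; have [v [vL wv1 wv2 _]] := approx eps eps0.
  apply: le_trans (nrm_dist_add ip (S (T (((s ^+ 2)%:C)%C *: v))) _ _) _.
  rewrite mulrDl; apply: lerD.
    rewrite -(nrm_op_sub adjS); apply: le_trans (SK _) _.
    rewrite -(nrm_op_sub adj) -mulrA ler_wpM2l//.
    by apply: le_trans (TK _) _; rewrite ler_wpM2l.
  rewrite (_ : nrm (_ - _) = nrm (((s ^+ 2)%:C)%C *: (S (T v) - w))).
    rewrite nrmZ nc_real ger0_norm ?sqr_ge0//.
    by rewrite ler_wpM2l// sqr_ge0.
  apply: eq_ip_eq_nrm => x; rewrite scalerBr !ipBl; congr (_ - _).
  by rewrite adjS (op_scale adj) -adjS ipZl.
exists (ncinv (nrm w) *: w, s) => /=; split => //.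
- by move=> p pL; rewrite ipZl wL// mulr0.
- by move=> _; exact: nrm_normalize.
- rewrite (_ : nrm (_ - _) = nrm (ncinv (nrm w) *: (S (T w) - ((s ^+ 2)%:C)%C *: w))).
    by rewrite nrmZ STw mulr0.
  apply: eq_ip_eq_nrm => x; rewrite scalerBr !ipBl !ipZl mulrCA; congr (_ - _).
  by rewrite adjS (op_scale adj) -adjS.
Qed.

End spectral.

(** * Singular values and their multiplicities *)

Section singular.
Context {R : realType} {V : lmodType R[i]}.
Variable ip : semi_inner V.
Local Notation C := R[i].
Local Notation nrm := (nrm ip).
Local Notation nrm2 := (nrm2 ip).
Local Notation orth := (orth ip).
Implicit Types (u v w : V) (a b : C).
Variables (T S : V -> V) (K : R).
Hypothesis adj : forall u v, ip (T u) v = ip u (S v).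
Hypothesis TK : forall u, nrm (T u) <= K * nrm u.
Hypothesis cT : sequentially_compact ip T.

Let adjS u v : ip (S u) v = ip u (T v). Proof. exact: adj_sym. Qed.

Definition is_eigen (r : R) v := nrm (S (T v) - ((r ^+ 2)%:C)%C *: v) = 0.

(** The pairs are produced one after the other, each orthogonal to its predecessors. For a unit
    e_{k+1} one has |T e_{k+1}| = s_{k+1}, so the bound s_k of T on the complement of the first k
    vectors yields monotonicity. A vector with s_i = 0 need not be a unit vector. *)
Lemma singular_system : exists (s : nat -> R) (e : nat -> V),
  [/\ forall k, 0 <= s k, nonincreasing_seq s,
      forall i j, i != j -> ip (e i) (e j) = 0,
      forall i, s i != 0 -> nrm (e i) = 1 &
      (forall i, is_eigen (s i) (e i)) /\
      forall k u, (forall i, (i < k)%N -> ip u (e i) = 0) ->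
        nrm (T u) <= s k * nrm u].
Proof.
have /choice[nxt nxtP] (L : seq (V * R)) : exists p : V * R, eigen_pairs ip T S L ->
    [/\ 0 <= p.2, perp ip L p.1, p.2 != 0 -> nrm p.1 = 1,
      nrm (S (T p.1) - ((p.2 ^+ 2)%:C)%C *: p.1) = 0 &
      forall u, perp ip L u -> nrm (T u) <= p.2 * nrm u].
  have [eL|neL] := pselect (eigen_pairs ip T S L).
    by have [p pP] := next_eigen_pair adj TK cT eL; exists p.
  by exists (0, 0).
pose Ls := fix F k := if k is j.+1 then rcons (F j) (nxt (F j)) else [::].
have LsP k : eigen_pairs ip T S (Ls k).
  elim: k => [|k IH] p //=; rewrite mem_rcons inE => /predU1P[->|]; last exact: IH.
  by have [] := nxtP _ IH.
have memLs i k : (i < k)%N -> nxt (Ls i) \in Ls k.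
  elim: k => // k IH; rewrite ltnS leq_eqVlt /= mem_rcons inE => /predU1P[->|/IH ->].
    by rewrite eqxx.
  by rewrite orbT.
have perpLs k u : (forall i, (i < k)%N -> ip u (nxt (Ls i)).1 = 0) -> perp ip (Ls k) u.
  elim: k => [|k IH] uk p //=; rewrite mem_rcons inE => /predU1P[->|]; first exact: uk.
  by apply: IH => i ik; apply: uk; exact: ltnW.
have ortho i j : (i < j)%N -> ip (nxt (Ls j)).1 (nxt (Ls i)).1 = 0.
  by move=> ij; have [_ + _ _ _] := nxtP _ (LsP j); apply; exact: memLs.
exists (fun k => (nxt (Ls k)).2), (fun k => (nxt (Ls k)).1); split.
- by move=> k; have [] := nxtP _ (LsP k).
- apply/nonincreasing_seqP => k.
  have [s0 pL n1 eig _] := nxtP _ (LsP k.+1).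
  have [sk _ _ _ /(_ (nxt (Ls k.+1)).1)] := nxtP _ (LsP k).
  have [->//|s1] := eqVneq (nxt (Ls k.+1)).2 0.
  set e := (nxt (Ls k.+1)).1 in n1 eig *; rewrite n1// mulr1 => h.
  have {}h := h _.
  have Te : nrm (T e) <= (nxt (Ls k)).2.
    by apply: h; apply: perpLs => i ik; apply: ortho; exact: ltnW.
  rewrite -(ler_pXn2r (_ : 0 < 2)%N) ?nnegrE//.
  suff -> : (nxt (Ls k.+1)).2 ^+ 2 = nrm (T e) ^+ 2.
    by rewrite ler_pXn2r ?nnegrE ?nrm_ge0.
  have := nrmB0_ip e eig; rewrite ipZr conj_realc -adj ip_nrm2 (nrm1_ip (n1 s1)) mulr1.
  by move=> /(congr1 (@complex.Re R)) /=; rewrite sqr_nrm.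
- move=> i j; rewrite neq_ltn => /orP[ij|ji]; last exact: ortho.
  by rewrite sip_conj ortho// rmorph0.
- by move=> i; have [] := nxtP _ (LsP i).
- split; first by move=> i; have [] := nxtP _ (LsP i).
  by move=> k u uk; have [_ _ _ _] := nxtP _ (LsP k); apply; exact: perpLs.
Qed.

Variables (s : nat -> R) (e : nat -> V).
Hypothesis s_ge0 : forall k, 0 <= s k.
Hypothesis s_noninc : nonincreasing_seq s.
Hypothesis e_orth : forall i j, i != j -> ip (e i) (e j) = 0.
Hypothesis e_unit : forall i, s i != 0 -> nrm (e i) = 1.
Hypothesis e_eigen : forall i, is_eigen (s i) (e i).
Hypothesis s_bound : forall k u, (forall i, (i < k)%N -> ip u (e i) = 0) ->
  nrm (T u) <= s k * nrm u.
Variables (p M : R).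
Hypothesis p0 : 0 < p.
Hypothesis SP : schatten_bound ip T p M.

(** The families e_k and f_k = T e_k / s_k are orthonormal and <T e_k, f_k> = s_k. The induction
    only discards a vanishing last term; monotonicity then makes all the s_k positive. *)
Lemma singular_sum N : \sum_(k < N) s k `^ p <= M.
Proof.
elim: N => [|N IH].
  by have := @SP 0%N (fun=> 0) (fun=> 0); rewrite !big_ord0; apply => i.
have [sN0|sN0] := eqVneq (s N) 0.
  by rewrite big_ord_recr/= sN0 powR0 ?addr0// gt_eqF.
have spos k : (k < N.+1)%N -> 0 < s k.
  rewrite ltnS => kN; apply: lt_le_trans (s_noninc kN).
  by rewrite lt_neqAle eq_sym sN0 s_ge0.
have oe : orth N.+1 e.
  move=> i j /spos si sj; have [->|ij] := eqVneq i j; last exact: e_orth.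
  by rewrite nrm1_ip// e_unit// gt_eqF// spos.
have TeTe i j : (j < N.+1)%N -> ip (T (e i)) (T (e j)) = ((s j ^+ 2)%:C)%C * ip (e i) (e j).
  by move=> jN; rewrite adj (nrmB0_ip _ (e_eigen j)) ipZr conj_realc.
pose f k := ((s k)^-1%:C)%C *: T (e k).
have ff : orth N.+1 f.
  move=> i j iN jN; rewrite /f ipZl ipZr TeTe// oe// conj_realc.
  have [<-|ij] := eqVneq i j; last by rewrite !mulr0.
  have si : s i != 0 by rewrite gt_eqF// spos.
  by rewrite mulr1 -!rmorphM /= expr2 mulKf// mulVf.
apply: le_trans (SP oe ff); apply: ler_sum => k _.
rewrite /f ipZr TeTe// oe ?unfold_in// eqxx mulr1 conj_realc -rmorphM nc_real.
by rewrite expr2 mulKf ?gt_eqF ?spos// ger0_norm.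
Qed.

Lemma singular_lt (r : R) : 0 < r -> exists N, s N < r.
Proof.
move=> r0; apply: contrapT => /forallNP H.
have bnd N : N%:R * r `^ p <= M.
  apply: le_trans (singular_sum N).
  rewrite mulr_natl -[N in leLHS]card_ord -sumr_const; apply: ler_sum => k _.
  rewrite ge0_ler_powR ?nnegrE ?s_ge0// ?(ltW p0) ?(ltW r0)//.
  by have /negP := H k; rewrite -leNgt.
have ep0 : 0 < r `^ p by rewrite powR_gt0.
have M0 : 0 <= M by have := bnd 0%N; rewrite mul0r.
have := bnd (Num.truncn (M / r `^ p)).+1.
rewrite leNgt -ltr_pdivrMr//.
have /andP[_ ->] := truncn_itv (divr_ge0 M0 (ltW ep0)).
by [].
Qed.

(** The indices with s_j = r are finitely many because s gets below r. An eigenvector w for r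
    orthogonal to these e_j is orthogonal to every e_i with i < N, so that |T w| <= s_N |w| with s_N
    < r, while |T w| = r |w|; hence |w| = 0. *)
Lemma eigenspace_basis (r : R) : 0 < r -> exists (k : nat) (b : 'I_k -> V),
  [/\ ([set j | s j = r] #= `I_k)%card,
      forall i, is_eigen r (b i),
      forall i j, ip (b i) (b j) = (i == j)%:R &
      forall v, is_eigen r v -> exists c : 'I_k -> C, nrm (v - \sum_i c i *: b i) = 0].
Proof.
move=> r0; have [N sN] := singular_lt r0.
pose J := [seq j <- iota 0 N | s j == r].
have uJ : uniq J by rewrite filter_uniq// iota_uniq.
have memJ j : (j \in J) = (s j == r).
  rewrite mem_filter mem_iota /= add0n; case: eqP => //= sj.
  by rewrite ltnNge; apply/negP => Nj; have := s_noninc Nj; rewrite sj leNgt sN.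
pose idx (i : 'I_(size J)) := nth 0%N J i.
have idxP i : s (idx i) = r by apply/eqP; rewrite -memJ mem_nth.
exists (size J), (fun i => e (idx i)); split.
- have -> : [set j | s j = r] = [set` J].
    by apply/seteqP; split => j /=; rewrite memJ => /eqP.
  rewrite card_eq_sym; apply/card_set_bijP; exists (nth 0%N J); split => //=.
  - by move=> i /= iJ; exact: mem_nth.
  - by move=> i j; rewrite !inE => iJ jJ /eqP; rewrite nth_uniq// => /eqP.
  - by move=> j /= jJ; exists (index j J); [rewrite /= index_mem|rewrite nth_index].
- by move=> i; have := e_eigen (idx i); rewrite idxP.
- move=> i j; have [->|ij] := eqVneq i j.
    by rewrite nrm1_ip// e_unit// idxP gt_eqF.
  by apply: e_orth; rewrite nth_uniq.
- move=> v ev; exists (fun i => ip v (e (idx i))).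
  have oJ : orthonormal ip (fun j => s j == r) e.
    move=> i j; rewrite !unfold_in => /eqP si _.
    have [<-|ij] := eqVneq i j; last exact: e_orth.
    by rewrite nrm1_ip// e_unit// si gt_eqF.
  have -> : \sum_(i < size J) ip v (e (idx i)) *: e (idx i) =
      \sum_(j <- J) ip v (e j) *: e j by rewrite (big_nth 0%N) big_mkord.
  set w := v - _.
  have we i : (i < N)%N -> ip w (e i) = 0.
    move=> iN; have [iJ|iJ] := boolP (i \in J).
      by apply: (ip_proj_orth _ uJ _ oJ) => // k; rewrite memJ.
    rewrite ipBl ip_suml big1_seq ?subr0; last first.
      move=> j /= jJ; rewrite ipZl e_orth ?mulr0//.
      by apply: contraNneq iJ => <-.
    have h1 : ip (S (T v)) (e i) = ((r ^+ 2)%:C)%C * ip v (e i).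
      by apply/eqP; rewrite -ipZl -subr_eq0 -ipBl (nrm_ip0l _ ev).
    have h2 : ip (S (T v)) (e i) = ((s i ^+ 2)%:C)%C * ip v (e i).
      by rewrite adjS adj (nrmB0_ip _ (e_eigen i)) ipZr conj_realc.
    have : ((r ^+ 2 - s i ^+ 2)%:C)%C * ip v (e i) = 0.
      by rewrite rmorphB mulrBl -h1 -h2 subrr.
    move/eqP; rewrite mulf_eq0 => /orP[|/eqP//].
    rewrite eq_complex /= eqxx andbT subr_eq0 eqf_sqr memJ in iJ *.
    rewrite eq_sym (negbTE iJ) /= => /eqP rs.
    by move: r0; rewrite rs oppr_gt0 ltNge s_ge0.
  have Tw := s_bound we.
  (* S T - r^2 is self-adjoint and annihilates v as well as the e_j subtracted from it. *)
  have ew : is_eigen r w.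
    have eigP x y : ip (S (T x) - ((r ^+ 2)%:C)%C *: x) y =
        ip x (S (T y) - ((r ^+ 2)%:C)%C *: y).
      by rewrite ipBl ipBr ipZl ipZr conj_realc adjS adj.
    apply: nrm_eq0; rewrite eigP; set Z := S _ - _.
    rewrite /w ipBl ip_suml -/w -eigP (nrm_ip0l _ ev) sub0r big1_seq ?oppr0//.
    move=> j /= jJ; rewrite ipZl -eigP.
    have /eqP <- : s j == r by rewrite -memJ.
    by rewrite (nrm_ip0l _ (e_eigen j)) mulr0.
  apply/eqP/negPn/negP => w0.
  have wp : 0 < nrm w by rewrite lt_neqAle eq_sym w0 nrm_ge0.
  have : (r * nrm w) ^+ 2 = nrm (T w) ^+ 2.
    rewrite exprMn !sqr_nrm.
    have : ip (S (T w)) w = ((r ^+ 2)%:C)%C * ip w w.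
      by apply/eqP; rewrite -ipZl -subr_eq0 -ipBl (nrm_ip0l _ ew).
    rewrite adjS !ip_nrm2 -rmorphM => /(congr1 (@complex.Re R)) /= -> //.
  have h3 : nrm (T w) < r * nrm w.
    by apply: le_lt_trans Tw _; rewrite ltr_pM2r.
  move=> h4; have := h3; rewrite -(ltr_pXn2r (_ : 0 < 2)%N) ?nnegrE ?nrm_ge0//.
    by rewrite h4 ltxx.
  by rewrite mulr_ge0// ltW.
Qed.

End singular.

(** * Complex integrals and square integrable functions *)

Section cint.
Context d (T : measurableType d) (R : realType).
Implicit Types (f g : T -> R[i]).

Lemma measurable_sqrtr D (f : T -> R) : measurable_fun D f ->
  measurable_fun D (fun x => Num.sqrt (f x)).
Proof.
move=> mf; apply: (measurableT_comp _ mf).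
by apply: continuous_measurable_fun; exact: sqrt_continuous.
Qed.

Lemma measurable_nc f : cmeasurable f -> measurable_fun setT (fun x => nc (f x)).
Proof.
move=> [mr mi]; under eq_fun do rewrite ncE.
by apply: measurable_sqrtr; apply: measurable_funD; exact: measurable_funX.
Qed.

Lemma cmeasurableD f g : cmeasurable f -> cmeasurable g ->
  cmeasurable (fun x => f x + g x).
Proof.
move=> [fr fi] [gr gi]; split.
  by under eq_fun do rewrite cReD; exact: measurable_funD.
by under eq_fun do rewrite cImD; exact: measurable_funD.
Qed.

Lemma cmeasurableM f g : cmeasurable f -> cmeasurable g ->
  cmeasurable (fun x => f x * g x).
Proof.
move=> [fr fi] [gr gi]; split.
  under eq_fun do rewrite cReM.
  by apply: measurable_funB; exact: measurable_funM.
under eq_fun do rewrite cImM.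
by apply: measurable_funD; exact: measurable_funM.
Qed.

Lemma cmeasurable_cst (a : R[i]) : @cmeasurable d T R (fun=> a).
Proof. by split; exact: measurable_cst. Qed.

Lemma cmeasurableN f : cmeasurable f -> cmeasurable (fun x => - f x).
Proof.
move=> [fr fi]; split.
  under eq_fun do rewrite cReN.
  exact: (measurable_funN fr).
under eq_fun do rewrite cImN.
exact: (measurable_funN fi).
Qed.

Lemma cmeasurableJ f : cmeasurable f -> cmeasurable (fun x => (f x)^*).
Proof.
move=> [fr fi]; split.
  by under eq_fun do rewrite cReJ.
under eq_fun do rewrite cImJ.
exact: (measurable_funN fi).
Qed.

Lemma cmeasurable_real (f : T -> R) : measurable_fun setT f ->
  cmeasurable (fun x => (f x)%:C%C).
Proof. by move=> mf; split => //=; exact: measurable_cst. Qed.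

Lemma cmeasurable_comp d' (T' : measurableType d') (h : T' -> T) f :
  measurable_fun setT h -> cmeasurable f -> cmeasurable (fun x => f (h x)).
Proof.
by move=> mh [fr fi]; split; [exact: measurableT_comp fr mh|exact: measurableT_comp fi mh].
Qed.

Lemma cmeasurable_expi (f : T -> R) : measurable_fun setT f ->
  cmeasurable (fun x => expi (f x)).
Proof.
move=> mf; split => /=.
  by apply: measurableT_comp mf; apply: continuous_measurable_fun; exact: continuous_cos.
by apply: measurableT_comp mf; apply: continuous_measurable_fun; exact: continuous_sin.
Qed.

Variable m : {measure set T -> \bar R}.

Definition cintegrable f :=
  m.-integrable setT (fun x => (complex.Re (f x))%:E) /\
  m.-integrable setT (fun x => (complex.Im (f x))%:E).

Lemma cintegrable_meas f : cintegrable f -> cmeasurable f.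
Proof.
by move=> [fr fi]; split; apply/measurable_EFinP; exact: (measurable_int m).
Qed.

Lemma cintegrable_le f (g : T -> R) : cmeasurable f ->
  m.-integrable setT (fun x => (g x)%:E) -> (forall x, nc (f x) <= g x) ->
  cintegrable f.
Proof.
move=> [fr fi] ig fg; split.
  apply: le_integrable ig => //; first exact/measurable_EFinP.
  move=> x _; rewrite !abse_EFin lee_fin (le_trans (normr_Re _))//.
  by rewrite (le_trans (fg x))// ler_norm.
apply: le_integrable ig => //; first exact/measurable_EFinP.
move=> x _; rewrite !abse_EFin lee_fin (le_trans (normr_Im _))//.
by rewrite (le_trans (fg x))// ler_norm.
Qed.

Lemma cintegrable_nc f : cintegrable f -> m.-integrable setT (fun x => (nc (f x))%:E).
Proof.
move=> cf; have [fr fi] := cf.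
have h := integrableD measurableT (integrable_abse fr) (integrable_abse fi).
apply: le_integrable h => //.
  by apply/measurable_EFinP; apply: measurable_nc; exact: cintegrable_meas.
move=> x _ /=; rewrite lee_fin ger0_norm ?nc_ge0//.
by rewrite (le_trans (nc_le_ReIm _))// ler_norm.
Qed.

Lemma cintegrableZ (a : R[i]) f : cintegrable f -> cintegrable (fun x => a * f x).
Proof.
move=> cf; apply: (@cintegrable_le _ (fun x => nc a * nc (f x))).
- by apply: cmeasurableM; [exact: cmeasurable_cst|exact: cintegrable_meas].
- exact: (integrableZl measurableT (nc a) (cintegrable_nc cf)).
- by move=> x; rewrite ncM.
Qed.

Lemma cintegralD f g : cintegrable f -> cintegrable g ->
  cintegral m (fun x => f x + g x) = cintegral m f + cintegral m g.
Proof.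
move=> [fr fi] [gr gi]; rewrite /cintegral; apply: eq_complexP => /=.
  by rewrite -RintegralD//; apply: eq_Rintegral => x _; rewrite cReD.
by rewrite -RintegralD//; apply: eq_Rintegral => x _; rewrite cImD.
Qed.

Lemma cintegralZ (a : R[i]) f : cintegrable f ->
  cintegral m (fun x => a * f x) = a * cintegral m f.
Proof.
move=> [fr fi]; rewrite /cintegral; case: a => a b; apply: eq_complexP => /=.
  rewrite -!RintegralZl// -RintegralB//; last 2 first.
    exact: (integrableZl measurableT a fr).
    exact: (integrableZl measurableT b fi).
  by apply: eq_Rintegral => x _; rewrite cReM.
rewrite -!RintegralZl// -RintegralD//; last 2 first.
  exact: (integrableZl measurableT a fi).
  exact: (integrableZl measurableT b fr).
by apply: eq_Rintegral => x _; rewrite cImM.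
Qed.

Lemma cintegral0 : cintegral m (fun=> 0) = 0.
Proof.
by rewrite /cintegral /=; congr Complex; rewrite Rintegral_cst// mul0r.
Qed.

Lemma eq_cintegral f g : f =1 g -> cintegral m f = cintegral m g.
Proof. by move=> /funext ->. Qed.

Lemma cintegralJ f : cintegrable f ->
  cintegral m (fun x => (f x)^*) = (cintegral m f)^*.
Proof.
move=> [fr fi]; rewrite /cintegral conjcE; apply: eq_complexP => /=.
  by apply: eq_Rintegral => x _; rewrite cReJ.
rewrite -mulN1r -RintegralZl//.
by apply: eq_Rintegral => x _; rewrite cImJ mulN1r.
Qed.

(** Multiplying f by the conjugate of its integral I makes the integral equal to |I|^2, which is
    real and can be bounded through the real part of the integrand. *)
Lemma nc_cintegral f : cintegrable f ->
  nc (cintegral m f) <= \int[m]_x nc (f x).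
Proof.
move=> cf; set I := cintegral m f.
have [->|I0] := eqVneq I 0.
  by rewrite nc0 Rintegral_ge0// => x _; exact: nc_ge0.
have nI0 : nc I != 0 by apply: contra_neq I0 => /nc_eq0.
have nIp : 0 < nc I by rewrite lt_neqAle eq_sym nI0 nc_ge0.
rewrite -(ler_pM2l nIp) -expr2.
have -> : nc I ^+ 2 = complex.Re (cintegral m (fun x => I^* * f x)).
  by rewrite cintegralZ// -/I mulrC mulcJ.
rewrite -RintegralZl//; last exact: cintegrable_nc.
have [h1 h2] := cintegrableZ I^* cf.
apply: le_Rintegral => //.
  by have := integrableZl measurableT (nc I) (cintegrable_nc cf).
by move=> x _; rewrite (le_trans (Re_le_nc _))// ncM ncJ.
Qed.

Lemma cintegral_ae f g : cintegrable f -> cintegrable g ->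
  {ae m, forall x, f x = g x} -> cintegral m f = cintegral m g.
Proof.
move=> cf cg fg; have [fr fi] := cf; have [gr gi] := cg.
rewrite /cintegral /Rintegral; congr Complex; congr fine.
  apply: ae_eq_integral => //; [exact: (measurable_int m)|exact: (measurable_int m)|].
  by apply: filterS fg => x -> .
apply: ae_eq_integral => //; [exact: (measurable_int m)|exact: (measurable_int m)|].
by apply: filterS fg => x -> .
Qed.

End cint.

(** * The space of square integrable functions *)

Section sqint.
Context d (T : measurableType d) (R : realType) (m : {measure set T -> \bar R}).
Implicit Types (f g : T -> R[i]).

Definition sqint f := cmeasurable f /\
  m.-integrable setT (fun x => (nc (f x) ^+ 2)%:E).

Lemma measurable_nc2 f : cmeasurable f ->
  measurable_fun setT (fun x => (nc (f x) ^+ 2)%:E).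
Proof. by move=> mf; apply/measurable_EFinP/measurable_funX/measurable_nc. Qed.

Lemma sqint_le f g : cmeasurable f -> sqint g -> (forall x, nc (f x) <= nc (g x)) ->
  sqint f.
Proof.
move=> mf [mg ig] fg; split => //; apply: le_integrable ig => //.
  exact: measurable_nc2.
move=> x _; rewrite !abse_EFin lee_fin !ger0_norm ?sqr_ge0//.
by rewrite ler_pXn2r ?nnegrE ?nc_ge0.
Qed.

Lemma sqint0 : sqint (fun=> 0).
Proof.
split; first exact: cmeasurable_cst.
by under eq_fun do rewrite nc0 expr0n; exact: integrable0.
Qed.

Lemma sqintZ (a : R[i]) f : sqint f -> sqint (fun x => a * f x).
Proof.
move=> [mf fi]; split; first by apply: cmeasurableM => //; exact: cmeasurable_cst.
under eq_fun do rewrite ncM exprMn.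
exact: (integrableZl measurableT (nc a ^+ 2) fi).
Qed.

Lemma sqintD f g : sqint f -> sqint g -> sqint (fun x => f x + g x).
Proof.
move=> [mf fi] [mg gi]; split; first exact: cmeasurableD.
have h := integrableD measurableT (integrableZl measurableT 2 fi) (integrableZl measurableT 2 gi).
apply: le_integrable h => //.
  by apply: measurable_nc2; exact: cmeasurableD.
move=> x _ /=; rewrite lee_fin ger0_norm ?sqr_ge0//.
apply: le_trans (ler_norm _).
have h0 := ncD (f x) (g x).
have h1 : nc (f x + g x) ^+ 2 <= (nc (f x) + nc (g x)) ^+ 2.
  by rewrite ler_pXn2r ?nnegrE ?addr_ge0 ?nc_ge0.
have := sqr_ge0 (nc (f x) - nc (g x)); lra.
Qed.

Lemma sqintN f : sqint f -> sqint (fun x => - f x).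
Proof.
move=> sf; have [mf _] := sf.
by apply: (sqint_le (g := f)) => //; [exact: cmeasurableN|move=> x; rewrite ncN].
Qed.

Lemma sqint_bndM f (b : T -> R[i]) (B : R) : cmeasurable b ->
  (forall x, nc (b x) <= B) -> sqint f -> sqint (fun x => b x * f x).
Proof.
move=> mb bB sf; have [mf _] := sf.
have [[x0 _]|B0] := pselect (exists x : T, True); last first.
  apply: (sqint_le (g := f)) => //; first exact: cmeasurableM.
  by move=> x; exfalso; apply: B0; exists x.
have B0 : 0 <= B := le_trans (nc_ge0 _) (bB x0).
apply: (sqint_le (g := fun x => B%:C%C * f x)).
- exact: cmeasurableM.
- exact: sqintZ.
- by move=> y; rewrite !ncM nc_real ger0_norm// ler_wpM2r// nc_ge0.
Qed.

Lemma sqint_prod f g : sqint f -> sqint g -> cintegrable m (fun x => f x * (g x)^*).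
Proof.
move=> [mf fi] [mg gi].
apply: (@cintegrable_le _ _ _ _ _ (fun x => nc (f x) ^+ 2 + nc (g x) ^+ 2)).
- by apply: cmeasurableM => //; exact: cmeasurableJ.
- exact: (integrableD measurableT fi gi).
- move=> x; rewrite ncM ncJ; have := sqr_ge0 (nc (f x) - nc (g x)).
  have := sqr_ge0 (nc (f x) + nc (g x)); lra.
Qed.

(** Functions rather than classes, as in the statement, where operators act on functions: the
    pointwise algebra is exact and only the norm ignores null sets. *)
Record L2type := L2Type { L2fun :> T -> R[i] ; L2sq : sqint L2fun }.

HB.instance Definition _ := gen_eqMixin L2type.
HB.instance Definition _ := gen_choiceMixin L2type.

Lemma L2eq (f g : L2type) : f =1 g -> f = g.
Proof.
case: f => f sf; case: g => g sg /= /funext fg; move: sf sg; rewrite fg => sf sg.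
by congr L2Type; exact: Prop_irrelevance.
Qed.

Definition L2_0 := L2Type sqint0.
Definition L2_opp (f : L2type) := L2Type (sqintN (L2sq f)).
Definition L2_add (f g : L2type) := L2Type (sqintD (L2sq f) (L2sq g)).
Definition L2_scale (a : R[i]) (f : L2type) := L2Type (sqintZ a (L2sq f)).

Let L2_addA : associative L2_add.
Proof. by move=> f g h; apply: L2eq => x /=; rewrite addrA. Qed.
Let L2_addC : commutative L2_add.
Proof. by move=> f g; apply: L2eq => x /=; rewrite addrC. Qed.
Let L2_add0 : left_id L2_0 L2_add.
Proof. by move=> f; apply: L2eq => x /=; rewrite add0r. Qed.
Let L2_addN : left_inverse L2_0 L2_opp L2_add.
Proof. by move=> f; apply: L2eq => x /=; rewrite addNr. Qed.

HB.instance Definition _ := GRing.isZmodule.Build L2type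
  L2_addA L2_addC L2_add0 L2_addN.

Let L2_scaleA a b (f : L2type) : L2_scale a (L2_scale b f) = L2_scale (a * b) f.
Proof. by apply: L2eq => x /=; rewrite mulrA. Qed.
Let L2_scale1 : left_id 1 L2_scale.
Proof. by move=> f; apply: L2eq => x /=; rewrite mul1r. Qed.
Let L2_scaleDr : right_distributive L2_scale +%R.
Proof. by move=> a f g; apply: L2eq => x /=; rewrite mulrDr. Qed.
Let L2_scaleDl v : {morph L2_scale^~ v: a b / a + b}.
Proof. by move=> a b; apply: L2eq => x /=; rewrite mulrDl. Qed.

HB.instance Definition _ := GRing.Zmodule_isLmodule.Build R[i] L2type
  L2_scaleA L2_scale1 L2_scaleDr L2_scaleDl.

Definition L2ipf (f g : L2type) : R[i] := cintegral m (fun x => f x * (g x)^*).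

Let L2ip_linear a (u v w : L2type) :
  L2ipf (a *: u + v) w = a * L2ipf u w + L2ipf v w.
Proof.
rewrite /L2ipf -cintegralZ; last exact: sqint_prod (L2sq _) (L2sq _).
rewrite -cintegralD; last 2 first.
  by apply: cintegrableZ; exact: sqint_prod (L2sq _) (L2sq _).
  exact: sqint_prod (L2sq _) (L2sq _).
by apply: eq_cintegral => x /=; rewrite mulrDl mulrA.
Qed.

Let L2ip_conj u v : L2ipf v u = (L2ipf u v)^*.
Proof.
rewrite /L2ipf -cintegralJ; last exact: sqint_prod (L2sq _) (L2sq _).
by apply: eq_cintegral => x /=; rewrite rmorphM /= conjCK mulrC.
Qed.

Lemma L2ip_Re u : complex.Re (L2ipf u u) = \int[m]_x (nc (u x) ^+ 2).
Proof. by rewrite /L2ipf /=; apply: eq_Rintegral => x _; rewrite mulcJ. Qed.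

Let L2ip_ge0 u : 0 <= complex.Re (L2ipf u u).
Proof. by rewrite L2ip_Re Rintegral_ge0// => x _; exact: sqr_ge0. Qed.

Definition L2ip : semi_inner L2type := SemiInner L2ip_linear L2ip_conj L2ip_ge0.

Lemma L2nrm2E u : nrm2 L2ip u = \int[m]_x (nc (u x) ^+ 2).
Proof. exact: L2ip_Re. Qed.

Lemma L2nrm2_EFin u : (nrm2 L2ip u)%:E = (\int[m]_x (nc (u x) ^+ 2)%:E)%E.
Proof.
by rewrite L2nrm2E /Rintegral fineK// integrable_fin_num//; exact: (L2sq u).2.
Qed.

Lemma L2nrm_le (u v : L2type) : (forall x, nc (u x) <= nc (v x)) ->
  nrm L2ip u <= nrm L2ip v.
Proof.
move=> uv; rewrite ler_wsqrtr// !L2nrm2E; apply: le_Rintegral => //.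
- exact: (L2sq u).2.
- exact: (L2sq v).2.
- by move=> x _; rewrite ler_pXn2r ?nnegrE ?nc_ge0.
Qed.

Lemma L2ip_eq (u v u' v' : L2type) : (forall x, u x * (v x)^* = u' x * (v' x)^*) ->
  L2ip u v = L2ip u' v'.
Proof. by move=> h; rewrite /= /L2ipf; exact: eq_cintegral. Qed.

Lemma L2nrm_eq0 u : nrm L2ip u = 0 <-> ae_eq m setT u (fun=> 0).
Proof.
have -> : nrm L2ip u = 0 <-> nrm2 L2ip u = 0.
  rewrite -sqr_nrm; split => [->|/eqP]; first by rewrite expr0n.
  by rewrite sqrf_eq0 => /eqP.
have [mu iu] := L2sq u.
have h : (nrm2 L2ip u)%:E = (\int[m]_x `|(nc (u x) ^+ 2)%:E|)%E.
  rewrite L2nrm2_EFin; apply: eq_integral => x _.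
  by rewrite abse_EFin ger0_norm// sqr_ge0.
split => [u0|u0].
- have : (\int[m]_x `|(nc (u x) ^+ 2)%:E| = 0)%E by rewrite -h u0.
  move/(ae_eq_integral_abs m measurableT (measurable_nc2 mu)).
  apply: filterS => x /(_ I) [] /eqP; rewrite sqrf_eq0 => /eqP xu _.
  exact: nc_eq0.
- suff : (\int[m]_x `|(nc (u x) ^+ 2)%:E| = 0)%E by rewrite -h => -[].
  apply/(ae_eq_integral_abs m measurableT (measurable_nc2 mu)).
  by apply: filterS u0 => x /= /(_ I) -> _; rewrite nc0 expr0n.
Qed.

End sqint.

(** * Completeness of L^2 *)

Section riesz_fischer.
Context d (T : measurableType d) (R : realType) (m : {measure set T -> \bar R}).
Local Notation nrmL := (nrm (L2ip m)).

Lemma big_iota0 (V : nmodType) (F : nat -> V) n :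
  \sum_(j <- iota 0 n) F j = \sum_(j < n) F j.
Proof. by rewrite -(big_mkord xpredT) /index_iota subn0. Qed.

Lemma L2abs_sq (f : L2type m) : sqint m (fun x => (nc (f x))%:C%C).
Proof.
apply: (sqint_le _ (L2sq f)).
  by apply: cmeasurable_real; apply: measurable_nc; exact: (L2sq f).1.
by move=> x; rewrite nc_real ger0_norm ?nc_ge0.
Qed.

Definition L2abs f := L2Type (L2abs_sq f).

Lemma nrm_L2abs f : nrmL (L2abs f) = nrmL f.
Proof.
rewrite /nrm !L2nrm2E; congr Num.sqrt; apply: eq_Rintegral => x _.
by rewrite (_ : L2abs f x = (nc (f x))%:C%C)// nc_real real_normK ?num_real.
Qed.

Lemma L2_sumE I (r : seq I) (F : I -> L2type m) x :
  (\sum_(i <- r) F i) x = \sum_(i <- r) F i x.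
Proof.
elim: r => [|i r IH]; first by rewrite !big_nil.
by rewrite !big_cons -IH.
Qed.

Lemma nrm_telescope (v : nat -> L2type m) (vv : forall j, nrmL (v j.+1 - v j) <= half_pow j)
  j i : (j <= i)%N -> nrmL (v i - v j) <= 2 * half_pow j - 2 * half_pow i.
Proof.
move=> /subnKC <-; elim: (i - j)%N => [|k IH].
  by rewrite addn0 !subrr nrm0.
apply: le_trans (nrm_dist_add _ (v (j + k)%N) _ _) _.
rewrite addnS; have := vv (j + k)%N; have := @half_powS R (j + k)%N; lra.
Qed.

(** Riesz-Fischer: the sum of the |v_{j+1} - v_j| has L^2 norm at most 2, hence is finite almost
    everywhere, and there v converges. Fatou's lemma transfers the bound on v_i - v_j to the
    limit. *)
Lemma L2_complete : complete_ip (L2ip m).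
Proof.
move=> v vv.
pose dd j := L2abs (v j.+1 - v j).
pose g n x := \sum_(j < n) nc (v j.+1 x - v j x).
have g_ge0 n x : 0 <= g n x by rewrite sumr_ge0// => j _; exact: nc_ge0.
have g_nd x : nondecreasing_seq (g ^~ x).
  by apply/nondecreasing_seqP => n; rewrite /g big_ord_recr/= lerDl nc_ge0.
have gE n x : ((g n x)%:C)%C = (\sum_(j <- iota 0 n) dd j) x.
  rewrite L2_sumE big_iota0 /g.
  by rewrite rmorph_sum.
have gnrm n : nrmL (\sum_(j <- iota 0 n) dd j) <= 2.
  apply: le_trans (nrm_sum _ _ _ _) _.
  have : \sum_(j <- iota 0 n) nrmL (dd j) <= 2 - 2 * half_pow n.
    rewrite big_iota0; elim: n => [|n IH].
      by rewrite big_ord0 /half_pow expr0; lra.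
    rewrite big_ord_recr/= {2}/dd nrm_L2abs.
    have := vv n; have := @half_powS R n; lra.
  have := @half_pow_ge0 R n; lra.
pose f n x := (g n x ^+ 2)%:E.
have fE n x : f n x = (nc ((\sum_(j <- iota 0 n) dd j) x) ^+ 2)%:E.
  by rewrite -gE nc_real real_normK// num_real.
have mf n : measurable_fun setT (f n).
  rewrite (_ : f n = fun x => (nc ((\sum_(j <- iota 0 n) dd j) x) ^+ 2)%:E).
    apply: measurable_nc2; exact: (L2sq (\sum_(j <- iota 0 n) dd j)).1.
  by apply/funext => x; exact: fE.
have f0 n x : (0 <= f n x)%E by rewrite lee_fin sqr_ge0.
have f_nd x : nondecreasing_seq (f ^~ x).
  move=> i j ij; rewrite lee_fin ler_pXn2r ?nnegrE//; exact: g_nd.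
have fint n : (\int[m]_x f n x <= 4%:E)%E.
  rewrite (eq_integral (fun x => (nc ((\sum_(j <- iota 0 n) dd j) x) ^+ 2)%:E)); last by move=> x _; exact: fE.
  rewrite -L2nrm2_EFin lee_fin -sqr_nrm (_ : 4 = 2 ^+ 2); last by rewrite -natrX.
  by rewrite ler_pXn2r ?nnegrE ?nrm_ge0.
pose F x := limn (f ^~ x).
have f_cvg x : cvgn (f ^~ x) by apply: ereal_nondecreasing_is_cvgn; exact: f_nd.
have mF : measurable_fun setT F.
  by apply: (emeasurable_fun_cvg f) => // x _; exact: f_cvg.
have F0 x : (0 <= F x)%E by apply: lime_ge => //; apply: nearW => n.
have intF : (\int[m]_x F x <= 4%:E)%E.
  rewrite monotone_convergence//; apply: lime_le.
    apply: ereal_nondecreasing_is_cvgn => i j ij.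
    by apply: ge0_le_integral => // x _; exact: f_nd.
  by apply: nearW => n; exact: fint.
have iF : m.-integrable setT F.
  apply/integrableP; split => //.
  under eq_integral do rewrite gee0_abs//.
  by rewrite (le_lt_trans intF)// ltry.
have [N [mN N0 FN]] := integrable_ae measurableT iF.
have gB x : ~ N x -> exists B, forall n, g n x <= B.
  move=> Nx; have Ffin : F x \is a fin_num.
    by apply: contrapT => h; apply: Nx; apply: FN => /= /(_ I).
  exists (1 + fine (F x)) => n.
  have h : (f n x <= F x)%E.
    by apply: lime_ge => //; exists n => // k /= nk; exact: f_nd.
  rewrite -(fineK Ffin) lee_fin in h.
  have := sqr_ge0 (g n x - 1); rewrite sqrrB; have := g_ge0 n x; lra.
(* Multiplication by b replaces v by 0 on the exceptional set, so that w converges at every point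
   and its limit is measurable. *)
pose b x : R[i] := if x \in N then 0 else 1.
have mb : cmeasurable b.
  have -> : b = fun x => (\1_(~` N) x)%:C%C.
    apply/funext => x; rewrite /b indicE in_setC.
    by case: (x \in N).
  by apply: cmeasurable_real; apply: measurable_indic; exact: measurableC.
have sw j : sqint m (fun x => b x * v j x).
  apply: (sqint_bndM (B := 1)) => //; last exact: L2sq.
  by move=> x; rewrite /b; case: ifP => _; rewrite ?nc0 ?nc1.
pose w j := L2Type (sw j).
have wv j : nrmL (v j - w j) = 0.
  apply/L2nrm_eq0; exists N; split => // x /= /not_implyP[_ h].
  apply: contrapT => Nx; apply: h; rewrite /b memNset// mul1r; exact: subrr.
have wdiff i j x : nc (w i x - w j x) <= nc (v i x - v j x).
  rewrite /= -mulrBr ncM /b; case: ifP => _; first by rewrite nc0 mul0r nc_ge0.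
  by rewrite nc1 mul1r.
have cvg_part (h : R[i] -> R) (hB : forall x y, h (x - y) = h x - h y)
    (hn : forall x, `|h x| <= nc x) x : cvgn (fun j => h (w j x)).
  have hw : (fun j => h (w j x)) = (fun j => h (w 0%N x) + series (fun k => h (w k.+1 x - w k x)) j).
    apply/funext => j; rewrite /series /= big_mkord.
    elim: j => [|j IH]; first by rewrite big_ord0 addr0.
    by rewrite big_ord_recr/= addrA -IH hB addrC subrK.
  rewrite hw; apply: is_cvgD; first exact: is_cvg_cst.
  apply: normed_cvg; apply: nondecreasing_is_cvgn.
    by apply: nondecreasing_series => k _ _; exact: normr_ge0.
  have [B hB'] : exists B, forall n, \sum_(k < n) nc (w k.+1 x - w k x) <= B.
    have [Nx|Nx] := pselect (N x).
      exists 0 => n; rewrite big1// => k _.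
      by rewrite /= /b mem_set// !mul0r subrr nc0.
    have [B gBx] := gB x Nx; exists B => n; apply: le_trans (gBx n).
    by apply: ler_sum => k _; exact: wdiff.
  exists B => _ [n _ <-]; rewrite -[leLHS]/(\sum_(0 <= k < n) `|h (w k.+1 x - w k x)|) big_mkord.
  apply: le_trans (hB' n); apply: ler_sum => k _; exact: hn.
have cRe x : cvgn (fun j => complex.Re (w j x)).
  by apply: (cvg_part (@complex.Re R)) => [y z|y]; [exact: cReB|exact: normr_Re].
have cIm x : cvgn (fun j => complex.Im (w j x)).
  by apply: (cvg_part (@complex.Im R)) => [y z|y]; [exact: cImB|exact: normr_Im].
pose l x := Complex (limn (fun j => complex.Re (w j x))) (limn (fun j => complex.Im (w j x))).
have ml : cmeasurable l.
  split => /=.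
    by apply: (measurable_fun_cvg (h := fun j x => complex.Re (w j x))) => [j|x _]; [exact: (L2sq (w j)).1.1|exact: cRe].
  by apply: (measurable_fun_cvg (h := fun j x => complex.Im (w j x))) => [j|x _]; [exact: (L2sq (w j)).1.2|exact: cIm].
have fat j : (\int[m]_x (nc (l x - w j x) ^+ 2)%:E <= ((2 * half_pow j) ^+ 2)%:E)%E.
  pose h i x := (nc (w i x - w j x) ^+ 2)%:E.
  have mh i : measurable_fun setT (h i).
    by apply: measurable_nc2; exact: (L2sq (w i - w j)).1.
  have hl x : h ^~ x @ \oo --> (nc (l x - w j x) ^+ 2)%:E.
    apply: cvg_EFin; first exact: nearW.
    rewrite [X in X @ _ --> _](_ : _ = fun i => (complex.Re (w i x) - complex.Re (w j x)) ^+ 2 + (complex.Im (w i x) - complex.Im (w j x)) ^+ 2); last first.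
      by apply/funext => i; rewrite /= sqr_nc cReB cImB.
    rewrite sqr_nc cReB cImB; apply: cvgD.
      apply: (@cvg_comp _ _ _ _ (fun y => y ^+ 2) _ (nbhs (complex.Re (l x) - complex.Re (w j x)))); last exact: exprn_continuous.
      by apply: cvgB; [exact: cRe|exact: cvg_cst].
    apply: (@cvg_comp _ _ _ _ (fun y => y ^+ 2) _ (nbhs (complex.Im (l x) - complex.Im (w j x)))); last exact: exprn_continuous.
    by apply: cvgB; [exact: cIm|exact: cvg_cst].
  rewrite (eq_integral (fun x => limn_einf (h^~ x))); last first.
    by move=> x _; rewrite (cvg_limn_einf_sup (hl x)).1.
  apply: le_trans (fatou _ _ _ _) _ => //.
    by move=> i x _; rewrite lee_fin sqr_ge0.
  rewrite limn_einf_lim; apply: lime_le; first exact: is_cvg_einfs.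
  near=> n.
  apply: le_trans (ereal_inf_lbound _) _; first by exists (maxn n j) => //=; exact: leq_maxl.
  rewrite /h -(L2nrm2_EFin (w (maxn n j) - w j)) lee_fin -sqr_nrm.
  rewrite ler_pXn2r ?nnegrE ?nrm_ge0 ?mulr_ge0 ?half_pow_ge0//.
  apply: le_trans (L2nrm_le (v := v (maxn n j) - v j) _) _; first by move=> x; exact: wdiff.
  apply: le_trans (nrm_telescope vv (leq_maxr n j)) _.
  have := @half_pow_ge0 R (maxn n j); lra.
have sl : sqint m l.
  have s0 : sqint m (fun x => l x - w 0%N x).
    have m0 : cmeasurable (fun x => l x - w 0%N x).
      by apply: cmeasurableD => //; apply: cmeasurableN; exact: (L2sq (w 0%N)).1.
    split => //; apply/integrableP; split; first exact: measurable_nc2.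
    under eq_integral do rewrite gee0_abs ?lee_fin ?sqr_ge0//.
    by rewrite (le_lt_trans (fat 0%N))// ltry.
  have := sqintD s0 (L2sq (w 0%N)).
  by rewrite (_ : (fun x => _) = l)//; apply/funext => x; rewrite subrK.
exists (L2Type sl) => j.
apply: le_trans (nrm_dist_add _ (w j) _ _) _; rewrite wv add0r.
rewrite -(ler_pXn2r (_ : 0 < 2)%N) ?nnegrE ?nrm_ge0 ?mulr_ge0 ?half_pow_ge0//.
by rewrite nrm_distC sqr_nrm -lee_fin L2nrm2_EFin; exact: fat.
Unshelve. all: by end_near.
Qed.

End riesz_fischer.

(** * Integrals over row vectors *)

Section rV_integral.
Context {R : realType}.
Local Notation leb := (rV_lebesgue (R := R)).
Local Notation leb1 := (@lebesgue_measure R).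

Lemma measurable_rV_consL n :
  measurable_fun [set: (measurableTypeR R * 'rV[R]_n)%type] (@rV_cons R n).
Proof. exact: measurable_rV_cons. Qed.

Lemma ge0_integral_rVS n (F : 'rV[R]_n.+1 -> \bar R) :
  measurable_fun setT F -> (forall v, (0 <= F v)%E) ->
  (\int[leb n.+1]_v F v = \int[leb1 \x leb n]_p F (rV_cons p))%E.
Proof.
move=> mF F0.
have := ge0_integral_pushforward (@measurable_rV_consL n) (leb1 \x leb n)%E measurableT mF.
rewrite preimage_setT => <-; last by move=> v _; exact: F0.
by apply: eq_measure_integral => [|A mA _]; [exact: measurable_rV_consL|].
Qed.

Lemma ge0_integral_rVS2 n (F : 'rV[R]_n.+1 -> \bar R) :
  measurable_fun setT F -> (forall v, (0 <= F v)%E) ->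
  (\int[leb n.+1]_v F v = \int[leb1]_s \int[leb n]_w F (rV_cons (s, w)))%E.
Proof.
move=> mF F0; rewrite ge0_integral_rVS//.
rewrite (fubini_tonelli1 (fun p : measurableTypeR R * 'rV[R]_n => F (rV_cons p)))//.
by apply: measurableT_comp mF (@measurable_rV_consL n).
Qed.

Lemma ge0_lebesgue_shift (a : R) (f : R -> \bar R) :
  measurable_fun setT f -> (forall x, (0 <= f x)%E) ->
  (\int[leb1]_x f ((x : R) + a)%R = \int[leb1]_x f x)%E.
Proof.
move=> mf f0.
have msh : measurable_fun setT (fun x : measurableTypeR R => (x : R) + a : measurableTypeR R).
  by apply: measurable_funD.
have := ge0_integral_pushforward msh leb1 measurableT mf.
rewrite preimage_setT => <-; last by move=> v _; exact: f0.
apply: eq_measure_integral => A mA _.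
apply/esym/lebesgue_measure_unique => //.
move=> _ [[x y] _ <-] /=; rewrite /pushforward.
have -> : (fun x0 : R => x0 + a) @^-1` `]x, y] = `]x - a, y - a]%classic.
  by apply/seteqP; split => z /=; rewrite !in_itv /= ltrBlDr lerBrDr.
rewrite !lebesgue_measure_itv /= !lte_fin ltrD2r; case: ifP => // _; rewrite -!EFinB; congr EFin; ring.
Qed.

Lemma measurable_rV_add n (a : 'rV[R]_n) : measurable_fun setT (fun v : 'rV[R]_n => v + a).
Proof.
apply/measurable_fun_rVP => i; rewrite /comp /rV_coord.
under eq_fun do rewrite mxE.
by apply: measurable_funD; [exact: measurable_rV_coord|exact: measurable_cst].
Qed.

Lemma ge0_rV_lebesgue_shift n (a : 'rV[R]_n) (F : 'rV[R]_n -> \bar R) :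
  measurable_fun setT F -> (forall v, (0 <= F v)%E) ->
  (\int[leb n]_v F (v + a)%R = \int[leb n]_v F v)%E.
Proof.
elim: n a F => [|n IH] a F mF F0.
  by apply: eq_integral => v _; congr F; apply/rowP => -[].
have mFa : measurable_fun setT (fun v : 'rV[R]_n.+1 => F (v + a)).
  exact: measurableT_comp mF (measurable_rV_add a).
rewrite !ge0_integral_rVS2//.
pose a' : 'rV[R]_n := \row_i a ord0 (lift ord0 i).
pose G s := (\int[leb n]_w F (rV_cons (s, w)))%E.
have consD s w : rV_cons (s, w) + a = rV_cons (s + a ord0 ord0, w + a').
  apply/rowP => i; rewrite mxE.
  case: (unliftP ord0 i) => [j|] ->; last by rewrite !rV_cons0.
  by rewrite !rV_cons_lift /= !mxE.
have mcons s : measurable_fun setT (fun w : 'rV[R]_n => rV_cons (s, w)).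
  apply: measurableT_comp (@measurable_rV_consL n) _.
  by apply: measurable_fun_pair => //; exact: measurable_cst.
transitivity (\int[leb1]_s G ((s : R) + a ord0 ord0)%R)%E.
  apply: eq_integral => s _; rewrite /G.
  under eq_integral do rewrite consD.
  rewrite (IH a' (fun w => F (rV_cons (s + a ord0 ord0, w))))//.
  exact: measurableT_comp mF (mcons _).
rewrite ge0_lebesgue_shift//; last by move=> s; apply: integral_ge0.
have mFc : measurable_fun [set: (measurableTypeR R * 'rV[R]_n)%type] (F \o @rV_cons R n).
  exact: measurableT_comp mF (@measurable_rV_consL n).
have h := measurable_fun_fubini_tonelli_F (m2 := leb n) _ mFc.
by apply: h => p; exact: F0.
Qed.

End rV_integral.

Section product_integral.
Context d1 d2 (X : measurableType d1) (Y : measurableType d2) (R : realType).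
Variables (m1 : {sigma_finite_measure set X -> \bar R}).
Variables (m2 : {sigma_finite_measure set Y -> \bar R}).

Lemma Rintegral_prod (u : X -> R) (v : Y -> R) :
  m1.-integrable setT (EFin \o u) -> m2.-integrable setT (EFin \o v) ->
  (m1 \x m2)%E.-integrable setT (fun p => (u p.1 * v p.2)%:E) /\
  \int[(m1 \x m2)%E]_p (u p.1 * v p.2) = (\int[m1]_x u x) * (\int[m2]_y v y).
Proof.
move=> iu iv.
have mu : measurable_fun setT u by apply/measurable_EFinP; exact: measurable_int iu.
have mv : measurable_fun setT v by apply/measurable_EFinP; exact: measurable_int iv.
have muv : measurable_fun [set: (X * Y)%type] (fun p => (u p.1 * v p.2)%:E).
  by apply/measurable_EFinP; apply: measurable_funM; apply: measurableT_comp.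
have vfin : (\int[m2]_y `|(v y)%:E|)%E \is a fin_num.
  exact: (integrable_fin_num measurableT (integrable_abse iv)).
have ii : (m1 \x m2)%E.-integrable setT (fun p => (u p.1 * v p.2)%:E).
  apply/(integrable12ltyP m1 m2 muv) => /=.
  under eq_integral.
    move=> x _; under eq_integral do rewrite normrM EFinM.
    rewrite ge0_integralZl ?lee_fin//; last first.
      by apply/measurable_EFinP; exact: measurableT_comp.
    over.
  rewrite -(fineK vfin) ge0_integralZr ?lee_fin ?fine_ge0 ?integral_ge0//; last first.
    by apply/measurable_EFinP; exact: measurableT_comp.
  have [_ uoo] := integrableP _ _ _ iu.
  by rewrite lte_mul_pinfty// ?ltry//; [exact: integral_ge0|exact: integrable_fin_num (integrable_abse iu)].
split => //.
rewrite /Rintegral -(integral12_prod_meas1 ii) /fubini_F /=.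
under eq_integral.
  move=> x _; under eq_integral do rewrite EFinM.
  rewrite integralZl//; over.
rewrite -(fineK (integrable_fin_num measurableT iv)) integralZr//.
by rewrite -(fineK (integrable_fin_num measurableT iu)).
Qed.

Lemma cintegral_prod2 (f : X -> R[i]) (g : Y -> R[i]) :
  cintegrable m1 f -> cintegrable m2 g ->
  cintegrable (m1 \x m2)%E (fun p => f p.1 * g p.2) /\
  cintegral (m1 \x m2)%E (fun p => f p.1 * g p.2) = cintegral m1 f * cintegral m2 g.
Proof.
move=> [fr fi] [gr gi].
have [i1 e1] := Rintegral_prod fr gr.
have [i2 e2] := Rintegral_prod fi gi.
have [i3 e3] := Rintegral_prod fr gi.
have [i4 e4] := Rintegral_prod fi gr.
split.
  split; under eq_fun do rewrite ?cReM ?cImM ?EFinB ?EFinD.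
    exact: integrableB.
  exact: integrableD.
rewrite /cintegral; apply: eq_complexP => /=.
  rewrite -e1 -e2 -RintegralB//.
  by apply: eq_Rintegral => p _; rewrite cReM.
rewrite -e3 -e4 -RintegralD//.
by apply: eq_Rintegral => p _; rewrite cImM.
Qed.

End product_integral.

Section rV_product.
Context {R : realType}.
Local Notation leb := (rV_lebesgue (R := R)).
Local Notation leb1 := (@lebesgue_measure R).

Lemma integral_rVS n (F : 'rV[R]_n.+1 -> R) : measurable_fun setT F ->
  (leb1 \x leb n)%E.-integrable setT (fun p => (F (rV_cons p))%:E) ->
  (leb n.+1).-integrable setT (EFin \o F) /\
  \int[leb n.+1]_v F v = \int[(leb1 \x leb n)%E]_p F (rV_cons p).
Proof.
move=> mF iF.
have mF' : measurable_fun setT (EFin \o F) by exact/measurable_EFinP.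
have iF' : (leb n.+1).-integrable setT (EFin \o F).
  apply/integrableP; split => //.
  rewrite ge0_integral_rVS//; last exact: measurableT_comp.
  by have [_] := integrableP _ _ _ iF.
split => //; rewrite /Rintegral; congr fine.
have := integral_pushforward (@measurable_rV_consL R n)
  (mu := (leb1 \x leb n)%E) (D := setT) mF'.
rewrite preimage_setT => /(_ iF measurableT) <-.
by apply: eq_measure_integral => [|A mA _]; [exact: measurable_rV_consL|].
Qed.

Lemma cintegral_prod n (phi : 'I_n -> R -> R[i]) :
  (forall j, cintegrable leb1 (phi j)) ->
  cintegrable (leb n) (fun v => \prod_(j < n) phi j (v ord0 j)) /\
  cintegral (leb n) (fun v => \prod_(j < n) phi j (v ord0 j)) =
    \prod_(j < n) cintegral leb1 (phi j).
Proof.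
elim: n phi => [|n IH] phi iphi.
  under eq_fun do rewrite big_ord0.
  rewrite big_ord0; split.
    apply: (@cintegrable_le _ _ _ _ _ (fun=> 1)).
    - exact: cmeasurable_cst.
    - apply/integrableP; split; first exact/measurable_EFinP/measurable_cst.
      rewrite integral_cst//= normr1 mul1e diracE mem_set//= ltry //.
    - by move=> x; rewrite nc1.
  rewrite /cintegral /=; apply: eq_complexP => /=.
    by rewrite Rintegral_cst//= indicT mul1r.
  by rewrite Rintegral_cst//= mul0r.
have [iP eP] := IH (fun j => phi (lift ord0 j)) (fun j => iphi _).
have [iQ eQ] := cintegral_prod2 (iphi ord0) iP.
have consE p : \prod_(j < n.+1) phi j (rV_cons p ord0 j) =
    phi ord0 p.1 * \prod_(j < n) phi (lift ord0 j) (p.2 ord0 j).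
  rewrite big_ord_recl rV_cons0; congr (_ * _).
  by apply: eq_bigr => j _; rewrite rV_cons_lift.
have mF : cmeasurable (fun v : 'rV[R]_n.+1 => \prod_(j < n.+1) phi j (v ord0 j)).
  elim: (index_enum _) => [|j r IHr].
    under eq_fun do rewrite big_nil; exact: cmeasurable_cst.
  under eq_fun do rewrite big_cons; apply: cmeasurableM => //.
  apply: (cmeasurable_comp (h := fun v : 'rV[R]_n.+1 => v ord0 j)).
    exact: measurable_rV_coord.
  exact: cintegrable_meas (iphi j).
have [iQr iQi] := iQ; have [mr mi] := mF.
have [|ir er] := @integral_rVS n (fun v => complex.Re (\prod_(j < n.+1) phi j (v ord0 j))) mr.
  by under eq_fun do rewrite consE.
have [|ii ei] := @integral_rVS n (fun v => complex.Im (\prod_(j < n.+1) phi j (v ord0 j))) mi.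
  by under eq_fun do rewrite consE.
split => //; rewrite big_ord_recl -eP -eQ /cintegral; apply: eq_complexP => /=.
  by rewrite er; apply: eq_Rintegral => p _; rewrite consE.
by rewrite ei; apply: eq_Rintegral => p _; rewrite consE.
Qed.

End rV_product.

(** * Integration against a complex measure *)

Section charge_to_measure.
Context d (T : measurableType d) (R : realType).

(** The second clause asks that nu vanish on all measurable subsets of A, since nu A = 0 alone lets
    positive and negative mass cancel. The Jordan parts are restrictions of nu up to sign, so they
    inherit it. *)
Lemma charge_integral_measures (nu : {charge set T -> \bar R}) :
  exists m1 m2 : {finite_measure set T -> \bar R},
    (forall f, charge_integral nu f = \int[m1]_x f x - \int[m2]_x f x) /\
    (forall A, measurable A ->
      (forall B, measurable B -> B `<=` A -> nu B = 0%E) ->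
      m1 A = 0%E /\ m2 A = 0%E).
Proof.
rewrite /charge_integral; case: cid => P exN; case: cid => N nuPN.
exists (jordan_pos nuPN), (jordan_neg nuPN); split => // A mA nuA.
have [[mP _] [mN _] _ _] := nuPN.
have e1 : jordan_pos nuPN A = 0%E.
  rewrite jordan_posE cjordan_posE /crestr0 mem_set// /crestr /= nuA//.
  exact: measurableI.
have e2 : jordan_neg nuPN A = 0%E.
  rewrite jordan_negE cjordan_negE /crestr0 mem_set// /crestr /= nuA ?oppe0//.
  exact: measurableI.
by split.
Qed.

(** A class on which all integrals against finite measures exist, so that [cm_integral] is linear
    there. *)
Definition bcm (f : T -> R[i]) :=
  cmeasurable f /\ exists B : R, forall x, nc (f x) <= B.

Lemma bcm_cintegrable (m : {finite_measure set T -> \bar R}) f : bcm f ->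
  cintegrable m f.
Proof.
move=> [mf [B fB]]; apply: (@cintegrable_le _ _ _ _ _ (fun=> B)) => //.
exact: (@finite_measure_integrable_cst _ _ _ m setT B).
Qed.

Lemma bcmD f g : bcm f -> bcm g -> bcm (fun x => f x + g x).
Proof.
move=> [mf [B fB]] [mg [D gD]]; split; first exact: cmeasurableD.
by exists (B + D) => x; rewrite (le_trans (ncD _ _))// lerD.
Qed.

Lemma bcmM f g : bcm f -> bcm g -> bcm (fun x => f x * g x).
Proof.
move=> [mf [B fB]] [mg [D gD]]; split; first exact: cmeasurableM.
by exists (B * D) => x; rewrite ncM ler_pM ?nc_ge0.
Qed.

Lemma bcm_cst (a : R[i]) : bcm (fun=> a).
Proof. by split; [exact: cmeasurable_cst|exists (nc a)]. Qed.

Lemma bcmZ a f : bcm f -> bcm (fun x => a * f x).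
Proof. exact: bcmM (bcm_cst a). Qed.

Lemma bcmN f : bcm f -> bcm (fun x => - f x).
Proof.
move=> [mf [B fB]]; split; first exact: cmeasurableN.
by exists B => x; rewrite ncN.
Qed.

Lemma bcm_sum I (r : seq I) (F : I -> T -> R[i]) :
  (forall i, bcm (F i)) -> bcm (fun x => \sum_(i <- r) F i x).
Proof.
move=> bF; elim: r => [|i r IH].
  by under eq_fun do rewrite big_nil; exact: bcm_cst.
by under eq_fun do rewrite big_cons; exact: bcmD.
Qed.

Lemma bcm_expi (f : T -> R) : measurable_fun setT f -> bcm (fun x => expi (f x)).
Proof.
by move=> mf; split; [exact: cmeasurable_expi|exists 1 => x; rewrite nc_expi].
Qed.

(** The four measures are the Jordan parts of [cm_Re mu] and [cm_Im mu]; the exponents 0, 2, 1, 3 of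
    i produce their coefficients 1, -1, i, -i. *)
Lemma cm_integral_bcm (mu : complex_measure T R) :
  exists m : 'I_4 -> {finite_measure set T -> \bar R},
    (forall f, bcm f ->
      cm_integral mu f = \sum_(k < 4) 'i%C ^+ (nth 0%N [:: 0; 2; 1; 3]%N k) * cintegral (m k) f) /\
    (forall A, measurable A ->
      (forall B, measurable B -> B `<=` A -> cm_Re mu B = 0%E /\ cm_Im mu B = 0%E) ->
      forall k, m k A = 0%E).
Proof.
have [m0 [m1 [h1 n1]]] := charge_integral_measures (cm_Re mu).
have [m2 [m3 [h2 n2]]] := charge_integral_measures (cm_Im mu).
pose m (k : 'I_4) := nth m0 [:: m0; m1; m2; m3] k.
exists m; split => [f bf|A mA nuA k].
  rewrite /cm_integral !h1 !h2 !big_ord_recl big_ord0 /= /m /cintegral /=.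
  rewrite expr0 expr1 (exprSr _ 2) sqr_i mul1r !mulN1r addr0.
  by apply: eq_complexP; rewrite !(cReD, cImD, cReN, cImN, cReM, cImM) /=; ring.
have [a b] := n1 A mA (fun B mB BA => (nuA B mB BA).1).
have [c e] := n2 A mA (fun B mB BA => (nuA B mB BA).2).
by rewrite /m; case: k => [[|[|[|[|//]]]] ?] /=.
Qed.

Lemma cm_integralD mu f g : bcm f -> bcm g ->
  cm_integral mu (fun x => f x + g x) = cm_integral mu f + cm_integral mu g.
Proof.
move=> bf bg; have [m [mE _]] := cm_integral_bcm mu.
rewrite !mE//; last exact: bcmD.
rewrite -big_split /=; apply: eq_bigr => k _.
by rewrite cintegralD ?mulrDr//; exact: bcm_cintegrable.
Qed.

Lemma cm_integralZ mu a f : bcm f ->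
  cm_integral mu (fun x => a * f x) = a * cm_integral mu f.
Proof.
move=> bf; have [m [mE _]] := cm_integral_bcm mu.
rewrite !mE//; last exact: bcmZ.
rewrite mulr_sumr; apply: eq_bigr => k _.
by rewrite cintegralZ 1?mulrCA//; exact: bcm_cintegrable.
Qed.

Lemma cm_integralB mu f g : bcm f -> bcm g ->
  cm_integral mu (fun x => f x - g x) = cm_integral mu f - cm_integral mu g.
Proof.
move=> bf bg; rewrite cm_integralD//; last exact: bcmN.
congr (_ + _); rewrite -mulN1r -cm_integralZ//.
by congr cm_integral; apply/funext => x; rewrite mulN1r.
Qed.

Lemma cm_integral_sum mu I (r : seq I) (F : I -> T -> R[i]) :
  (forall i, bcm (F i)) ->
  cm_integral mu (fun x => \sum_(i <- r) F i x) = \sum_(i <- r) cm_integral mu (F i).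
Proof.
move=> bF; elim: r => [|i r IH].
  under eq_fun do rewrite big_nil; rewrite big_nil.
  rewrite -[RHS](mul0r (cm_integral mu (fun=> 1))) -cm_integralZ; last exact: bcm_cst.
  by congr cm_integral; apply/funext => x; rewrite mul0r.
under eq_fun do rewrite big_cons; rewrite big_cons cm_integralD ?IH//.
exact: bcm_sum.
Qed.

(** M is the total mass of the four positive measures. The complement of K is null for each of them,
    so a bound of f on K is enough. *)
Lemma cm_integral_le mu (K : set T) : measurable K ->
  (forall B, measurable B -> B `<=` ~` K -> cm_Re mu B = 0%E /\ cm_Im mu B = 0%E) ->
  exists2 M : R, 0 <= M & forall f (e : R), bcm f -> 0 <= e ->
    (forall x, K x -> nc (f x) <= e) -> nc (cm_integral mu f) <= M * e.
Proof.
move=> mK muK; have [m [mE m0]] := cm_integral_bcm mu.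
exists (\sum_k fine (m k setT)) => [|f e bf e0 fK].
  by rewrite sumr_ge0// => k _; exact: fine_ge0.
rewrite mE// (le_trans (nc_sum _ _ _))// mulr_suml ler_sum// => k _.
rewrite ncM ncX [X in X ^+ _](_ : _ = 1) ?expr1n ?mul1r; last first.
  by rewrite ncE /= expr0n expr1n add0r sqrtr1.
have cf := bcm_cintegrable (m k) bf.
rewrite (le_trans (nc_cintegral cf))// mulrC.
rewrite -(Rintegral_cst (m k))// -lee_fin /Rintegral.
rewrite !fineK; last 2 first.
- exact: integrable_fin_num (@finite_measure_integrable_cst _ _ _ (m k) setT e measurableT).
- exact: integrable_fin_num (cintegrable_nc cf).
apply: ae_ge0_le_integral => //.
- by move=> x _; rewrite lee_fin nc_ge0.
- by apply/measurable_EFinP; apply: measurable_nc; exact: bf.1.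
exists (~` K); split; first exact: measurableC.
  by apply: m0 => //; exact: measurableC.
move=> x /= /not_implyP[_ h] Kx; apply: h.
by rewrite lee_fin fK.
Qed.

End charge_to_measure.

(** * The Weyl operator *)

Section L2_representatives.
Context {R : realType} (n : nat).
Local Notation leb := (rV_lebesgue (R := R) n).
Local Notation V := (L2type leb).
Local Notation ip := (L2ip leb).

Lemma L2normE (f : 'rV[R]_n -> R[i]) : cmeasurable f ->
  L2norm f = ((\int[leb]_x (nc (f x) ^+ 2)%:E) `^ (2^-1))%E.
Proof.
move=> mf; rewrite /L2norm unlock.
congr (_ `^ _)%E; apply: eq_integral => x _ /=.
by rewrite ger0_norm ?nc_ge0// powR_mulrn// nc_ge0.
Qed.

Lemma L2norm_nrm (f : V) : L2norm f = (nrm ip f)%:E.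
Proof.
rewrite (L2normE (L2sq f).1) -L2nrm2_EFin poweR_EFin powR12_sqrt//.
exact: nrm2_ge0.
Qed.

Lemma L2P (f : 'rV[R]_n -> R[i]) : L2 f <-> sqint leb f.
Proof.
split => [[mf foo]|sf].
  split => //; apply/integrableP; split; first exact: measurable_nc2.
  under eq_integral do rewrite gee0_abs ?lee_fin ?sqr_ge0//.
  rewrite ltNge; apply/negP; rewrite leye_eq => /eqP h.
  by move: foo; rewrite L2normE// h poweRyr ?invr_eq0// ltxx.
by split; [exact: sf.1|rewrite (L2norm_nrm (L2Type sf)) ltry].
Qed.

Lemma sqint_shift (f : 'rV[R]_n -> R[i]) (a : 'rV[R]_n) : sqint leb f ->
  sqint leb (fun t => f (t - a)) /\
  (\int[leb]_t (nc (f (t - a)) ^+ 2)%:E = \int[leb]_t (nc (f t) ^+ 2)%:E)%E.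
Proof.
move=> [mf fi].
have mfa : cmeasurable (fun t : 'rV[R]_n => f (t - a)).
  exact: cmeasurable_comp (measurable_rV_add (- a)) mf.
have e := @ge0_rV_lebesgue_shift R n (- a) (fun t => (nc (f t) ^+ 2)%:E)
  (measurable_nc2 mf) (fun v => sqr_ge0 _).
split => //; split => //.
apply/integrableP; split; first exact: measurable_nc2.
under eq_integral do rewrite gee0_abs ?lee_fin ?sqr_ge0//.
rewrite e; have [_] := integrableP _ _ _ fi.
by under eq_integral do rewrite gee0_abs ?lee_fin ?sqr_ge0//.
Qed.

Definition L2shift (a : 'rV[R]_n) (f : V) : V :=
  L2Type (sqint_shift a (L2sq f)).1.

Lemma nrm_L2shift a f : nrm ip (L2shift a f) = nrm ip f.
Proof.
rewrite /nrm; congr Num.sqrt; apply: EFin_inj; rewrite !L2nrm2_EFin.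
exact: (sqint_shift a (L2sq f)).2.
Qed.

Lemma L2mul_sq (b : 'rV[R]_n -> R[i]) (bb : bcm b) (f : V) :
  sqint leb (fun t => b t * f t).
Proof. by case: bb => mb [B bB]; exact: sqint_bndM mb bB (L2sq f). Qed.

Definition L2mul b (bb : bcm b) (f : V) : V := L2Type (L2mul_sq bb f).

Lemma nrm_L2mul b (bb : bcm b) B f : 0 <= B -> (forall x, nc (b x) <= B) ->
  nrm ip (L2mul bb f) <= B * nrm ip f.
Proof.
move=> B0 bB; have -> : B * nrm ip f = nrm ip (B%:C%C *: f).
  by rewrite nrmZ nc_real ger0_norm.
apply: L2nrm_le => x.
rewrite -[leLHS]/(nc (b x * f x)) -[leRHS]/(nc (B%:C%C * f x)) !ncM.
by rewrite nc_real ger0_norm// ler_wpM2r ?nc_ge0.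
Qed.

Lemma measurable_dotv d (T : measurableType d) (u v : T -> 'rV[R]_n) :
  measurable_fun setT u -> measurable_fun setT v ->
  measurable_fun setT (fun x => dotv (u x) (v x)).
Proof.
move=> mu mv; apply: measurable_sum => i.
apply: measurable_funM.
  exact: measurableT_comp (measurable_rV_coord i) mu.
exact: measurableT_comp (measurable_rV_coord i) mv.
Qed.

Local Notation phase := ('rV[R]_n * 'rV[R]_n)%type.

Lemma rho_phase_bcm (z : phase) :
  bcm (fun t : 'rV[R]_n => expi (- pi * dotv z.1 z.2) * expi (2 * pi * dotv t z.2)).
Proof.
apply: bcmM; first exact: bcm_cst.
apply: bcm_expi; apply: measurable_funM; first exact: measurable_cst.
by apply: measurable_dotv; [exact: measurable_id|exact: measurable_cst].
Qed.

Definition L2rho (z : phase) (f : V) : V := L2mul (rho_phase_bcm z) (L2shift z.1 f).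

Lemma nrm_L2rho z f : nrm ip (L2rho z f) <= nrm ip f.
Proof.
rewrite -(nrm_L2shift z.1 f) -[leRHS]mul1r; apply: nrm_L2mul => // t.
by rewrite ncM !nc_expi mul1r.
Qed.

Lemma L2rho_linear z a f g : L2rho z (a *: f + g) = a *: L2rho z f + L2rho z g.
Proof. by apply: L2eq => t; rewrite /= mulrDr mulrCA. Qed.

Lemma measurable_param_Rintegral d (X : measurableType d) (F : X * 'rV[R]_n -> R) :
  measurable_fun setT F -> measurable_fun setT (fun x => \int[leb]_t F (x, t)).
Proof.
move=> mF; rewrite /Rintegral; apply: measurableT_comp; first exact: fine_measurable.
under eq_fun do rewrite integralE.
have mF' : measurable_fun setT (EFin \o F) by exact/measurable_EFinP.
have h1 := measurable_fun_fubini_tonelli_F (m2 := leb) _ (measurable_funepos mF') (fun x => funepos_ge0 _ x).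
have h2 := measurable_fun_fubini_tonelli_F (m2 := leb) _ (measurable_funeneg mF') (fun x => funeneg_ge0 _ x).
apply: emeasurable_funB.
  have -> // : (fun x => \int[leb]_t (fun t => (F (x, t))%:E)^\+ t)%E =
      fubini_F leb (EFin \o F)^\+%E.
  by apply/funext => x; apply: eq_integral => t _; rewrite unlock.
have -> // : (fun x => \int[leb]_t (fun t => (F (x, t))%:E)^\- t)%E =
    fubini_F leb (EFin \o F)^\-%E.
by apply/funext => x; apply: eq_integral => t _; rewrite unlock.
Qed.

(** The variable z occurs both in the translation and in the phase; the integrand is jointly
    measurable in z and t, and Fubini's theorem gives the measurability of its integral. *)
Lemma bcm_ip_rho (f g : V) : bcm (fun z => ip (L2rho z f) g).
Proof.
split; last first.
  exists (nrm ip f * nrm ip g) => z.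
  rewrite (le_trans (cauchy_schwarz _ _ _))// ler_wpM2r ?nrm_ge0//.
  exact: nrm_L2rho.
have mF : @cmeasurable _ (phase * 'rV[R]_n)%type R (fun p => rho p.1 f p.2 * (g p.2)^*).
  have m1 : measurable_fun [set: (phase * 'rV[R]_n)%type] (fun p => p.1.1).
    exact: measurableT_comp measurable_fst measurable_fst.
  have m2 : measurable_fun [set: (phase * 'rV[R]_n)%type] (fun p => p.1.2).
    exact: measurableT_comp measurable_snd measurable_fst.
  apply: cmeasurableM; last first.
    apply: cmeasurableJ; apply: (cmeasurable_comp (h := snd)); first exact: measurable_snd.
    exact: (L2sq g).1.
  apply: cmeasurableM; first apply: cmeasurableM.
  - apply: cmeasurable_expi; apply: measurable_funM; first exact: measurable_cst.
    exact: measurable_dotv.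
  - apply: cmeasurable_expi; apply: measurable_funM; first exact: measurable_cst.
    by apply: measurable_dotv.
  - apply: (cmeasurable_comp (h := fun p : phase * 'rV[R]_n => p.2 - p.1.1)).
      apply/measurable_fun_rVP => i; rewrite /comp /rV_coord.
      under eq_fun do rewrite mxE mxE.
      apply: measurable_funB; first exact: measurableT_comp (measurable_rV_coord i) measurable_snd.
      exact: measurableT_comp (measurable_rV_coord i) m1.
    exact: (L2sq f).1.
have [mr mi] := mF.
split; first exact: (measurable_param_Rintegral mr).
exact: (measurable_param_Rintegral mi).
Qed.

End L2_representatives.

(** * The sesquilinear form of the Weyl operator *)

Section weyl_operator.
Context {R : realType} (n : nat).
Local Notation leb := (rV_lebesgue (R := R) n).
Local Notation V := (L2type leb).
Local Notation ip := (L2ip leb).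
Local Notation phase := ('rV[R]_n * 'rV[R]_n)%type.

Definition phase_box (lam : R) : set phase :=
  [set z : phase | forall j : 'I_n, `|z.1 ord0 j| <= lam /\ `|z.2 ord0 j| <= lam].

Lemma measurable_phase_box lam : measurable (phase_box lam).
Proof.
have -> : phase_box lam = \big[setI/setT]_(j < n)
    ((fun z : phase => z.1 ord0 j) @^-1` `[- lam, lam] `&`
     (fun z : phase => z.2 ord0 j) @^-1` `[- lam, lam]).
  rewrite -bigcap_seq; apply/seteqP; split => z /=.
    by move=> h j _; have [h1 h2] := h j; split; rewrite /= in_itv /= -ler_norml.
  by move=> h j; have := h j (mem_index_enum j); rewrite /= !in_itv /= -!ler_norml.
apply: bigsetI_measurable => j _; apply: measurableI; rewrite -[X in measurable X]setTI.
  have m1 : measurable_fun [set: phase] (fun z => z.1 ord0 j).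
    exact: measurableT_comp (measurable_rV_coord j) measurable_fst.
  exact: m1.
have m2 : measurable_fun [set: phase] (fun z => z.2 ord0 j).
  exact: measurableT_comp (measurable_rV_coord j) measurable_snd.
exact: m2.
Qed.

Lemma compact_phase_box (K : set phase) : compact K ->
  exists2 lam : R, 0 <= lam & K `<=` phase_box lam.
Proof.
move=> cK.
have bnd (h : phase -> R) : continuous h -> exists2 M : R, 0 <= M & forall z, K z -> `|h z| <= M.
  move=> ch; have cI : compact (h @` K).
    by apply: continuous_compact => //; exact: continuous_subspaceT.
  have [M [_ Mh]] := compact_bounded cI.
  exists (Num.max 0 (M + 1)); first by rewrite le_max lexx.
  move=> z Kz; rewrite le_max; apply/orP; right.
  by apply: (Mh (M + 1)); [rewrite ltrDl|exists z].
have /choice[f fP] (j : 'I_n) : exists M : R, 0 <= M /\ forall z, K z ->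
    `|z.1 ord0 j| <= M /\ `|z.2 ord0 j| <= M.
  have [|M1 M10 h1] := bnd (fun z => z.1 ord0 j).
    by move=> z; apply: (@cvg_comp _ _ _ fst (fun v : 'rV[R]_n => v ord0 j) _ (nbhs z.1)); [exact: cvg_fst|exact: coord_continuous].
  have [|M2 M20 h2] := bnd (fun z => z.2 ord0 j).
    by move=> z; apply: (@cvg_comp _ _ _ snd (fun v : 'rV[R]_n => v ord0 j) _ (nbhs z.2)); [exact: cvg_snd|exact: coord_continuous].
  exists (M1 + M2); split; first exact: addr_ge0.
  by move=> z Kz; split; [rewrite (le_trans (h1 z Kz))// lerDl|rewrite (le_trans (h2 z Kz))// lerDr].
exists (\sum_j f j); first by rewrite sumr_ge0// => j _; exact: (fP j).1.
move=> z Kz j.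
have fj : f j <= \sum_j f j.
  by rewrite (bigD1 j)//= lerDl sumr_ge0// => i _; exact: (fP i).1.
by have [h1 h2] := (fP j).2 z Kz; split; exact: le_trans fj.
Qed.

Variable mu : complex_measure phase R.

Definition weyl_form (f g : V) : R[i] := cm_integral mu (fun z => ip (L2rho z f) g).

Lemma weyl_form_linear a f1 f2 g :
  weyl_form (a *: f1 + f2) g = a * weyl_form f1 g + weyl_form f2 g.
Proof.
rewrite /weyl_form -cm_integralZ; last exact: bcm_ip_rho.
rewrite -cm_integralD; [|apply: bcmZ; exact: bcm_ip_rho|exact: bcm_ip_rho].
by congr cm_integral; apply/funext => z; rewrite L2rho_linear sip_linear.
Qed.

Lemma weyl_form_conj_linear a f g1 g2 :
  weyl_form f (a *: g1 + g2) = a^* * weyl_form f g1 + weyl_form f g2.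
Proof.
rewrite /weyl_form -cm_integralZ; last exact: bcm_ip_rho.
rewrite -cm_integralD; [|apply: bcmZ; exact: bcm_ip_rho|exact: bcm_ip_rho].
by congr cm_integral; apply/funext => z; rewrite ipDr ipZr.
Qed.

Lemma weyl_form_bound (lam : R) :
  (forall B, measurable B -> B `<=` ~` phase_box lam -> cm_Re mu B = 0%E /\ cm_Im mu B = 0%E) ->
  exists2 M : R, 0 <= M & forall f g, nc (weyl_form f g) <= M * (nrm ip f * nrm ip g).
Proof.
move=> muK; have [M M0 MP] := cm_integral_le (measurable_phase_box lam) muK.
exists M => // f g; apply: MP; first exact: bcm_ip_rho.
  by rewrite mulr_ge0 ?nrm_ge0.
move=> z _; rewrite (le_trans (cauchy_schwarz _ _ _))// ler_wpM2r ?nrm_ge0//.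
exact: nrm_L2rho.
Qed.

(** Both operators come from [riesz], applied to the form in each of its two arguments; they are
    adjoint because they represent the same form. It is S that makes T linear up to vectors of norm
    0. *)
Lemma weyl_operator_exists (M : R) : 0 <= M ->
  (forall f g, nc (weyl_form f g) <= M * (nrm ip f * nrm ip g)) ->
  exists T S : V -> V, [/\ forall f g, ip (T f) g = weyl_form f g,
    forall f g, ip (T f) g = ip f (S g) &
    forall f, nrm ip (T f) <= M * nrm ip f].
Proof.
move=> M0 Mw.
have /choice[T TP] f : exists w, forall g, (weyl_form f g)^* = ip g w.
  apply: (riesz (@L2_complete _ _ _ leb) (K := M * nrm ip f)) => [a u v|u].
    by rewrite weyl_form_conj_linear rmorphD rmorphM /= conjCK.
  by rewrite ncJ (le_trans (Mw _ _))// mulrA.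
have /choice[S SP] g : exists w, forall f, weyl_form f g = ip f w.
  apply: (riesz (@L2_complete _ _ _ leb) (K := M * nrm ip g)) => [a u v|u].
    exact: weyl_form_linear.
  by rewrite (le_trans (Mw _ _))// mulrA mulrAC.
have TE f g : ip (T f) g = weyl_form f g by rewrite sip_conj -TP conjCK.
exists T, S; split => // [f g|f]; first by rewrite TE SP.
have [->|T0] := eqVneq (nrm ip (T f)) 0; first by rewrite mulr_ge0 ?nrm_ge0.
have Tp : 0 < nrm ip (T f) by rewrite lt_neqAle eq_sym T0 nrm_ge0.
rewrite -(ler_pM2l Tp) -expr2 sqr_nrm /nrm2 TE.
by rewrite (le_trans (Re_le_nc _))// (le_trans (Mw _ _))// mulrA mulrC.
Qed.

End weyl_operator.

(** * From semi-inner product operators to operators on functions *)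

Section representatives.
Context {R : realType} (n : nat).
Local Notation leb := (rV_lebesgue (R := R) n).
Local Notation V := (L2type leb).
Local Notation ip := (L2ip leb).
Local Notation fn := ('rV[R]_n -> R[i]).

Definition L2lift (T : V -> V) (f : fn) : fn :=
  if pselect (sqint leb f) is left sf then T (L2Type sf) else fun=> 0.

Lemma L2liftE T f (sf : sqint leb f) : L2lift T f = T (L2Type sf).
Proof.
by rewrite /L2lift; case: pselect => // sf'; congr (L2fun (T _)); exact: L2eq.
Qed.

Lemma L2lift_val T (f : V) : L2lift T f = T f.
Proof. by rewrite (L2liftE T (L2sq f)); congr (L2fun (T _)); exact: L2eq. Qed.

Lemma nrm0_ae (f g : V) : nrm ip (f - g) = 0 <-> ae_eq leb setT f g.
Proof.
rewrite L2nrm_eq0; split; apply: filterS => x /= h _.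
  by apply/eqP; rewrite -subr_eq0; apply/eqP; exact: h.
by apply/eqP; rewrite subr_eq0; apply/eqP; exact: h.
Qed.

Variables (T S : V -> V) (K : R).
Hypothesis adj : forall f g, ip (T f) g = ip f (S g).
Hypothesis TK : forall f, nrm ip (T f) <= K * nrm ip f.

Lemma bounded_L2lift : bounded_operator (L2lift T).
Proof.
split.
- by move=> f /L2P sf; rewrite (L2liftE _ sf); apply/L2P; exact: L2sq.
- move=> a f g /L2P sf /L2P sg.
  have sfg : sqint leb (fun t => a * f t + g t) := L2sq (a *: L2Type sf + L2Type sg).
  rewrite !L2liftE.
  have -> : L2Type sfg = a *: L2Type sf + L2Type sg by exact: L2eq.
  apply/(nrm0_ae _ (a *: T (L2Type sf) + T (L2Type sg))).
  by apply: eq_ip_nrm => w; rewrite (op_lin adj) ipDl ipZl.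
- exists K => f /L2P sf; rewrite (L2liftE _ sf) L2norm_nrm.
  by rewrite (L2norm_nrm (L2Type sf)) -EFinM lee_fin.
Qed.

End representatives.

Section schatten_representatives.
Context {R : realType} (n : nat).
Local Notation leb := (rV_lebesgue (R := R) n).
Local Notation V := (L2type leb).
Local Notation ip := (L2ip leb).
Local Notation fn := ('rV[R]_n -> R[i]).
Variables (T S : V -> V) (K : R).
Hypothesis adj : forall f g, ip (T f) g = ip f (S g).
Hypothesis TK : forall f, nrm ip (T f) <= K * nrm ip f.

Lemma adjoint_L2lift : is_adjoint (L2lift T) (L2lift S).
Proof.
split; first exact: bounded_L2lift (adj_sym adj) (adj_bound adj TK).
move=> f g /L2P sf /L2P sg; rewrite !L2liftE.
exact: (adj (L2Type sf) (L2Type sg)).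
Qed.

Lemma compact_L2lift : sequentially_compact ip T -> compact_operator (L2lift T).
Proof.
move=> cT; split; first exact: bounded_L2lift adj TK.
move=> u uL2 [M uM].
have su k : sqint leb (u k) by exact/L2P.
have uM' k : nrm ip (L2Type (su k)) <= M.
  by rewrite -lee_fin -L2norm_nrm; exact: uM.
have [phi phi_incr [g gP]] := cT (fun k => L2Type (su k)) M uM'.
exists phi => //; exists g; first exact/L2P/L2sq.
have -> : (fun k => L2norm (fun t => L2lift T (u (phi k)) t - g t)) =
    fun k => (nrm ip (T (L2Type (su (phi k))) - g))%:E.
  by apply/funext => k; rewrite -L2norm_nrm (L2liftE _ (su (phi k))).
apply: cvg_EFin; first exact: nearW.
apply: (@squeeze_cvgr _ _ _ _ (fun=> 0) (fun j => 2 * half_pow j)).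
- by apply: nearW => j; rewrite nrm_ge0 gP.
- exact: cvg_cst.
- rewrite -[X in _ --> X](mulr0 2); apply: cvgM; first exact: cvg_cst.
  by apply: cvg_expr; rewrite ger0_norm; lra.
Qed.

Lemma schatten_L2lift (p M : R) : 0 < p -> schatten_bound ip T p M ->
  schatten p%:E (L2lift T).
Proof.
move=> p0 SP.
have cT : sequentially_compact ip T.
  apply: (finite_codim_compact (@L2_complete _ _ _ leb) adj TK).
  exact: (schatten_finite_codim adj TK p0 SP).
split; first exact: compact_L2lift.
have [s [e [s0 sn eo eu [ee sb]]]] := singular_system adj TK cT.
exists s; last first.
  apply: (@le_lt_trans _ _ M%:E); last exact: ltry.
  apply: lime_le.
    apply: is_cvg_nneseries => k _ _; exact: powR_ge0.
  apply: nearW => N; rewrite sumEFin lee_fin big_mkord.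
  exact: (singular_sum adj s0 sn eo eu ee p0 SP).
split => //; exists (L2lift S); first exact: adjoint_L2lift.
move=> r r0.
have [k [b [cb be bo bspan]]] := eigenspace_basis adj s0 sn eo eu ee sb p0 SP r0.
exists k => //; exists (fun i => L2fun (b i)); split.
- move=> i; split; first exact/L2P/L2sq.
  rewrite /= !L2lift_val.
  by have /(nrm0_ae (S (T (b i))) ((r ^+ 2)%:C%C *: b i)) := be i.
- move=> c c0 i.
  have : nrm ip (\sum_j c j *: b j) = 0.
    apply/L2nrm_eq0; apply: filterS c0 => x /= h _; rewrite -[RHS](h I).
    by rewrite L2_sumE.
  move/(nrm_ip0l (b i)); rewrite ip_suml.
  under eq_bigr do rewrite ipZl bo.
  rewrite (bigD1 i)//= eqxx mulr1 big1 ?addr0// => j ji.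
  by rewrite (negbTE ji) mulr0.
- move=> v [/L2P sv ev].
  have [|c cv] := bspan (L2Type sv).
    apply/nrm0_ae; apply: filterS ev => x /= h _; rewrite -[RHS](h I).
    by rewrite (L2liftE _ sv) L2lift_val.
  exists c; move/nrm0_ae : cv; apply: filterS => x /= h _; rewrite (h I).
  by rewrite L2_sumE.
Qed.

End schatten_representatives.

Section reduction.
Context {R : realType} (n : nat).
Local Notation leb := (rV_lebesgue (R := R) n).
Local Notation V := (L2type leb).
Local Notation ip := (L2ip leb).
Local Notation phase := ('rV[R]_n * 'rV[R]_n)%type.

(** One operator must serve all exponents, hence the predicate [P]: the operator is built once, and
    each p only contributes its estimate. *)
Lemma weyl_schatten (mu : complex_measure phase R) (lam : R) (P : R -> Prop) :
  (forall B, measurable B -> B `<=` ~` phase_box lam -> cm_Re mu B = 0%E /\ cm_Im mu B = 0%E) ->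
  (forall p, P p -> 0 < p /\ exists M, forall N (e f : nat -> V), orth ip N e -> orth ip N f ->
    \sum_(k < N) nc (weyl_form mu (e k) (f k)) `^ p <= M) ->
  exists L, is_weyl_operator mu L /\ forall p, P p -> schatten p%:E L.
Proof.
move=> muK SP.
have [M M0 Mw] := weyl_form_bound muK.
have [T [S [TE adj TK]]] := weyl_operator_exists M0 Mw.
exists (L2lift T); split.
  split; first exact: bounded_L2lift adj TK.
  move=> f g /L2P sf /L2P sg; rewrite (L2liftE _ sf).
  exact: (TE (L2Type sf) (L2Type sg)).
move=> p /SP[p0 [Mp MpP]]; apply: (schatten_L2lift adj TK p0 (M := Mp)).
by move=> N e f oe ff; under eq_bigr do rewrite TE; exact: MpP.
Qed.

End reduction.

(** * Sums over lattices *)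

Section finite_jensen.
Variable R : realType.

(** Young's inequality a t^(p-1) <= a^p / p + t^p / q is summed against the weights, with t the
    weighted mean X / S. *)
Lemma jensen_powR (I : finType) (w a : I -> R) (p B : R) : 1 <= p ->
  (forall i, 0 <= w i) -> (forall i, 0 <= a i) -> \sum_i w i <= B ->
  (\sum_i w i * a i) `^ p <= B `^ (p - 1) * \sum_i w i * a i `^ p.
Proof.
move=> p1 w0 a0 wB.
have p0 : 0 < p by exact: lt_le_trans p1.
set S := \sum_i w i in wB *; set X := \sum_i w i * a i; set Y := \sum_i _ * _ `^ _.
have S0 : 0 <= S by exact: sumr_ge0.
have X0 : 0 <= X by apply: sumr_ge0 => i _; exact: mulr_ge0.
have Y0 : 0 <= Y by apply: sumr_ge0 => i _; rewrite mulr_ge0// powR_ge0.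
have [S00|S00] := eqVneq S 0.
  have X00 : X = 0.
    apply: big1 => i _; suff -> : w i = 0 by rewrite mul0r.
    have /eqP := S00; rewrite psumr_eq0// => /allP/(_ i).
    by rewrite mem_index_enum => /(_ isT)/eqP.
  by rewrite X00 powR0 ?gt_eqF// mulr_ge0// powR_ge0.
have Sp : 0 < S by rewrite lt_neqAle eq_sym S00.
suff H : X `^ p <= S `^ (p - 1) * Y.
  apply: le_trans H _; rewrite ler_wpM2r// ge0_ler_powR ?nnegrE ?subr_ge0//.
  exact: le_trans wB.
have [pe|pn1] := eqVneq p 1.
  rewrite pe subrr powRr0 mul1r powRr1// /X /Y pe; apply: ler_sum => i _.
  by rewrite powRr1.
have p1' : 0 < p - 1 by rewrite subr_gt0 lt_neqAle eq_sym pn1.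
pose t := X / S.
have t0 : 0 <= t by rewrite divr_ge0.
pose q := p / (p - 1).
have q0 : 0 < q by rewrite divr_gt0.
have pq : p^-1 + q^-1 = 1 by rewrite /q; field; rewrite !gt_eqF.
have young i : a i * t `^ (p - 1) <= a i `^ p / p + t `^ p / q.
  have := conjugate_powR (a0 i) (powR_ge0 t (p - 1)) p0 q0 pq.
  by rewrite -powRrM /q mulrCA divff ?mulr1 ?gt_eqF.
have h1 : X * t `^ (p - 1) <= Y / p + S * (t `^ p / q).
  rewrite /X /Y /S !mulr_suml -big_split /=; apply: ler_sum => i _.
  by rewrite -!mulrA -mulrDr; apply: ler_wpM2l => //; exact: young.
have tp : t `^ p = t * t `^ (p - 1).
  have [->|tn0] := eqVneq t 0; first by rewrite powR0 ?gt_eqF// mul0r.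
  by rewrite -[X in X * _](powRr1 t0) -powRD ?tn0 ?implybT// addrC subrK.
have XS : X = S * t by rewrite /t mulrCA divff ?mulr1.
have h2 : S * t `^ p <= Y.
  have h3 : S * t `^ p <= Y / p + S * t `^ p / q.
    by rewrite -[X in _ <= _ + X]mulrA {1}tp mulrA -XS.
  have qE : q^-1 = 1 - p^-1 by rewrite -pq addrC addKr.
  have h4 : S * t `^ p / p <= Y / p by move: h3; rewrite qE mulrBr mulr1; lra.
  by move: h4; rewrite ler_pM2r// invr_gt0.
rewrite {1}XS powRM// (_ : S `^ p = S `^ (p - 1) * S); last first.
  by rewrite -[X in _ * X](powRr1 S0) -powRD ?S00 ?implybT// subrK.
by rewrite -mulrA ler_wpM2l// powR_ge0.
Qed.

(** In the application k runs over the orthonormal families, i over lattice points and j over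
    characters; al and be are moduli of inner products, a those of the Fourier transform. For fixed
    k the weights c al be have mass at most A B by Bessel in i, which allows Jensen; for fixed i and
    j, Bessel in k then removes the weights and leaves the p-sums of a. *)
Lemma discrete_schatten (I J K : finType) (c : J -> R) (a : J -> I -> R)
    (al : I -> K -> R) (be : J -> I -> K -> R) (A B D p : R) :
  1 <= p -> 0 <= B -> 0 <= D ->
  (forall j, 0 <= c j) -> (forall j i, 0 <= a j i) ->
  (forall i k, 0 <= al i k) -> (forall j i k, 0 <= be j i k) ->
  \sum_j c j <= A ->
  (forall k, \sum_i al i k ^+ 2 <= B) -> (forall i, \sum_k al i k ^+ 2 <= B) ->
  (forall j k, \sum_i be j i k ^+ 2 <= B) ->
  (forall j i, \sum_k be j i k ^+ 2 <= B) ->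
  (forall j, \sum_i a j i `^ p <= D) ->
  \sum_k (\sum_j \sum_i c j * (al i k * be j i k) * a j i) `^ p <=
    (A * B) `^ (p - 1) * (A * (B * D)).
Proof.
move=> p1 B0 D0 c0 a0 al0 be0 cA al1 al2 be1 be2 aD.
have prodB (x y : R) : x * y <= (x ^+ 2 + y ^+ 2) / 2.
  have := sqr_ge0 (x - y); lra.
have sumB (T : finType) (x y : T -> R) :
    \sum_t x t ^+ 2 <= B -> \sum_t y t ^+ 2 <= B -> \sum_t x t * y t <= B.
  move=> xB yB; apply: (@le_trans _ _ ((\sum_t x t ^+ 2 + \sum_t y t ^+ 2) / 2)); last lra.
  by rewrite -big_split /= mulr_suml; apply: ler_sum => t _; exact: prodB.
have wB k : \sum_(ji : J * I) c ji.1 * (al ji.2 k * be ji.1 ji.2 k) <= A * B.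
  rewrite -(pair_bigA _ (fun j i => c j * (al i k * be j i k))) /=.
  apply: (@le_trans _ _ (\sum_j c j * B)); last by rewrite -mulr_suml ler_wpM2r.
  by apply: ler_sum => j _; rewrite -mulr_sumr ler_wpM2l// sumB.
have step k : (\sum_j \sum_i c j * (al i k * be j i k) * a j i) `^ p <=
    (A * B) `^ (p - 1) * \sum_j \sum_i c j * (al i k * be j i k) * a j i `^ p.
  rewrite !pair_bigA /=.
  apply: (jensen_powR (w := fun ji => c ji.1 * (al ji.2 k * be ji.1 ji.2 k))
    (a := fun ji => a ji.1 ji.2)) => //.
  by move=> ji; rewrite !mulr_ge0.
apply: (@le_trans _ _ (\sum_k (A * B) `^ (p - 1) *
    \sum_j \sum_i c j * (al i k * be j i k) * a j i `^ p)).
  by apply: ler_sum => k _; exact: step.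
rewrite -mulr_sumr ler_wpM2l ?powR_ge0//.
rewrite exchange_big /=.
apply: (@le_trans _ _ (\sum_j c j * (B * D))); last first.
  by rewrite -mulr_suml ler_wpM2r// mulr_ge0.
apply: ler_sum => j _; rewrite exchange_big /=.
apply: (@le_trans _ _ (c j * (B * \sum_i a j i `^ p))); last first.
  by rewrite !ler_wpM2l.
rewrite !mulr_sumr; apply: ler_sum => i _; rewrite -mulr_suml -mulr_sumr mulrA.
by rewrite ler_wpM2r ?powR_ge0// ler_wpM2l// sumB.
Qed.

End finite_jensen.

Section lattice_sums.
Variable R : realType.

(** With t = q - 1, each term is at most the increment of - m^(-t) / t, so that the sum telescopes;
    the inequality comes from ln (1 - y) <= - y at y = 1 / (m + 2). *)
Lemma zeta_partial_sum (q : R) : 1 < q -> exists2 B : R, 0 <= B &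
  forall M, \sum_(m < M) m.+1%:R `^ (- q) <= B.
Proof.
move=> q1; pose t := q - 1; have t0 : 0 < t by rewrite subr_gt0.
have step m : (m.+2%:R : R) `^ (- q) <= t^-1 * (m.+1%:R `^ (- t) - m.+2%:R `^ (- t)).
  have m1 : (0 : R) < m.+1%:R by rewrite ltr0n.
  have m2 : (0 : R) < m.+2%:R by rewrite ltr0n.
  set x := m.+1%:R / m.+2%:R : R.
  have x0 : 0 < x by rewrite divr_gt0.
  have xE : x = 1 - m.+2%:R^-1.
    rewrite /x (_ : m.+1%:R = m.+2%:R - 1); last by rewrite -[m.+2]addn1 natrD addrK.
    by rewrite mulrBl divff ?mul1r// gt_eqF.
  have h : 1 + t / m.+2%:R <= x `^ (- t).
    rewrite /powR gt_eqF//.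
    apply: le_trans (expR_ge1Dx _) _; rewrite ler_expR.
    have : ln x <= - m.+2%:R^-1.
      by rewrite xE; apply: le_ln1Dx; rewrite ltrN2 invf_lt1// ltr1n.
    move=> /(ler_wpM2l (ltW t0)); rewrite mulrN lerNr => le_ln.
    by rewrite mulNr.
  have m1E : (m.+1%:R : R) `^ (- t) = x `^ (- t) * m.+2%:R `^ (- t).
    by rewrite -powRM ?ltW// /x divfK// gt_eqF.
  have qE : (m.+2%:R : R) `^ (- q) = m.+2%:R `^ (- t) / m.+2%:R.
    rewrite -(powR_inv1 (ltW m2)) -powRD; last by rewrite (gt_eqF m2) implybT.
    by congr (_ `^ _); rewrite /t; ring.
  rewrite m1E qE ler_pdivlMl//.
  have y0 := powR_ge0 (m.+2%:R : R) (- t).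
  by have := ler_wpM2r y0 h; rewrite mulrDl mul1r -lerBrDl mulrA mulrAC.
exists (1 + t^-1) => [|M]; first by rewrite addr_ge0// invr_ge0 ltW.
suff H : \sum_(m < M.+1) (m.+1%:R : R) `^ (- q) <= 1 + t^-1 * (1 - M.+1%:R `^ (- t)).
  apply: (@le_trans _ _ (\sum_(m < M.+1) (m.+1%:R : R) `^ (- q))).
    by rewrite [leRHS]big_ord_recr/= lerDl powR_ge0.
  apply: le_trans H _; rewrite lerD2l; apply: ler_piMr; first by rewrite invr_ge0 ltW.
  by rewrite gerBl powR_ge0.
elim: M => [|M IH].
  by rewrite big_ord_recl big_ord0 !powR1 subrr mulr0.
rewrite big_ord_recr/=; have := step M; lra.
Qed.

(** On each side of i0 the map i -> |i - i0| is injective, whence the factor 2. *)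
Lemma uniq_int_sum (f : nat -> R) (B : R) (s : seq int) (i0 : int) :
  (forall m, 0 <= f m) -> (forall M, \sum_(m < M) f m <= B) -> uniq s ->
  \sum_(i <- s) f `|i - i0|%N <= 2 * B.
Proof.
move=> f0 fB us.
have part (P : pred int) : {in P &, injective (fun i : int => `|i - i0|%N)} ->
    \sum_(i <- s | P i) f `|i - i0|%N <= B.
  move=> inj; rewrite -big_filter -(big_map (fun i : int => `|i - i0|%N) xpredT f).
  set s' := map _ _.
  have us' : uniq s'.
    rewrite map_inj_in_uniq ?filter_uniq// => i j.
    by rewrite !mem_filter => /andP[Pi _] /andP[Pj _]; exact: inj.
  pose M := (\max_(m <- s') m).+1.
  apply: le_trans (fB M).
  rewrite -(big_mkord xpredT f) -/M.
  have sub : {subset s' <= index_iota 0 M}.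
    by move=> m ms; rewrite mem_index_iota /= ltnS; apply: leq_bigmax_seq.
  rewrite [leRHS](bigID (mem s')) /=; apply: ler_wpDr; first exact: sumr_ge0.
  rewrite -[leRHS]big_filter le_eqVlt; apply/orP; left; apply/eqP/perm_big.
  apply: uniq_perm; rewrite ?filter_uniq ?iota_uniq// => m.
  rewrite mem_filter inE; case: (boolP (m \in s')) => //= ms; exact/esym/sub.
rewrite (bigID (fun i => i0 <= i)) /= mulr_natl mulr2n.
apply: lerD; apply: part => i j h1 h2 h3.
  have {}h1 : i0 <= i := h1; have {}h2 : i0 <= j := h2; lia.
have {}h1 : ~~ (i0 <= i) := h1; have {}h2 : ~~ (i0 <= j) := h2; lia.
Qed.

(** The bound must not depend on the shift x, which will come from the frequencies of an arbitrary
    character; recentring at the integer part of - x / kap removes it. *)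
Lemma lattice_sum1 (kap q : R) : 0 < kap -> kap <= 1 -> 1 < q ->
  exists2 B : R, 0 <= B & forall (s : seq int) (x : R), uniq s ->
  \sum_(i <- s) (1 + `|kap * i%:~R + x|) `^ (- q) <= B.
Proof.
move=> k0 k1 q1; have [B B0 BP] := zeta_partial_sum q1.
have q0 : 0 < q by exact: lt_trans q1.
exists ((kap / 2) `^ (- q) * (2 * B)) => [|s x us].
  by rewrite mulr_ge0 ?powR_ge0// mulr_ge0.
pose i0 := Num.floor (- x / kap).
(* As |kap (i - i0)| <= |kap i + x| + kap and kap <= 1, halving kap absorbs the additive
   constants. *)
have key (i : int) : (kap / 2) * (`|i - i0|%N.+1)%:R <= 1 + `|kap * i%:~R + x|.
  have /andP[f1 f2] : i0%:~R <= - x / kap < (i0 + 1)%:~R by exact: floor_itv.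
  rewrite ler_pdivlMr// in f1; rewrite ltr_pdivrMr// in f2.
  have h : (`|i - i0|%N%:R : R) = `|i%:~R - i0%:~R|.
    by rewrite natr_absz intr_norm rmorphB.
  rewrite -[X in _ * X <= _]natr1 h.
  rewrite intrD mulrDl mul1r in f2.
  have h3 : `|kap * (i%:~R - i0%:~R)| <= `|kap * i%:~R + x| + kap.
    have -> : kap * (i%:~R - i0%:~R) = (kap * i%:~R + x) - (x + kap * i0%:~R) by ring.
    rewrite (le_trans (ler_normB _ _))// lerD2l ler_norml; apply/andP; split; lra.
  rewrite normrM gtr0_norm// in h3.
  have h4 := normr_ge0 (kap * i%:~R + x).
  lra.
apply: (@le_trans _ _ (\sum_(i <- s) (kap / 2) `^ (- q) * (`|i - i0|%N.+1)%:R `^ (- q))).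
  have k2 : 0 < kap / 2 by rewrite divr_gt0.
  apply: ler_sum => i _; rewrite -powRM ?ler0n ?(ltW k2)// !powRN.
  have c0 : 0 < 1 + `|kap * i%:~R + x| by rewrite ltr_pwDl.
  have d0 : 0 < kap / 2 * (`|i - i0|%N.+1)%:R by rewrite mulr_gt0 ?ltr0n.
  rewrite lef_pV2 ?posrE ?powR_gt0//.
  by apply: ge0_ler_powR; rewrite ?nnegrE ?(ltW c0) ?(ltW d0) ?(ltW q0)//; exact: key.
rewrite -mulr_sumr ler_wpM2l ?powR_ge0//.
by apply: (uniq_int_sum (f := fun m => m.+1%:R `^ (- q))) => // m; exact: powR_ge0.
Qed.

(** The set s need not be a product: it is embedded in the finite cube U^d, where U collects all
    entries of its vectors, and the sum over the cube factors by distributivity. *)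
Lemma lattice_sum_prod d (s : seq 'rV[int]_d) (f : 'I_d -> int -> R) (B : R) :
  uniq s -> (forall l i, 0 <= f l i) ->
  (forall l t, uniq t -> \sum_(i <- t) f l i <= B) ->
  \sum_(v <- s) \prod_l f l (v ord0 l) <= B ^+ d.
Proof.
move=> us f0 fB.
(* The entry 0 keeps U nonempty, so that [insubd] has a default index. *)
pose U := undup (0 :: flatten [seq [seq (v : 'rV[int]_d) ord0 l | l <- enum 'I_d] | v <- s]).
have memU v l : v \in s -> v ord0 l \in U.
  move=> vs; rewrite mem_undup inE; apply/orP; right; apply/flattenP.
  exists [seq v ord0 l | l <- enum 'I_d]; first by apply/mapP; exists v.
  by apply/mapP; exists l; rewrite ?mem_enum.
have U0 : (0 < size U)%N.
  by rewrite -has_predT; apply/hasP; exists 0; rewrite ?mem_undup ?mem_head.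
pose F l (k : 'I_(size U)) := f l (nth 0 U k).
apply: (@le_trans _ _ (\prod_(l < d) \sum_(k < size U) F l k)).
  rewrite bigA_distr_bigA /=.
  pose phi (v : 'rV[int]_d) : {ffun 'I_d -> 'I_(size U)} :=
    [ffun l => insubd (Ordinal U0) (index (v ord0 l) U)].
  have phiE v l : v \in s -> nth 0 U (phi v l) = v ord0 l.
    move=> vs; by rewrite ffunE val_insubd index_mem memU// nth_index// memU.
  have phi_inj : {in s &, injective phi}.
    by move=> v w vs ws e; apply/rowP => l; rewrite -(phiE v)// e phiE.
  have -> : \sum_(v <- s) \prod_l f l (v ord0 l) =
      \sum_(h <- map phi s) \prod_l F l (h l).
    rewrite big_map; apply: eq_big_seq => v vs.
    by apply: eq_bigr => l _; rewrite /F phiE.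
  rewrite big_uniq ?map_inj_in_uniq//=.
  rewrite [leRHS](bigID (mem (map phi s))) /= lerDl.
  by apply: sumr_ge0 => h _; apply: prodr_ge0 => l _; exact: f0.
rewrite -[d in leRHS]card_ord -prodr_const; apply: ler_prod => l _.
apply/andP; split; first by apply: sumr_ge0 => k _; exact: f0.
have := fB l U (undup_uniq _).
by rewrite (big_nth 0) big_mkord.
Qed.

End lattice_sums.

(** * Uniform limits of sums of characters *)

Section arcsine.
Variable R : realType.
Implicit Types (x th : R).

Lemma mvt0 (f f' : R -> R) x : (forall y : R, is_derive y 1 f (f' y)) ->
  exists c, [/\ `|c| <= `|x|, (0 <= x -> 0 <= c) & f x - f 0 = f' c * x].
Proof.
move=> df.
have cf : continuous f.
  by move=> y; apply/differentiable_continuous/derivable1_diffP; exact: ex_derive.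
have cw a b : {within `[a, b], continuous f} by exact: continuous_subspaceT.
have [x0|x0] := leP 0 x.
  have [c /=] := MVT_segment x0 (fun y _ => df y) (cw _ _).
  rewrite in_itv /= subr0 => /andP[c0 cx] fE.
  by exists c; split => //; rewrite !ger0_norm.
have [c /=] := MVT_segment (ltW x0) (fun y _ => df y) (cw _ _).
rewrite in_itv /= sub0r => /andP[xc c0] fE.
exists c; split; first by rewrite !ler0_norm ?lerN2// ltW.
  by move=> x1; lra.
by rewrite -opprB fE mulrN opprK.
Qed.

Lemma normr_sin_le x : `|sin x| <= `|x|.
Proof.
have [c [_ _]] := mvt0 x (fun y => is_derive_sin y).
rewrite sin0 subr0 => ->; rewrite normrM ler_piMl// ler_norml.
by rewrite cos_geN1 cos_le1.
Qed.

Lemma cos_ge_quadratic x : 1 - x ^+ 2 / 2 <= cos x.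
Proof.
have -> : cos x = 1 - 2 * sin (x / 2) ^+ 2.
  have {1}-> : x = x / 2 + x / 2 by field.
  rewrite cosD; have := cos2Dsin2 (x / 2); rewrite -!expr2; lra.
have : sin (x / 2) ^+ 2 <= (x / 2) ^+ 2.
  rewrite -(real_normK (num_real (sin _))) -(real_normK (num_real (x / 2))).
  by rewrite ler_pXn2r ?nnegrE//; exact: normr_sin_le.
lra.
Qed.

Lemma sin_approx x : `|sin x - x| <= `|x| * x ^+ 2.
Proof.
have [c [cx _]] : exists c, [/\ `|c| <= `|x|, (0 <= x -> 0 <= c) &
    (sin x - x) - (sin 0 - 0) = (cos c - 1) * x].
  by apply: (mvt0 (f := fun y => sin y - y) (f' := fun y => cos y - 1)).
rewrite sin0 !subr0 => ->; rewrite normrM mulrC ler_wpM2l//.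
have h := cos_ge_quadratic c; have h1 := cos_le1 c.
have h2 : c ^+ 2 <= x ^+ 2.
  by rewrite -(real_normK (num_real c)) -(real_normK (num_real x)) ler_pXn2r ?nnegrE.
have h3 := sqr_ge0 c.
rewrite ler_norml; apply/andP; split; lra.
Qed.

Lemma expi_approx x : `|x| <= 1 -> nc (expi x - (1 + 'i%C * x%:C%C)) <= 2 * x ^+ 2.
Proof.
move=> x1; apply: le_trans (nc_le_ReIm _) _.
rewrite cReB cImB cReD cImD cReM cImM /=.
rewrite !(mul0r, mul1r, subr0, mulr0, addr0, add0r).
have h1 := cos_ge_quadratic x; have h2 := cos_le1 x; have h3 := sin_approx x.
have h4 := sqr_ge0 x.
have h5 : `|x| * x ^+ 2 <= x ^+ 2 by rewrite ler_piMl.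
have h6 : `|cos x - 1| <= x ^+ 2 by rewrite ler_norml; apply/andP; split; lra.
lra.
Qed.

(** The numbers C(2n, n) / 4^n, that is the Taylor coefficients of 1 / sqrt (1 - x^2) in powers of
    x^2. *)
Fixpoint asin_b (n : nat) : R :=
  if n is k.+1 then asin_b k * (2 * k + 1)%:R / (2 * k.+1)%:R else 1.

Lemma asin_b_ge0 n : 0 <= asin_b n.
Proof. by elim: n => //= n IH; rewrite divr_ge0// mulr_ge0. Qed.

Lemma asin_b_le1 n : asin_b n <= 1.
Proof.
elim: n => //= n IH; rewrite ler_pdivrMr ?ltr0n// mul1r.
apply: le_trans (_ : (2 * n + 1)%:R <= _); last by rewrite ler_nat; lia.
by rewrite ler_piMl.
Qed.

(* The partial sums of the Taylor series of asin, and the derivative of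
   [asin_poly N (sin th)]. Differentiating once more telescopes
   (is_derive_asin_dpoly), and all coefficients are nonnegative. *)
Definition asin_poly N x : R := \sum_(n < N) asin_b n / (2 * n + 1)%:R * x ^+ (2 * n + 1).
Definition asin_dpoly N th : R := \sum_(n < N) asin_b n * sin th ^+ (2 * n) * cos th.

Lemma is_derive_mul (f g : R -> R) (x a b : R) :
  is_derive x 1 f a -> is_derive x 1 g b ->
  is_derive x 1 (fun y => f y * g y) (a * g x + f x * b).
Proof.
move=> df dg; have h := is_deriveM df dg.
by apply: (is_derive_eq h); rewrite /GRing.scale /= addrC (mulrC (g x)).
Qed.

Lemma is_derive_scale (c : R) (f : R -> R) (x a : R) :
  is_derive x 1 f a -> is_derive x 1 (fun y => c * f y) (c * a).
Proof.
move=> df; have h := is_derive_mul (is_derive_cst c x 1) df.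
by apply: (is_derive_eq h); rewrite mul0r add0r.
Qed.

Lemma is_derive_sinX m (x : R) :
  is_derive x 1 (fun y => sin y ^+ m) (m%:R * sin x ^+ m.-1 * cos x).
Proof.
elim: m => [|m IH].
  under eq_fun do rewrite expr0.
  by rewrite !mul0r; exact: is_derive_cst.
under eq_fun do rewrite exprS.
apply: (is_derive_eq (is_derive_mul (is_derive_sin x) IH)).
rewrite /= -natr1 !mulrDl mul1r addrC; congr (_ + _); last by rewrite mulrC.
by case: m {IH} => [|m] /=; rewrite ?mul0r ?mulr0// exprS; ring.
Qed.

Lemma is_derive_asin_poly N th :
  is_derive th 1 (fun y => asin_poly N (sin y)) (asin_dpoly N th).
Proof.
rewrite /asin_poly /asin_dpoly; elim: N => [|N IH].
  under eq_fun do rewrite big_ord0.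
  by rewrite big_ord0; exact: is_derive_cst.
under eq_fun do rewrite big_ord_recr/=.
rewrite big_ord_recr/=; apply: is_deriveD.
apply: (is_derive_eq (is_derive_scale _ (is_derive_sinX _ _))).
rewrite addn1 /=; have : (2 * N).+1%:R != 0 :> R by rewrite pnatr_eq0.
by move=> n0; field.
Qed.

Lemma is_derive_asin_dpoly N th : is_derive th 1 (asin_dpoly N.+1)
  (- ((2 * N + 1)%:R * asin_b N * sin th ^+ (2 * N + 1))).
Proof.
elim: N => [|N IH].
  rewrite /asin_dpoly; under eq_fun do rewrite big_ord_recr big_ord0 /= expr0 mulr1 mul1r add0r.
  by apply: (is_derive_eq (is_derive_cos th)); rewrite muln0 add0n expr1 mulr1 mul1r.
rewrite /asin_dpoly; under eq_fun do rewrite big_ord_recr/=.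
have h := is_derive_mul (is_derive_scale (asin_b N.+1) (is_derive_sinX (2 * N.+1) th)) (is_derive_cos th).
apply: (is_derive_eq (is_deriveD IH h)).
rewrite (_ : (2 * N.+1).-1 = (2 * N + 1)%N); last lia.
rewrite (_ : (2 * N.+1)%N = (2 * N + 2)%N); last lia.
set X := sin th ^+ (2 * N + 1).
have -> : sin th ^+ (2 * N + 2) = X * sin th by rewrite /X -exprSr; congr (_ ^+ _); lia.
have -> : sin th ^+ (2 * N + 2 + 1) = X * sin th ^+ 2 by rewrite /X -exprD; congr (_ ^+ _); lia.
(* By this recursion the derivative of the new term cancels the one given by IH, and a single term
   remains. *)
have bE : asin_b N * (2 * N + 1)%:R = asin_b N.+1 * (2 * N + 2)%:R.
  rewrite /= (_ : (2 * N.+1)%N = (2 * N + 2)%N); last lia.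
  by rewrite divfK// pnatr_eq0 addn2.
have c2 : cos th * cos th = 1 - sin th ^+ 2.
  by have := cos2Dsin2 th; rewrite -!expr2; lra.
rewrite [X in - (X * _) + _]mulrC bE [in RHS]natrD.
apply/eqP; rewrite -subr_eq0; apply/eqP.
transitivity (asin_b N.+1 * (2 * N + 2)%:R * X * (cos th * cos th - (1 - sin th ^+ 2))); last first.
  by rewrite c2 subrr mulr0.
ring.
Qed.

Lemma asin_dpoly0 N : asin_dpoly N.+1 0 = 1.
Proof.
rewrite /asin_dpoly big_ord_recl /= muln0 expr0 cos0 !mulr1 big1 ?addr0// => i _.
by rewrite sin0 expr0n /= mulr0 mul0r.
Qed.

Lemma asin_poly0 N : asin_poly N (sin 0) = 0.
Proof.
rewrite /asin_poly big1// => i _.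
by rewrite sin0 expr0n addn1 mulr0.
Qed.

Lemma asin_dpoly_le1 N th : 0 <= th <= pi / 2 -> asin_dpoly N.+1 th <= 1.
Proof.
move=> /andP[th0 thpi].
have [c [cth c0 fE]] := mvt0 th (is_derive_asin_dpoly N).
rewrite asin_dpoly0 in fE; rewrite -subr_le0 fE mulNr oppr_le0.
have c0' := c0 th0.
have sc : 0 <= sin c.
  apply: sin_ge0_pi; rewrite c0' /=.
  rewrite ger0_norm// ger0_norm// in cth.
  by rewrite (le_trans cth)// (le_trans thpi)// ler_pdivrMr// ler_peMr ?pi_ge0//; lra.
by rewrite !mulr_ge0 ?asin_b_ge0 ?exprn_ge0.
Qed.

(** The sum is the value of the polynomial at sin (pi / 2) = 1. Its derivative in th is at most 1 on
    [0, pi / 2], so this value is at most pi / 2 < 2. *)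
Lemma asin_coef_sum N : \sum_(n < N) asin_b n / (2 * n + 1)%:R <= 2.
Proof.
have -> : \sum_(n < N) asin_b n / (2 * n + 1)%:R = asin_poly N (sin (pi / 2)).
  by apply: eq_bigr => n _; rewrite sin_pihalf expr1n mulr1.
case: N => [|N]; first by rewrite /asin_poly big_ord0.
have pi0 : 0 <= pi / 2 :> R by rewrite divr_ge0// pi_ge0.
have [c [cth c0 fE]] := mvt0 (pi / 2) (is_derive_asin_poly N.+1).
rewrite asin_poly0 subr0 in fE; rewrite fE.
have c0' := c0 pi0; rewrite !ger0_norm// in cth.
have h1 : asin_dpoly N.+1 c <= 1 by apply: asin_dpoly_le1; rewrite c0'.
have h2 : pi / 2 < 2 :> R by exact: pihalf_lt2.
by apply: (@le_trans _ _ (pi / 2)); [rewrite ler_piMl|exact: ltW].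
Qed.

(** For |th| <= 1 one has cos th >= 1/2, so sin th has square at most r = 3/4; the telescoped second
    derivative then bounds the derivative of the error by (2 N + 1) r^N. *)
Lemma asin_poly_approx (eps : R) : 0 < eps -> exists N, forall th, `|th| <= 1 ->
  `|asin_poly N (sin th) - th| <= eps.
Proof.
move=> e0.
pose r : R := 3 / 4.
have dbound N th : `|th| <= 1 -> `|asin_dpoly N.+1 th - 1| <= (2 * N + 1)%:R * r ^+ N.
  move=> th1; have [c [cth _ fE]] := mvt0 th (is_derive_asin_dpoly N).
  rewrite asin_dpoly0 in fE; rewrite fE normrM normrN !normrM normr_nat.
  have b1 : `|asin_b N| <= 1 by rewrite ger0_norm ?asin_b_ge0 ?asin_b_le1.
  have c1 : `|c| <= 1 by exact: le_trans cth _.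
  have s34 : sin c ^+ 2 <= r.
    have h := cos_ge_quadratic c.
    have c2 : c ^+ 2 <= 1 by rewrite -(real_normK (num_real c)) exprn_ile1.
    have h3 := cos2Dsin2 c.
    have h4 : 1 / 2 <= cos c by lra.
    have h5 : (1 / 2) ^+ 2 <= cos c ^+ 2 by rewrite ler_pXn2r ?nnegrE//; lra.
    rewrite /r; lra.
  have sN : `|sin c ^+ (2 * N + 1)| <= r ^+ N.
    rewrite normrX addn1 exprSr exprM real_normK ?num_real//.
    rewrite -[leRHS]mulr1; apply: ler_pM => //; first by rewrite exprn_ge0 ?sqr_ge0.
      by apply: lerXn2r; rewrite ?nnegrE ?sqr_ge0// /r; lra.
    by rewrite ler_norml sin_geN1 sin_le1.
  rewrite -[leRHS]mulr1; apply: ler_pM => //.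
  by rewrite -mulrA ler_wpM2l// -[leRHS]mul1r ler_pM.
have small : exists N, (2 * N + 1)%:R * r ^+ N <= eps.
  have h78 : `|7 / 8 : R| < 1 by rewrite ger0_norm; lra.
  have e12 : 0 < eps / 12 by rewrite divr_gt0.
  have /cvgrPdist_lt/(_ _ e12) [N _ /(_ N (leqnn N))] := cvg_expr h78.
  have p78 : (0 : R) <= 7 / 8 by lra.
  rewrite sub0r normrN ger0_norm ?exprn_ge0//.
  move=> hN; exists N.
  have bern (n : nat) : 1 + n%:R / 6 <= (7 / 6 : R) ^+ n.
    elim: n => [|n IH]; first by rewrite mul0r addr0 expr0.
    rewrite exprS -natr1.
    have n0 : (0 : R) <= n%:R by [].
    have h76 : (0 : R) <= 7 / 6 by lra.
    have := ler_wpM2l h76 IH; lra.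
  (* One geometric factor absorbs 2 N + 1 through Bernoulli's inequality, the other tends to 0. *)
  have -> : r ^+ N = (6 / 7) ^+ N * (7 / 8) ^+ N.
    by rewrite -exprMn; congr (_ ^+ _); rewrite /r; field.
  have h1 : (2 * N + 1)%:R * (6 / 7 : R) ^+ N <= 12.
    have -> : (6 / 7 : R) ^+ N = ((7 / 6) ^+ N)^-1 by rewrite -exprVn invf_div.
    have p76 : (0 : R) < 7 / 6 by lra.
    rewrite ler_pdivrMr ?exprn_gt0//.
    rewrite natrD natrM; have := bern N; have : (0 : R) <= N%:R by []; lra.
  have h2 : (0 : R) <= (7 / 8) ^+ N by rewrite exprn_ge0.
  rewrite mulrA; apply: le_trans (ler_wpM2r h2 h1) _; lra.
have [N hN] := small; exists N.+1 => th th1.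
have dG (y : R) : is_derive y 1 (fun y => asin_poly N.+1 (sin y) - y) (asin_dpoly N.+1 y - 1).
  exact: is_deriveB (is_derive_asin_poly _ _) (is_derive_id _ _).
have [c [cth _ fE]] := mvt0 th dG.
rewrite asin_poly0 !subr0 in fE; rewrite fE normrM.
apply: le_trans hN; rewrite -[leRHS]mulr1; apply: ler_pM => //.
by apply: dbound; exact: le_trans cth _.
Qed.

End arcsine.

(** * A Wiener algebra restricted to a set *)

Section wiener_class.
Context {R : realType} {X : Type}.
Variable chr : (X -> R[i]) -> Prop.
Variable B : set X.
Hypothesis chr1 : chr (fun=> 1).
Hypothesis chrM : forall g h, chr g -> chr h -> chr (fun x => g x * h x).
Hypothesis chr_le1 : forall g x, chr g -> nc (g x) <= 1.
Implicit Types (phi psi : X -> R[i]) (M N : R).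

(* Uniform limits on [B] of combinations of characters with coefficients of
   total mass at most [M]: the restriction to [B] of a ball of the Wiener
   algebra. *)
Definition wiener M phi := forall eps : R, 0 < eps ->
  exists (I : finType) (c : I -> R[i]) (g : I -> X -> R[i]),
    [/\ forall i, chr (g i), \sum_i nc (c i) <= M &
        forall x, B x -> nc (phi x - \sum_i c i * g i x) <= eps].

Lemma wiener_ge0 M phi : wiener M phi -> 0 <= M.
Proof.
move=> /(_ 1 ltr01)[I [c [g [_ cM _]]]]; apply: le_trans cM.
by apply: sumr_ge0 => i _; exact: nc_ge0.
Qed.

Lemma nc_charsum (I : finType) (c : I -> R[i]) (g : I -> X -> R[i]) x :
  (forall i, chr (g i)) -> nc (\sum_i c i * g i x) <= \sum_i nc (c i).
Proof.
move=> hg; apply: le_trans (nc_sum _ _ _) _; apply: ler_sum => i _.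
by rewrite ncM ler_piMr ?nc_ge0// chr_le1.
Qed.

Lemma wiener_bound M phi x : wiener M phi -> B x -> nc (phi x) <= M.
Proof.
move=> W Bx; apply/ler_addgt0Pr => eps e0.
have [I [c [g [hg cM gP]]]] := W eps e0.
rewrite -[phi x](subrK (\sum_i c i * g i x)) (le_trans (ncD _ _))// addrC.
apply: lerD; last exact: gP.
exact: le_trans (nc_charsum _ _ hg) cM.
Qed.

Lemma wiener_le M N phi : M <= N -> wiener M phi -> wiener N phi.
Proof.
move=> MN W eps e0; have [I [c [g [hg cM gP]]]] := W eps e0.
by exists I, c, g; split => //; exact: le_trans MN.
Qed.

Lemma wiener_lim M phi : (forall eps : R, 0 < eps -> exists2 psi, wiener M psi &
  forall x, B x -> nc (phi x - psi x) <= eps) -> wiener M phi.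
Proof.
move=> H eps e0; have e20 : 0 < eps / 2 by rewrite divr_gt0.
have [psi W pP] := H _ e20.
have [I [c [g [hg cM gP]]]] := W _ e20.
exists I, c, g; split => // x Bx.
rewrite -[phi x - _](subrKA (psi x)) (le_trans (ncD _ _))//.
by have := pP x Bx; have := gP x Bx; lra.
Qed.

Lemma wiener_ext M phi psi : (forall x, B x -> phi x = psi x) -> wiener M phi -> wiener M psi.
Proof.
move=> e W; apply: wiener_lim => eps e0; exists phi => // x Bx.
by rewrite e// subrr nc0 ltW.
Qed.

Lemma wiener_chr g : chr g -> wiener 1 g.
Proof.
move=> hg eps e0; exists unit, (fun=> 1), (fun=> g); split => //.
  by rewrite sumr_const card_unit mulr1n nc1.
by move=> x Bx; rewrite sumr_const card_unit mulr1n mul1r subrr nc0 ltW.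
Qed.

Lemma wiener_scale (a : R[i]) M phi : wiener M phi -> wiener (nc a * M) (fun x => a * phi x).
Proof.
move=> W eps e0; have d0 : 0 < eps / (nc a + 1) by rewrite divr_gt0// ltr_wpDl ?nc_ge0.
have [I [c [g [hg cM gP]]]] := W _ d0.
exists I, (fun i => a * c i), g; split => //.
  under eq_bigr do rewrite ncM.
  by rewrite -mulr_sumr ler_wpM2l ?nc_ge0.
move=> x Bx; under eq_bigr do rewrite -mulrA.
rewrite -mulr_sumr -mulrBr ncM.
have h := gP x Bx; rewrite ler_pdivlMr ?ltr_wpDl ?nc_ge0// in h.
apply: le_trans h; rewrite mulrC ler_wpM2l ?nc_ge0//.
by rewrite lerDl.
Qed.

Lemma wiener_cst (a : R[i]) : wiener (nc a) (fun=> a).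
Proof.
rewrite -[X in wiener X](mulr1 (nc a)).
by apply: wiener_ext (wiener_scale a (wiener_chr chr1)) => x _; rewrite mulr1.
Qed.

Lemma wienerD M N phi psi : wiener M phi -> wiener N psi ->
  wiener (M + N) (fun x => phi x + psi x).
Proof.
move=> W1 W2 eps e0; have d0 : 0 < eps / 2 by rewrite divr_gt0.
have [I [c [g [hg cM gP]]]] := W1 _ d0.
have [J [e [h [hh eM hP]]]] := W2 _ d0.
pose cc (k : I + J) := match k with inl i => c i | inr j => e j end.
pose gg (k : I + J) := match k with inl i => g i | inr j => h j end.
exists (I + J)%type, cc, gg; split; first by case.
  by rewrite big_sumType /= lerD.
move=> x Bx; rewrite big_sumType /= opprD addrACA (le_trans (ncD _ _))//.
by have := gP x Bx; have := hP x Bx; lra.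
Qed.

Lemma wienerM M N phi psi : wiener M phi -> wiener N psi ->
  wiener (M * N) (fun x => phi x * psi x).
Proof.
move=> W1 W2 eps e0.
have M0 := wiener_ge0 W1; have N0 := wiener_ge0 W2.
pose del := eps / (M + N + 1).
have MN1 : 0 < M + N + 1 by lra.
have d0 : 0 < del by rewrite divr_gt0.
have [I [c [g [hg cM gP]]]] := W1 _ d0.
have [J [e [h [hh eM hP]]]] := W2 _ d0.
exists (I * J)%type, (fun k => c k.1 * e k.2), (fun k x => g k.1 x * h k.2 x); split.
- by move=> [i j] /=; exact: chrM.
- rewrite -(pair_bigA _ (fun i j => nc (c i * e j))) /=.
  have -> : \sum_i \sum_j nc (c i * e j) = (\sum_i nc (c i)) * (\sum_j nc (e j)).
    rewrite mulr_suml; apply: eq_bigr => i _; rewrite mulr_sumr.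
    by apply: eq_bigr => j _; rewrite ncM.
  by apply: ler_pM => //; apply: sumr_ge0 => *; exact: nc_ge0.
- move=> x Bx.
  rewrite -(pair_bigA _ (fun i j => c i * e j * (g i x * h j x))) /=.
  have -> : \sum_i \sum_j c i * e j * (g i x * h j x) =
      (\sum_i c i * g i x) * (\sum_j e j * h j x).
    rewrite mulr_suml; apply: eq_bigr => i _; rewrite mulr_sumr.
    by apply: eq_bigr => j _; rewrite mulrACA.
  set P := \sum_i _; set Q := \sum_j _.
  have -> : phi x * psi x - P * Q = (phi x - P) * psi x + P * (psi x - Q) by ring.
  apply: le_trans (ncD _ _) _; rewrite !ncM.
  have h1 : nc (phi x - P) * nc (psi x) <= del * N.
    by apply: ler_pM; rewrite ?nc_ge0// ?gP//; exact: wiener_bound W2 Bx.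
  have h2 : nc P * nc (psi x - Q) <= M * del.
    apply: ler_pM; rewrite ?nc_ge0//; last exact: hP.
    exact: le_trans (nc_charsum _ _ hg) cM.
  have h3 : del * (M + N + 1) = eps by rewrite /del divfK// gt_eqF.
  lra.
Qed.

Lemma wienerX M phi n : wiener M phi -> wiener (M ^+ n) (fun x => phi x ^+ n).
Proof.
move=> W; elim: n => [|n IH].
  have := wiener_cst 1; rewrite nc1.
  by apply: wiener_ext.
by rewrite exprS; have := wienerM W IH; apply: wiener_ext => x _; rewrite exprS.
Qed.

Lemma wiener_sum (I : Type) (r : seq I) (m : I -> R) (phi : I -> X -> R[i]) :
  (forall i, wiener (m i) (phi i)) ->
  wiener (\sum_(i <- r) m i) (fun x => \sum_(i <- r) phi i x).
Proof.
move=> W; elim: r => [|i r IH].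
  have := wiener_cst 0; rewrite nc0 big_nil; apply: wiener_ext => x _.
  by rewrite big_nil.
rewrite big_cons; have := wienerD (W i) IH; apply: wiener_ext => x _.
by rewrite big_cons.
Qed.

(* [th = asin (sin th)], and asin has an absolutely convergent Taylor series. *)
Lemma wiener_coord (th : X -> R) : chr (fun x => expi (th x)) ->
  chr (fun x => expi (- th x)) -> (forall x, B x -> `|th x| <= 1) ->
  wiener 2 (fun x => (th x)%:C%C).
Proof.
move=> h1 h2 th1.
(* By Euler's formula sin th is a combination of two characters, each with a coefficient of modulus
   1/2. *)
have Wsin : wiener 1 (fun x => (sin (th x))%:C%C).
  have i2 : nc (- 'i%C / 2 : R[i]) = 1 / 2.
    rewrite ncM ncN Normc.normcV -[2]/((2%:R : R[i])) -(rmorph_nat (real_complex R)) nc_real normr_nat.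
    by rewrite ncE /= expr0n expr1n add0r sqrtr1.
  have := wienerD (wiener_scale (- 'i%C / 2) (wiener_chr h1))
    (wiener_scale (- (- 'i%C / 2)) (wiener_chr h2)).
  rewrite !ncN i2 (_ : 1 / 2 * 1 + 1 / 2 * 1 = 1); last by field.
  apply: wiener_ext => x _.
  transitivity (- 'i%C / 2 * (expi (th x) - expi (- th x))); first by ring.
  have -> : expi (th x) - expi (- th x) = 2 * ('i%C * (sin (th x))%:C%C).
    rewrite /expi cosN sinN.
    by apply: eq_complexP; rewrite !(cReB, cImB, cReM, cImM) /=; ring.
  transitivity (- ('i%C * 'i%C) * (sin (th x))%:C%C : R[i]).
    by field.
  by rewrite -expr2 sqr_i opprK mul1r.
apply: wiener_lim => eps e0; have [N NP] := asin_poly_approx e0.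
exists (fun x => (asin_poly N (sin (th x)))%:C%C); last first.
  move=> x Bx; rewrite -rmorphB nc_real distrC; exact/NP/th1.
have := @wiener_sum 'I_N (index_enum _) (fun n => nc (asin_b R n / (2 * n + 1)%:R)%:C%C * 1 ^+ (2 * n + 1))
  (fun n x => (asin_b R n / (2 * n + 1)%:R)%:C%C * (sin (th x))%:C%C ^+ (2 * n + 1)).
move=> /(_ _)/wiener_ext h; apply: (@wiener_le (\sum_(n < N) asin_b R n / (2 * n + 1)%:R)).
  exact: asin_coef_sum.
rewrite (_ : \sum_(n < N) _ = \sum_(n < N) (nc (asin_b R n / (2 * n + 1)%:R)%:C%C * 1 ^+ (2 * n + 1))); last first.
  apply: eq_bigr => n _; rewrite expr1n mulr1 nc_real ger0_norm//.
  by rewrite divr_ge0// asin_b_ge0.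
apply: h; last first.
  by move=> n; apply: wiener_scale; exact: wienerX.
move=> x _; rewrite /asin_poly rmorph_sum; apply: eq_bigr => n _.
by rewrite [RHS]rmorphM [X in _ = _ * X]rmorphXn.
Qed.

(* Through the limit of [(1 + i f / n) ^+ n], whose mass is at most
   [(1 + M / n) ^+ n <= expR M]. *)
Lemma wiener_expi (f : X -> R) M : wiener M (fun x => (f x)%:C%C) ->
  wiener (expR M) (fun x => expi (f x)).
Proof.
move=> W; have M0 := wiener_ge0 W.
have fM x : B x -> `|f x| <= M by move=> Bx; rewrite -nc_real; exact: wiener_bound W Bx.
have Wn n : wiener (expR M) (fun x => (1 + 'i%C * (f x / n.+1%:R)%:C%C) ^+ n.+1).
  have n0 : (0 : R) < n.+1%:R by rewrite ltr0n.
  have h : wiener (1 + M / n.+1%:R) (fun x => 1 + 'i%C * (f x / n.+1%:R)%:C%C).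
    have h1 := wiener_scale ('i%C * (n.+1%:R^-1)%:C%C) W.
    have h2 := wienerD (wiener_cst 1) h1.
    rewrite nc1 ncM nc_real in h2.
    have e1 : nc ('i%C : R[i]) = 1 by rewrite ncE /= expr0n expr1n add0r sqrtr1.
    rewrite e1 mul1r ger0_norm ?invr_ge0 ?ltW// mulrC in h2.
    apply: wiener_ext h2 => x _; congr (1 + _).
    by rewrite -mulrA -rmorphM mulrC [in RHS]mulrC; congr (_%:C%C * _); rewrite mulrC.
  apply: wiener_le (wienerX n.+1 h).
  have hM : 0 <= 1 + M / n.+1%:R by rewrite addr_ge0// divr_ge0// ltW.
  apply: (@le_trans _ _ (expR (M / n.+1%:R) ^+ n.+1)).
    by apply: lerXn2r; rewrite ?nnegrE ?expR_ge0// expR_ge1Dx.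
  by rewrite -expRM_natl -mulr_natl mulrCA divff ?mulr1// gt_eqF.
apply: wiener_lim => eps e0.
(* Each of the n + 1 factors has error 2 b^2 with |b| <= M / (n + 1), and the powers are bounded by
   exp M: the total error is at most K / (n + 1). *)
pose K := 2 * M ^+ 2 * expR M.
have K0 : 0 <= K by rewrite !mulr_ge0 ?sqr_ge0 ?expR_ge0.
(* Besides K / eps, the number n + 1 must exceed M, so that |b| <= 1 as [expi_approx] requires. *)
pose n := Num.truncn (K / eps + M).
have hn : K / eps + M < n.+1%:R.
  by have /andP[] := truncn_itv (addr_ge0 (divr_ge0 K0 (ltW e0)) M0).
have n0 : (0 : R) < n.+1%:R by rewrite ltr0n.
exists (fun x => (1 + 'i%C * (f x / n.+1%:R)%:C%C) ^+ n.+1); first exact: Wn.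
move=> x Bx; set b := f x / n.+1%:R.
have fE : f x = b *+ n.+1 by rewrite -mulr_natr /b divfK// gt_eqF.
have expE k : expi (b *+ k) = expi b ^+ k.
  by elim: k => [|k IH]; rewrite ?mulr0n ?expi0// mulrS expiD IH exprS.
rewrite fE expE.
have bM : `|b| <= M / n.+1%:R.
  by rewrite /b normrM normfV normr_nat ler_pM2r ?invr_gt0// fM.
have Mn : M <= n.+1%:R.
  apply: le_trans (ltW hn); rewrite lerDr divr_ge0// ltW//.
have b1 : `|b| <= 1 by apply: le_trans bM _; rewrite ler_pdivrMr// mul1r.
set u := expi b; set v := 1 + _.
have uv : nc (u - v) <= 2 * b ^+ 2 by exact: expi_approx.
have v1 : nc v <= expR (M / n.+1%:R).
  rewrite /v (le_trans (ncD _ _))// nc1 ncM nc_real.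
  have -> : nc ('i%C : R[i]) = 1 by rewrite ncE /= expr0n expr1n add0r sqrtr1.
  by rewrite mul1r (le_trans _ (expR_ge1Dx _))// lerD2l.
(* The difference of powers telescopes, with |u| = 1 and |v| <= exp (M / (n + 1)). *)
have tele k : nc (u ^+ k - v ^+ k) <= k%:R * (2 * b ^+ 2) * expR (M / n.+1%:R) ^+ k.
  have E1 : 1 <= expR (M / n.+1%:R) by rewrite -expR0 ler_expR divr_ge0// ltW.
  elim: k => [|k IH]; first by rewrite !expr0 subrr nc0 !mul0r.
  rewrite !exprS.
  have -> : u * u ^+ k - v * v ^+ k = (u - v) * u ^+ k + v * (u ^+ k - v ^+ k) by ring.
  apply: le_trans (ncD _ _) _; rewrite !ncM ncX nc_expi expr1n mulr1.
  have h1 := ler_pM (nc_ge0 _) (nc_ge0 _) v1 IH.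
  have Ek : 1 <= expR (M / n.+1%:R) * expR (M / n.+1%:R) ^+ k by rewrite -exprS exprn_ege1.
  have b20 : 0 <= 2 * b ^+ 2 by rewrite mulr_ge0// sqr_ge0.
  have h2 := ler_wpM2l b20 Ek.
  rewrite -natr1; lra.
apply: le_trans (tele n.+1) _.
have -> : expR (M / n.+1%:R) ^+ n.+1 = expR M.
  by rewrite -expRM_natl -mulr_natl mulrCA divff ?mulr1// gt_eqF.
have hb : b ^+ 2 <= (M / n.+1%:R) ^+ 2.
  by rewrite -(real_normK (num_real b)) lerXn2r ?nnegrE// divr_ge0// ltW.
have h : n.+1%:R * (2 * b ^+ 2) * expR M <= K / n.+1%:R.
  have -> : K / n.+1%:R = n.+1%:R * (2 * (M / n.+1%:R) ^+ 2) * expR M.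
    by rewrite /K; field; rewrite gt_eqF.
  by rewrite ler_wpM2r ?expR_ge0// ler_wpM2l ?(ltW n0)// ler_wpM2l.
apply: le_trans h _; rewrite ler_pdivrMr// mulrC -ler_pdivrMr//.
by apply: le_trans (ltW hn); rewrite lerDl.
Qed.

End wiener_class.

(** * Fourier series on a box *)

Section period.
Context {R : realType}.
Local Notation leb1 := (@lebesgue_measure R).

Lemma expiMn (a : R) (k : nat) : expi (k%:R * a) = expi a ^+ k.
Proof.
elim: k => [|k IH]; first by rewrite mul0r expi0 expr0.
by rewrite exprS -IH -expiD -natr1 mulrDl mul1r addrC.
Qed.

Lemma expi_period (k : int) : expi (2 * pi * k%:~R : R) = 1.
Proof.
have h1 : expi (2 * pi : R) = 1.
  by rewrite mulr_natl /expi cos2pi sin2pi.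
have hn (n : nat) : expi (2 * pi * n%:R : R) = 1.
  by rewrite mulrC expiMn h1 expr1n.
case: k => n; first exact: hn.
have := expiN (2 * pi * n.+1%:R : R); rewrite hn mulr1 => <-.
by rewrite NegzE mulrNz mulrN.
Qed.

Lemma lebesgue_FTC (f F : R -> R) (a b : R) : a < b ->
  (forall x, {for x, continuous f}) -> (forall x : R, is_derive x 1 F (f x)) ->
  leb1.-integrable setT (fun s => ((if a < s < b then f s else 0) : R)%:E) /\
  \int[leb1]_s (if a < s < b then f s else 0) = F b - F a.
Proof.
move=> ab cf dF.
have cF x : {for x, continuous F}.
  by apply: differentiable_continuous; apply/derivable1_diffP; case: (dF x).
have cab : {within `[a, b], continuous f} by apply: continuous_subspaceT.
have icc : leb1.-integrable `[a, b] (EFin \o f).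
  by apply: continuous_compact_integrable => //; exact: segment_compact.
have ioo : leb1.-integrable `]a, b[ (EFin \o f).
  by apply: integrableS icc => //; exact: subset_itv_oo_cc.
have e s : (if a < s < b then f s else 0) = (f \_ `]a, b[) s.
  rewrite patchE; case: ifPn => h; first by rewrite ifT// inE/= in_itv.
  by rewrite ifF//; apply/negbTE; rewrite notin_setE/= in_itv/=; exact/negP.
have e' : (fun s => if a < s < b then f s else 0) = (f \_ `]a, b[) by apply/funext.
split.
  have := ioo; rewrite integrable_mkcond//; congr (_.-integrable _ _).
  by apply/funext => s; rewrite e restrict_EFin.
rewrite e' -Rintegral_mkcond Rintegral_itv_bndo_bndc//.
rewrite Rintegral_itv_obnd_cbnd//; last first.
  by apply: integrableS icc => //; exact: subset_itv_oc_cc.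
rewrite /Rintegral (continuous_FTC2 ab cab (F := F)) //.
  split => //.
  - exact/cvg_at_right_filter/cF.
  - exact/cvg_at_left_filter/cF.
by move=> x _; rewrite derive1E; apply: derive_val.
Qed.

Definition ival (a L s : R) : R[i] := if `|s - a| < L then 1 else 0.

Lemma ivalE (a L s : R) : (`|s - a| < L) = (a - L < s < a + L).
Proof. by rewrite ltr_distl. Qed.

Lemma ival_exp_integral (a L : R) (k : int) : 0 < L ->
  cintegrable leb1 (fun s => ival a L s * expi (pi / L * k%:~R * s)) /\
  cintegral leb1 (fun s => ival a L s * expi (pi / L * k%:~R * s)) =
    if k == 0 then (2 * L)%:C%C else 0.
Proof.
move=> L0; set w := pi / L * k%:~R.
have ab : a - L < a + L by lra.
pose f1 (s : R) := cos (w * s); pose f2 (s : R) := sin (w * s).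
have dw (s : R) : is_derive s 1 (fun s => w * s) w.
  rewrite (_ : (fun s : R => w * s) = w *: (id : R -> R)) //.
  by apply: is_derive_eq; rewrite /GRing.scale/= mulr1.
have c1 x : {for x, continuous f1}.
  apply: (@continuous_comp _ _ _ ( *%R w) cos); first exact: mulrl_continuous.
  exact: continuous_cos.
have c2 x : {for x, continuous f2}.
  apply: (@continuous_comp _ _ _ ( *%R w) sin); first exact: mulrl_continuous.
  exact: continuous_sin.
have Re1 s : complex.Re (ival a L s * expi (w * s)) = if a - L < s < a + L then f1 s else 0.
  by rewrite /ival ivalE; case: ifP => _; rewrite ?mul1r ?mul0r.
have Im1 s : complex.Im (ival a L s * expi (w * s)) = if a - L < s < a + L then f2 s else 0.
  by rewrite /ival ivalE; case: ifP => _; rewrite ?mul1r ?mul0r.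
suff [F1 [F2 [d1 d2 e]]] : exists F1 F2 : R -> R, [/\ forall x : R, is_derive x 1 F1 (f1 x),
    forall x : R, is_derive x 1 F2 (f2 x) &
    Complex (F1 (a + L) - F1 (a - L)) (F2 (a + L) - F2 (a - L)) =
      if k == 0 then (2 * L)%:C%C else 0].
  have [i1 e1] := lebesgue_FTC ab c1 d1.
  have [i2 e2] := lebesgue_FTC ab c2 d2.
  split; first by split; [under eq_fun do rewrite Re1|under eq_fun do rewrite Im1].
  rewrite -e -e1 -e2 /cintegral; congr Complex; apply: eq_Rintegral => s _; first exact: Re1.
  exact: Im1.
have [k0|k0] := eqVneq k 0.
  exists id, (fun=> 0); split.
  - by move=> x; rewrite /f1 /w k0 mulr0 mul0r cos0; exact: is_derive_id.
  - by move=> x; rewrite /f2 /w k0 mulr0 mul0r sin0; exact: is_derive_cst.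
  - by rewrite subrr; congr Complex; ring.
have w0 : w != 0 by rewrite /w !mulf_neq0 ?invr_eq0 ?intr_eq0 ?(lt0r_neq0 (pi_gt0 R)) ?(lt0r_neq0 L0).
exists (fun s => w^-1 * sin (w * s)), (fun s => - w^-1 * cos (w * s)); split.
- move=> x.
  rewrite (_ : (fun s : R => w^-1 * sin (w * s)) = w^-1 *: (sin \o (fun s : R => w * s))) //.
  have h : is_derive x (1 : R) (sin \o (fun s : R => w * s)) (cos (w * x) * w).
    exact: is_derive1_comp.
  by apply: is_derive_eq; rewrite /GRing.scale/= /f1; field.
- move=> x.
  rewrite (_ : (fun s : R => - w^-1 * cos (w * s)) = (- w^-1) *: (cos \o (fun s : R => w * s))) //.
  have h : is_derive x (1 : R) (cos \o (fun s : R => w * s)) (- sin (w * x) * w).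
    exact: is_derive1_comp.
  by apply: is_derive_eq; rewrite /GRing.scale/= /f2; field.
have per : expi (w * (a + L)) = expi (w * (a - L)).
  have -> : w * (a + L) = w * (a - L) + 2 * pi * k%:~R.
    by rewrite /w; field; exact: lt0r_neq0.
  by rewrite expiD expi_period mulr1.
case: per => -> ->.
by rewrite !subrr.
Qed.

End period.

Section annihilator_lim.
Context d (T : measurableType d) (R : realType) (m : {measure set T -> \bar R}).
Implicit Types (h u : T -> R[i]).

Lemma cintegrable_bcmM h u : cintegrable m h -> bcm u ->
  cintegrable m (fun x => h x * u x).
Proof.
move=> ch [mu [B uB]]; apply: (@cintegrable_le _ _ _ _ _ (fun x => B * nc (h x))).
- by apply: cmeasurableM => //; exact: cintegrable_meas ch.
- exact: (integrableZl measurableT _ (cintegrable_nc ch)).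
- by move=> x; rewrite ncM mulrC ler_wpM2r ?nc_ge0.
Qed.

(** Dominated convergence. In the application h vanishes off the box, hence convergence is asked
    only where h is nonzero. *)
Lemma cintegral_lim0 h u (v : nat -> T -> R[i]) (M : R) : cintegrable m h ->
  cmeasurable u -> (forall k, cmeasurable (v k)) ->
  (forall x, nc (u x) <= M) -> (forall k x, nc (v k x) <= M) ->
  (forall x, h x = 0 \/ nc (v k x - u x) @[k --> \oo] --> 0) ->
  (forall k, cintegral m (fun x => h x * v k x) = 0) ->
  cintegral m (fun x => h x * u x) = 0.
Proof.
move=> ch mu mv uM vM lim v0.
have bu : bcm u by split => //; exists M.
have bv k : bcm (v k) by split => //; exists M.
pose F k x := (nc (h x * (v k x - u x)))%:E.
have mh := cintegrable_meas ch.
have mF k : measurable_fun setT (F k).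
  apply/measurable_EFinP/measurable_nc/cmeasurableM => //.
  by apply: cmeasurableD => //; exact: cmeasurableN.
have := @dominated_cvg _ _ _ m setT measurableT F (cst 0%E)
  (fun x => ((M + M) * nc (h x))%:E) mF.
move=> /(_ _ _ _ _)/wrap[].
- move=> x _; apply: cvg_EFin; first by apply: nearW.
  have [h0|vu] := lim x.
    apply: (@cvg_trans _ ((0 : R) @[k --> \oo])); last exact: cvg_cst.
    by apply: near_eq_cvg; apply: nearW => k; rewrite /F /= h0 mul0r nc0.
  have {}vu := cvgM (cvg_cst (nc (h x))) vu; rewrite mulr0 in vu.
  apply: (@cvg_trans _ ((nc (h x) * nc (v k x - u x)) @[k --> \oo])).
    by apply: near_eq_cvg; apply: nearW => k; rewrite /F /= ncM.
  exact: vu.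
- by [].
- exact: (integrableZl measurableT _ (cintegrable_nc ch)).
- move=> k x _; rewrite /F gee0_abs ?lee_fin ?nc_ge0// ncM mulrC ler_wpM2r ?nc_ge0//.
  by rewrite (le_trans (ncB _ _))// lerD.
rewrite integral_cst// mul0e => cF.
apply: nc_eq0; apply/eqP; rewrite eq_le nc_ge0 andbT -lee_fin.
rewrite -[leRHS](cvg_lim (@ereal_hausdorff R) cF).
apply: lime_ge; first by apply/cvg_ex; exists 0%E.
apply: nearW => k.
have ci : cintegrable m (fun x => h x * (v k x - u x)).
  by apply: cintegrable_bcmM => //; apply: bcmD => //; exact: bcmN.
have -> : cintegral m (fun x => h x * u x) = - cintegral m (fun x => h x * (v k x - u x)).
  have e x : h x * (v k x - u x) = h x * v k x + (-1) * (h x * u x) by ring.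
  rewrite (@eq_cintegral _ _ _ m _ _ e).
  rewrite cintegralD ?cintegralZ; [|exact: cintegrable_bcmM..|].
    by rewrite v0 add0r mulN1r opprK.
  by apply: cintegrableZ; exact: cintegrable_bcmM.
rewrite ncN; apply: le_trans (_ : (\int[m]_x nc (h x * (v k x - u x)))%:E <= _)%E.
  by rewrite lee_fin; exact: nc_cintegral.
rewrite /Rintegral fineK//; apply: integrable_fin_num => //.
exact: cintegrable_nc.
Qed.

End annihilator_lim.

(** * Polynomials converging to a step *)

Section half_step.
Context {R : realType}.
Implicit Types (v q x : R).

Lemma bernoulli_ge x k : 0 <= x -> 1 + k%:R * x <= (1 + x) ^+ k.
Proof.
move=> x0; elim: k => [|k IH]; first by rewrite mul0r addr0 expr0.
rewrite exprS -natr1; apply: le_trans (_ : (1 + x) * (1 + k%:R * x) <= _).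
  have h : 0 <= k%:R * x * x by rewrite !mulr_ge0.
  lra.
by rewrite ler_wpM2l// addr_ge0.
Qed.

Lemma bernoulli_le x k : 0 <= x <= 1 -> 1 - k%:R * x <= (1 - x) ^+ k.
Proof.
move=> /andP[x0 x1]; elim: k => [|k IH]; first by rewrite mul0r subr0 expr0.
rewrite exprS -natr1; apply: le_trans (_ : (1 - x) * (1 - k%:R * x) <= _).
  have h : 0 <= k%:R * x * x by rewrite !mulr_ge0.
  lra.
by rewrite ler_wpM2l// subr_ge0.
Qed.

(** Polynomials in v that tend on [0, 1] to the indicator of v < 1/2. The first factor is the one of
    elementary proofs of the Stone-Weierstrass theorem, governed by whether (2 v)^k tends to 0 or to
    infinity; the second corrects the value at 1/2. *)
Definition half_step v (k : nat) : R := (1 - v ^+ k) ^+ (2 ^ k) * (1 - (1 - (2 * v - 1) ^+ 2) ^+ k).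

Lemma half_step_bound v k : 0 <= v <= 1 -> 0 <= half_step v k <= 1.
Proof.
move=> /andP[v0 v1].
have h (x : R) j : 0 <= x <= 1 -> 0 <= x ^+ j <= 1.
  by move=> /andP[x0 x1]; rewrite exprn_ge0// exprn_ile1.
have hc (x : R) : 0 <= x <= 1 -> 0 <= 1 - x <= 1 by lra.
have h1 : 0 <= (1 - v ^+ k) ^+ (2 ^ k) <= 1 by apply/h/hc/h; rewrite v0.
have h2 : 0 <= 1 - (1 - (2 * v - 1) ^+ 2) ^+ k <= 1.
  by apply/hc/h/hc; rewrite sqr_ge0; nra.
case/andP: h1 => a0 a1; case/andP: h2 => b0 b1.
by rewrite /half_step mulr_ge0//= mulr_ile1.
Qed.

(* At v = 1/2 the first factor tends to 1/e and the second one is 0. *)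
Lemma half_step_cvg v : 0 <= v <= 1 ->
  half_step v k @[k --> \oo] --> ((v < 2^-1)%R%:R : R).
Proof.
move=> v01; have /andP[v0 v1] := v01.
have vk k : 0 <= v ^+ k <= 1 by rewrite exprn_ge0// exprn_ile1.
have vkk k : 0 <= (1 - v ^+ k) ^+ (2 ^ k) <= 1.
  by rewrite exprn_ge0 ?exprn_ile1 ?subr_ge0 ?lerBlDl ?lerDr; case/andP: (vk k).
have [e|ne] := eqVneq v 2^-1.
  rewrite e ltxx; apply: (@cvg_trans _ ((0 : R) @[k --> \oo])); last exact: cvg_cst.
  apply: near_eq_cvg; apply: nearW => k; rewrite /half_step.
  by rewrite mulfV ?pnatr_eq0// subrr expr0n subr0 expr1n subrr mulr0.
pose s := 1 - (2 * v - 1) ^+ 2.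
have s01 : 0 <= s < 1.
  have : 0 < (2 * v - 1) ^+ 2 by rewrite exprn_even_gt0//; apply/eqP => h; move/eqP: ne; apply; lra.
  by rewrite /s => h; apply/andP; split; nra.
have sk k : 0 <= s ^+ k <= 1.
  by case/andP: s01 => s0 s1; rewrite exprn_ge0// exprn_ile1// ltW.
have sc : s ^+ k @[k --> \oo] --> (0 : R).
  by case/andP: s01 => s0 s1; apply: cvg_expr; rewrite ger0_norm.
have [vh|vh] := ltP v 2^-1.
  apply: (@squeeze_cvgr _ _ _ _ (fun k => 1 - (2 * v) ^+ k - s ^+ k) (fun=> 1)); last exact: cvg_cst.
    apply: nearW => k; have /andP[_ ->] := half_step_bound k v01; rewrite andbT.
    have h : 1 - (2 * v) ^+ k <= (1 - v ^+ k) ^+ (2 ^ k).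
      by rewrite exprMn -natrX; apply: bernoulli_le.
    rewrite /half_step -/s; case/andP: (vkk k) => a0 a1; case/andP: (sk k) => b0 b1.
    nra.
  rewrite -[X in _ --> X]subr0 -[X in _ --> X - _]subr0.
  apply: cvgB => //; apply: cvgB; first exact: cvg_cst.
  by apply: cvg_expr; rewrite ger0_norm ?mulr_ge0//; lra.
have {ne}vh : 2^-1 < v by rewrite lt_neqAle eq_sym ne.
apply: (@squeeze_cvgr _ _ _ _ (fun=> 0) (fun k => (2 * v)^-1 ^+ k)); first last.
- by apply: cvg_expr; rewrite ger0_norm ?invr_ge0 ?mulr_ge0// invf_lt1; lra.
- exact: cvg_cst.
apply: nearW => k; have /andP[-> _] := half_step_bound k v01; rewrite andTb.
case/andP: (vkk k) => a0 a1; case/andP: (sk k) => b0 b1.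
apply: le_trans (_ : (1 - v ^+ k) ^+ (2 ^ k) <= _).
  by rewrite /half_step -/s; nra.
have v2 : 0 < 2 * v by lra.
rewrite exprVn -[leRHS]mul1r ler_pdivlMr ?exprn_gt0//.
(* The product is (1 - v^(2k))^(2^k) <= 1, while Bernoulli bounds its second factor below by (2
   v)^k. *)
apply: le_trans (_ : (1 - v ^+ k) ^+ (2 ^ k) * (1 + v ^+ k) ^+ (2 ^ k) <= _).
  rewrite ler_wpM2l//; apply: le_trans (bernoulli_ge _ _); last by case/andP: (vk k).
  by rewrite exprMn -natrX; lra.
case/andP: (vk k) => c0 c1.
by rewrite -exprMn exprn_ile1//; nra.
Qed.

End half_step.

(** * Totality of the exponentials on a box *)

Section fourier_exp.
Context {R : realType} (n : nat) (L : R).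
Implicit Types (eta : 'rV[int]_n) (t : 'rV[R]_n).

Definition bexp eta t : R[i] := expi (\sum_j pi / L * (eta ord0 j)%:~R * t ord0 j).

Lemma bexpD eta eta' t : bexp (eta + eta') t = bexp eta t * bexp eta' t.
Proof.
rewrite /bexp -expiD -big_split/=; congr expi; apply: eq_bigr => j _.
by rewrite mxE intrD -mulrDl -mulrDr.
Qed.

Lemma bexp_bcm eta : bcm (bexp eta).
Proof.
apply: bcm_expi; apply: measurable_sum => j; apply: measurable_funM.
  exact: measurable_cst.
exact: measurable_rV_coord.
Qed.

Lemma bexp0 t : bexp 0 t = 1.
Proof.
rewrite /bexp big1 ?expi0// => j _.
by rewrite mxE mulr0 mul0r.
Qed.

Variables (a : 'rV[R]_n) (h : 'rV[R]_n -> R[i]).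
Hypothesis L0 : 0 < L.
Local Notation leb := (rV_lebesgue (R := R) n).
Hypothesis ch : cintegrable leb h.
Hypothesis hD : forall t, ~~ [forall j, `|t ord0 j - a ord0 j| < L] -> h t = 0.
Hypothesis h0 : forall eta, cintegral leb (fun t => h t * bexp eta t) = 0.

(* The functions in [stab] form an algebra that contains the exponentials and is
   closed under bounded pointwise limits on the box, so that the sets whose
   indicator is in [stab] form a sigma-algebra. *)
Let ann (psi : 'rV[R]_n -> R[i]) := bcm psi /\
  forall eta, cintegral leb (fun t => h t * (psi t * bexp eta t)) = 0.
Let stab (phi : 'rV[R]_n -> R[i]) := bcm phi /\
  forall psi, ann psi -> ann (fun t => phi t * psi t).

Let annD f g : ann f -> ann g -> ann (fun t => f t + g t).
Proof.
move=> [bf f0] [bg g0]; split; first exact: bcmD.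
move=> eta.
have e t : h t * ((f t + g t) * bexp eta t) =
  h t * (f t * bexp eta t) + h t * (g t * bexp eta t) by ring.
rewrite (@eq_cintegral _ _ _ leb _ _ e) cintegralD ?f0 ?g0 ?addr0//.
  by apply: cintegrable_bcmM => //; apply: bcmM => //; exact: bexp_bcm.
by apply: cintegrable_bcmM => //; apply: bcmM => //; exact: bexp_bcm.
Qed.

Let annZ c f : ann f -> ann (fun t => c * f t).
Proof.
move=> [bf f0]; split; first exact: bcmZ.
move=> eta.
have e t : h t * (c * f t * bexp eta t) = c * (h t * (f t * bexp eta t)) by ring.
rewrite (@eq_cintegral _ _ _ leb _ _ e) cintegralZ ?f0 ?mulr0//.
by apply: cintegrable_bcmM => //; apply: bcmM => //; exact: bexp_bcm.
Qed.

Let eq_stab f g : f =1 g -> stab f -> stab g.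
Proof. by move=> /funext ->. Qed.

Let stab_cst c : stab (fun=> c).
Proof. by split; [exact: bcm_cst|move=> psi; exact: annZ]. Qed.

Let stabD f g : stab f -> stab g -> stab (fun t => f t + g t).
Proof.
move=> [bf sf] [bg sg]; split; first exact: bcmD.
move=> psi apsi; have -> : (fun t => (f t + g t) * psi t) = (fun t => f t * psi t + g t * psi t).
  by apply/funext => t; rewrite mulrDl.
by apply: annD; [exact: sf|exact: sg].
Qed.

Let stabM f g : stab f -> stab g -> stab (fun t => f t * g t).
Proof.
move=> [bf sf] [bg sg]; split; first exact: bcmM.
move=> psi apsi; have -> : (fun t => f t * g t * psi t) = (fun t => f t * (g t * psi t)).
  by apply/funext => t; rewrite mulrA.
exact/sf/sg.
Qed.

Let stabC f : stab f -> stab (fun t => 1 - f t).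
Proof.
move=> sf; have := stabD (stab_cst 1) (stabM (stab_cst (-1)) sf).
by apply: eq_stab => t; rewrite mulN1r.
Qed.

Let stabX f k : stab f -> stab (fun t => f t ^+ k).
Proof.
move=> sf; elim: k => [|k IH]; first exact: eq_stab (stab_cst 1).
by apply: eq_stab (stabM sf IH) => t; rewrite exprS.
Qed.

Let stab_bexp eta : stab (bexp eta).
Proof.
split; first exact: bexp_bcm.
move=> psi [bpsi p0]; split; first by apply: bcmM => //; exact: bexp_bcm.
move=> eta'; rewrite -(p0 (eta + eta')).
by apply: eq_cintegral => t; rewrite bexpD; ring.
Qed.

Let stab_lim (v : nat -> 'rV[R]_n -> R[i]) f (M : R) : (forall k, stab (v k)) ->
  cmeasurable f -> (forall k t, nc (v k t) <= M) ->
  (forall t, [forall j, `|t ord0 j - a ord0 j| < L] ->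
    nc (v k t - f t) @[k --> \oo] --> 0) ->
  (forall t, nc (f t) <= M) -> stab f.
Proof.
move=> sv mf vM lim fM; split; first by split => //; exists M.
move=> psi [bpsi p0]; split; first by apply: bcmM => //; split => //; exists M.
have [mpsi [B psiB]] := bpsi.
have M0 : 0 <= M by apply: le_trans (fM 0); exact: nc_ge0.
move=> eta; have [me _] := bexp_bcm eta.
apply: (@cintegral_lim0 _ _ _ leb h _ (fun k t => v k t * psi t * bexp eta t) (M * B)) => //.
- exact: (cmeasurableM (cmeasurableM mf mpsi) me).
- by move=> k; case: (sv k) => -[mv _] _; exact: (cmeasurableM (cmeasurableM mv mpsi) me).
- by move=> t; rewrite !ncM nc_expi mulr1 ler_pM ?nc_ge0.
- by move=> k t; rewrite !ncM nc_expi mulr1 ler_pM ?nc_ge0.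
- move=> t; have [tD|/hD] := boolP [forall j, `|t ord0 j - a ord0 j| < L]; [right|by left].
  have -> : (fun k => nc (v k t * psi t * bexp eta t - f t * psi t * bexp eta t)) =
      (fun k => nc (v k t - f t) * nc (psi t)).
    by apply/funext => k; rewrite -!mulrBl !ncM nc_expi mulr1.
  by rewrite -(mul0r (nc (psi t))); apply: cvgMl; exact: lim.
- by move=> k; case: ((sv k).2 _ (conj bpsi p0)) => _; exact.
Qed.

(** Changing a bounded function off the box does not affect integrals against h: the constant
    sequence f converges to g on the box. *)
Let stab_ind0 f g : bcm g -> stab f ->
  (forall t, [forall j, `|t ord0 j - a ord0 j| < L] -> f t = g t) -> stab g.
Proof.
move=> [mg [B gB]] sf fg; have [_ [B' fB']] := sf.1.
apply: (@stab_lim (fun=> f) g (Num.max B B')) => // [k t|t tD|t].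
- by rewrite le_max fB' orbT.
- rewrite fg// subrr nc0; exact: cvg_cst.
- by rewrite le_max gB.
Qed.

Let half_space_cos (j : 'I_n) (b : R) :
  stab (fun t => (cos (pi / L * t ord0 j + b))%:C%C).
Proof.
have bj (c : int) (t : 'rV[R]_n) : bexp (c *: delta_mx ord0 j) t = expi (pi / L * c%:~R * t ord0 j).
  rewrite /bexp (bigD1 j)//= big1 ?addr0; last first.
    by move=> i ij; rewrite !mxE (negPf ij) andbF mulr0 mulr0 mul0r.
  by rewrite !mxE !eqxx mulr1.
have sc := stabD (stabM (stab_cst (expi b / 2)) (stab_bexp (1 *: delta_mx ord0 j)))
  (stabM (stab_cst (expi (- b) / 2)) (stab_bexp (-1 *: delta_mx ord0 j))).
apply: eq_stab sc => t.
rewrite !bj /= mulr1 mulrN1 mulNr -!(mulrAC _ _ 2^-1) -!expiD.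
rewrite -mulrDl -opprD -conj_expi (addrC b); set z := _ + b.
apply: (mulIf (_ : (2 : R[i]) != 0)); first by rewrite pnatr_eq0.
rewrite mulfVK ?pnatr_eq0// conjcE /=.
by apply: eq_complexP; rewrite !(cReD, cImD, cReM, cImM) /=; ring.
Qed.

(** The functions [half_step] are polynomials in v, so they stay in the algebra, and their limit is
    the indicator. *)
Let stab_half (v : 'rV[R]_n -> R) : (forall t, 0 <= v t <= 1) ->
  stab (fun t => (v t)%:C%C) -> stab (fun t => ((v t < 2^-1)%R%:R : R)%:C%C).
Proof.
move=> v01 sv; have [[mv _] _] := sv.1.
have mi : measurable_fun setT (fun t => (v t < 2^-1)%R%:R : R).
  rewrite (_ : (fun t => _) = \1_(v @^-1` `]-oo, 2^-1[)); last first.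
    by apply/funext => t; rewrite indicE; congr (nat_of_bool _)%:R; apply/idP/idP; rewrite inE/= in_itv.
  apply: measurable_indic; rewrite -[X in measurable X]setTI.
  exact: mv.
apply: (@stab_lim (fun k t => (half_step (v t) k)%:C%C) _ 1).
- move=> k; have s := stabC (stabX k (stabC (stabX 2 (stabD (stabM (stab_cst 2) sv) (stab_cst (-1)))))).
  have := stabM (stabX (2 ^ k) (stabC (stabX k sv))) s.
  apply: eq_stab => t; rewrite /half_step.
  by rewrite !(rmorphM, rmorphB, rmorphXn, rmorph1, rmorph_nat).
- exact: cmeasurable_real.
- move=> k t; have /andP[h1 h2] := half_step_bound k (v01 t).
  by rewrite nc_real ger0_norm.
- move=> t _; have := half_step_cvg (v01 t) => /cvgrPdist_le hv.
  apply/cvgrPdist_le => e e0; near=> k.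
  rewrite sub0r normrN -rmorphB nc_real normr_id distrC.
  by near: k; exact: hv.
- by move=> t; rewrite nc_real; case: (_ < _); rewrite ?normr0 ?normr1.
Unshelve. all: by end_near. Qed.

(* On the box, the sign of [t_j - x] is that of the trigonometric polynomial
   [sin p * sin q] below, as [sin p > 0]. *)
Let stab_ray (j : 'I_n) (x : R) : stab (fun t => ((t ord0 j < x)%R%:R : R)%:C%C).
Proof.
have bind : bcm (fun t : 'rV[R]_n => ((t ord0 j < x)%R%:R : R)%:C%C).
  split; last by exists 1 => t; rewrite nc_real; case: (_ < _); rewrite ?normr0 ?normr1.
  apply: cmeasurable_real.
  rewrite (_ : (fun t => _) = \1_(rV_coord j @^-1` `]-oo, x[)); last first.
    by apply/funext => t; rewrite indicE; congr (nat_of_bool _)%:R; apply/idP/idP; rewrite inE/= in_itv.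
  apply: measurable_indic; rewrite -[X in measurable X]setTI.
  exact: measurable_rV_coord.
have [xl|xl] := leP x (a ord0 j - L).
  apply: (stab_ind0 bind (stab_cst 0)) => t /forallP/(_ j); rewrite ivalE => /andP[ha _].
  by rewrite ltNge (ltW (le_lt_trans xl ha)).
have [xr|xr] := leP (a ord0 j + L) x.
  apply: (stab_ind0 bind (stab_cst 1)) => t /forallP/(_ j); rewrite ivalE => /andP[_ ha].
  by rewrite (lt_le_trans ha xr).
(* These angles are chosen so that al = p - q and pi / L * t_j + be = p + q, with p and q set
   below. *)
set al := pi / L / 2 * (x - a ord0 j + L).
set be := pi / L / 2 * (L - x - a ord0 j).
(* The difference of cosines is 2 sin p sin q and lies in [-2, 2]: the factor 1/4 keeps v in [0, 1],
   and v < 1/2 exactly when sin p sin q < 0. *)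
pose v (t : 'rV[R]_n) := 2^-1 + 4^-1 * (cos al - cos (pi / L * t ord0 j + be)).
have v01 t : 0 <= v t <= 1.
  have := cos_le1 al; have := cos_geN1 al.
  have := cos_le1 (pi / L * t ord0 j + be); have := cos_geN1 (pi / L * t ord0 j + be).
  by rewrite /v; lra.
have sv : stab (fun t => (v t)%:C%C).
  have := stabD (stab_cst 2^-1%:C%C) (stabM (stab_cst 4^-1%:C%C)
    (stabD (stab_cst (cos al)%:C%C) (stabM (stab_cst (-1)) (half_space_cos j be)))).
  by apply: eq_stab => t; rewrite mulN1r -!(rmorphB, rmorphM, rmorphD).
apply: (stab_ind0 bind (stab_half v01 sv)) => t /forallP/(_ j); rewrite ivalE => /andP[t1 t2].
congr (_%:C)%C; congr (nat_of_bool _)%:R.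
set p := pi / L / 2 * (t ord0 j - a ord0 j + L); set q := pi / L / 2 * (t ord0 j - x).
have pL0 : 0 < pi / L / 2 by rewrite !divr_gt0// pi_gt0.
have e : cos al - cos (pi / L * t ord0 j + be) = 2 * (sin p * sin q).
  have -> : al = p - q by rewrite /al /p /q; ring.
  have -> : pi / L * t ord0 j + be = p + q by rewrite /be /p /q; field; exact: lt0r_neq0.
  rewrite cosB cosD; ring.
have ep : pi / L / 2 * (2 * L) = pi by field; exact: lt0r_neq0.
have sp : 0 < sin p.
  apply: sin_gt0_pi; rewrite /p mulr_gt0 ?andTb//; last lra.
  by rewrite -[ltRHS]ep ltr_pM2l//; lra.
rewrite /v e; have [tx|tx|tx] := ltgtP (t ord0 j) x.
- have sq : 0 < sin (- q).
    apply: sin_gt0_pi; rewrite /q -mulrN mulr_gt0 ?andTb//; last lra.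
    by rewrite -[ltRHS]ep ltr_pM2l//; lra.
  by rewrite sinN in sq; have spq := mulr_gt0 sp sq; lra.
- have sq : 0 < sin q.
    apply: sin_gt0_pi; rewrite /q mulr_gt0 ?andTb//; last lra.
    by rewrite -[ltRHS]ep ltr_pM2l//; lra.
  by apply/negbTE; rewrite -leNgt; have spq := mulr_gt0 sp sq; lra.
- by rewrite /q tx subrr mulr0 sin0 !mulr0 addr0 ltxx.
Qed.

Let good (A : set 'rV[R]_n) := measurable A /\ stab (fun t => (\1_A t)%:C%C).

Let goodC A : good A -> good (~` A).
Proof.
move=> [mA sA]; split; first exact: measurableC.
apply: eq_stab (stabC sA) => t.
by rewrite indicC indicE; case: (_ \in _); rewrite ?subrr ?subr0.
Qed.

Let goodU A B : good A -> good B -> good (A `|` B).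
Proof.
move=> [mA sA] [mB sB]; split; first exact: measurableU.
apply: eq_stab (stabC (stabM (stabC sA) (stabC sB))) => t.
rewrite !indicE in_setU; case: (_ \in _); case: (_ \in _) => /=;
by rewrite ?subrr ?subr0 ?mulr0 ?mul0r ?mulr1 ?subrr ?subr0.
Qed.

Let good_bigcup (F : (set 'rV[R]_n)^nat) : (forall i, good (F i)) -> good (\bigcup_i F i).
Proof.
move=> gF; have mU : measurable (\bigcup_i F i) by apply: bigcup_measurable => i _; case: (gF i).
have gk k : good (\big[setU/set0]_(i < k) F i).
  elim: k => [|k IH]; last by rewrite big_ord_recr/=; exact: goodU.
  rewrite big_ord0; split => //; apply: eq_stab (stab_cst 0) => t.
  by rewrite indic0.
split => //.
have ind_le1 (A : set 'rV[R]_n) t : nc (\1_A t)%:C%C <= 1 :> R.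
  by rewrite nc_real indicE; case: (_ \in _); rewrite ?normr0 ?normr1.
apply: (@stab_lim (fun k t => (\1_(\big[setU/set0]_(i < k) F i) t)%:C%C) _ 1) => //.
- by move=> k; case: (gk k).
- by apply: cmeasurable_real; exact: measurable_indic.
move=> t _; case: (pselect ((\bigcup_i F i) t)) => [[i _ Fit]|nFt].
  apply: (@cvg_trans _ ((0 : R) @[k --> \oo])); last exact: cvg_cst.
  apply: near_eq_cvg; exists i.+1 => // k ik.
  rewrite !indicE (mem_set (_ : (\bigcup_i0 F i0) t)); last by exists i.
  rewrite (mem_set (_ : (\big[setU/set0]_(i0 < k) F i0) t)).
    by rewrite subrr nc0.
  by rewrite -bigcup_mkord; exists i.
apply: (@cvg_trans _ ((0 : R) @[k --> \oo])); last exact: cvg_cst.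
apply: near_eq_cvg; apply: nearW => k.
rewrite !indicE !memNset ?subrr ?nc0// -bigcup_mkord => -[i _ Fi].
by apply: nFt; exists i.
Qed.

Let good_measurable A : measurable A -> good A.
Proof.
have good0 : good set0 by split => //; apply: eq_stab (stab_cst 0) => t; rewrite indic0.
apply: smallest_sub.
  by split; [|move=> B; rewrite setTD; exact: goodC|exact: good_bigcup].
rewrite -bigcup_seq/=; apply: bigcup_sub => j _ _ [B mB <-].
rewrite setTI.
have {}mB : (@RGenInftyO.G R).-sigma.-measurable B.
  by rewrite -RGenInftyO.measurableE.
suff /(_ _ mB) : <<s @RGenInftyO.G R >> `<=` [set B : set R | good (rV_coord j @^-1` B)] by [].
apply: smallest_sub.
  split => /= [|C hC|F hF].
  + by rewrite preimage_set0.
  + by rewrite setTD preimage_setC; exact: goodC.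
  + by rewrite preimage_bigcup; exact: good_bigcup.
move=> _ [x ->] /=; split.
  rewrite -[X in measurable X]setTI; exact: measurable_rV_coord.
apply: eq_stab (stab_ray j x) => t.
by rewrite indicE; congr ((nat_of_bool _)%:R%:C)%C; apply/idP/idP; rewrite inE/= in_itv.
Qed.

(** The indicators of all measurable sets lie in [stab]. Applied to psi = 1 at frequency 0, this
    says that h has integral 0 over every measurable set. *)
Lemma bexp_total : {ae leb, forall t, h t = 0}.
Proof.
have ann1 : ann (fun=> 1).
  split; first exact: bcm_cst.
  by move=> eta; rewrite -[RHS](h0 eta); apply: eq_cintegral => t; rewrite mul1r.
have h0A A : measurable A -> cintegral leb (fun t => h t * (\1_A t)%:C%C) = 0.
  move=> /good_measurable[_ [_ /(_ _ ann1)[_ /(_ 0) e]]]; rewrite -[RHS]e.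
  by apply: eq_cintegral => t; rewrite bexp0 !mulr1.
have [ir ii] := ch.
have key (f : 'rV[R]_n -> R) : leb.-integrable setT (EFin \o f) ->
    (forall A, measurable A -> \int[leb]_t (f t * \1_A t) = 0) ->
    ae_eq leb setT (EFin \o f) (cst 0%E).
  move=> intf f0; apply: (integral_ae_eq measurableT intf).
    exact: measurable_cst.
  move=> E _ mE; rewrite integral_cst// mul0e integral_mkcond.
  have := f0 _ mE; rewrite /Rintegral => fE.
  have intE : leb.-integrable setT (fun t => (f t * \1_E t)%:E).
    have -> : (fun t => (f t * \1_E t)%:E) = (EFin \o f) \_ E.
      by apply/funext => t; rewrite patchE indicE; case: (t \in E); rewrite ?mulr1 ?mulr0.
    by rewrite -integrable_mkcond//; exact: integrableS intf.
  have -> : (EFin \o f) \_ E = (fun t => (f t * \1_E t)%:E).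
    by apply/funext => t; rewrite patchE indicE; case: (t \in E); rewrite ?mulr1 ?mulr0.
  by rewrite -[LHS]fineK ?integrable_fin_num// fE.
have hr := key _ ir _; have hi := key _ ii _.
have {}hr : ae_eq leb setT (EFin \o (fun t => complex.Re (h t))) (cst 0%E).
  apply: hr => A /h0A; rewrite /cintegral => -[<- _].
  by apply: eq_Rintegral => t _; rewrite cReM /= mulr0 subr0.
have {}hi : ae_eq leb setT (EFin \o (fun t => complex.Im (h t))) (cst 0%E).
  apply: hi => A /h0A; rewrite /cintegral => -[_ <-].
  by apply: eq_Rintegral => t _; rewrite cImM /= mulr0 add0r.
move: hr hi; apply: filterS2 => t /= /(_ I) [hr] /(_ I) [hi].
by apply: eq_complexP; rewrite ?hr ?hi.
Qed.

End fourier_exp.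

(** * Orthonormal exponentials on a box *)

Section fourier_box.
Context {R : realType} (n : nat).
Local Notation leb := (rV_lebesgue (R := R) n).
Local Notation V := (L2type leb).
Local Notation ip := (L2ip leb).
Local Notation nrm := (nrm ip).
Implicit Types (a t : 'rV[R]_n) (eta : 'rV[int]_n) (L : R).

Definition boxi a L t : R[i] := \prod_j ival (a ord0 j) L (t ord0 j).

Lemma boxiE a L t : boxi a L t = if [forall j, `|t ord0 j - a ord0 j| < L] then 1 else 0.
Proof.
rewrite /boxi; case: ifPn => [/forallP h|].
  by rewrite big1// => j _; rewrite /ival h.
by rewrite negb_forall => /existsP[j h]; rewrite (bigD1 j)//= /ival (negPf h) mul0r.
Qed.

Lemma boxi_idem a L t : boxi a L t * boxi a L t = boxi a L t.
Proof. by rewrite boxiE; case: ifP; rewrite ?mulr1 ?mulr0. Qed.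

Lemma conj_boxi a L t : (boxi a L t)^* = boxi a L t.
Proof. by rewrite boxiE conjcE; case: ifP => _ /=; rewrite oppr0. Qed.

Lemma boxi_le1 a L t : nc (boxi a L t) <= 1.
Proof. by rewrite boxiE; case: ifP; rewrite ?nc1 ?nc0. Qed.

Lemma conj_bexp L eta t : (bexp L eta t)^* = bexp L (- eta) t.
Proof.
rewrite /bexp conj_expi -sumrN; congr expi; apply: eq_bigr => j _.
by rewrite mxE rmorphN mulrN mulNr.
Qed.

Lemma nc_bexp L eta t : nc (bexp L eta t) = 1. Proof. exact: nc_expi. Qed.

Variables (a : 'rV[R]_n) (L : R).
Hypothesis L0 : 0 < L.

Let boxi_bexp eta t : boxi a L t * bexp L eta t =
  \prod_j (ival (a ord0 j) L (t ord0 j) * expi (pi / L * (eta ord0 j)%:~R * t ord0 j)).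
Proof. by rewrite /bexp expi_sum -big_split. Qed.

Lemma boxi_bexp_integral eta :
  cintegrable leb (fun t => boxi a L t * bexp L eta t) /\
  cintegral leb (fun t => boxi a L t * bexp L eta t) =
    if eta == 0 then ((2 * L) ^+ n)%:C%C else 0.
Proof.
under eq_fun do rewrite boxi_bexp.
have [ci ->] := cintegral_prod (fun j => (ival_exp_integral (a ord0 j) (eta ord0 j) L0).1).
split => //; case: eqVneq => [->|eta0].
  under eq_bigr => j _ do rewrite (ival_exp_integral (a ord0 j) _ L0).2 mxE eqxx.
  by rewrite prodr_const card_ord rmorphXn.
have [j ej] : exists j, eta ord0 j != 0.
  apply/existsP; rewrite -negb_forall; apply: contraNN eta0 => /forallP h.
  by apply/eqP/rowP => j; rewrite mxE; apply/eqP.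
by rewrite (bigD1 j)//= (ival_exp_integral (a ord0 j) _ L0).2 (negPf ej) mul0r.
Qed.

Lemma boxi_cmeasurable : cmeasurable (boxi a L).
Proof.
have := cintegrable_meas (boxi_bexp_integral 0).1.
by congr cmeasurable; apply/funext => t; rewrite bexp0 mulr1.
Qed.

Lemma boxi_bcm : bcm (boxi a L).
Proof. by split; [exact: boxi_cmeasurable|exists 1 => t; exact: boxi_le1]. Qed.

Lemma boxi_sqint : sqint leb (boxi a L).
Proof.
split; first exact: boxi_cmeasurable.
have [[ci _] _] := boxi_bexp_integral 0.
move: ci; congr (_.-integrable _ _); apply/funext => t; congr EFin.
by rewrite bexp0 mulr1 boxiE; case: ifP => _; rewrite ?nc1 ?nc0 ?expr1n ?expr0n.
Qed.

Definition box_scale : R := (Num.sqrt ((2 * L) ^+ n))^-1.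

Let scale_gt0 : 0 < box_scale.
Proof. by rewrite invr_gt0 sqrtr_gt0 exprn_gt0// mulr_gt0. Qed.

Let scale2 : box_scale ^+ 2 * (2 * L) ^+ n = 1.
Proof.
rewrite /box_scale exprVn sqr_sqrtr ?mulVf ?exprn_ge0 ?mulr_ge0 ?(ltW L0)//.
by rewrite expf_neq0// mulf_neq0// lt0r_neq0.
Qed.

Let bexp_sqint eta : sqint leb (fun t => (box_scale%:C%C * bexp L eta t) * boxi a L t).
Proof.
have [mb _] := bcmZ box_scale%:C%C (bexp_bcm L eta).
apply: (sqint_bndM mb _ boxi_sqint) => t.
by rewrite ncM nc_bexp mulr1.
Qed.

Definition fourier_vec eta : V := L2Type (bexp_sqint eta).

Lemma fourier_vecE eta t :
  fourier_vec eta t = box_scale%:C%C * bexp L eta t * boxi a L t.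
Proof. by []. Qed.

Lemma orthonormal_fourier_vec : orthonormal ip xpredT fourier_vec.
Proof.
move=> eta eta' _ _; rewrite -[LHS]/(cintegral leb (fun t => fourier_vec eta t * (fourier_vec eta' t)^*)).
have e t : fourier_vec eta t * (fourier_vec eta' t)^* =
    (box_scale ^+ 2)%:C%C * (boxi a L t * bexp L (eta - eta') t).
  rewrite !fourier_vecE expr2 !rmorphM/= conj_bexp conj_boxi conj_realc bexpD.
  by rewrite -{3}(boxi_idem a L t); ring.
rewrite (@eq_cintegral _ _ _ leb _ _ e) cintegralZ; last exact: (boxi_bexp_integral _).1.
rewrite (boxi_bexp_integral _).2 subr_eq0; case: eqVneq => _; last by rewrite mulr0.
by rewrite -rmorphM scale2.
Qed.

(** The family does not see w outside the box; hence the test against functions cut off to the box,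
    which is the hypothesis that [fourier_expansion] asks for. *)
Lemma fourier_vec_total (w v : V) : (forall eta, ip w (fourier_vec eta) = 0) ->
  ip w (L2mul boxi_bcm v) = 0.
Proof.
move=> w0; pose h t := w t * (boxi a L t)^*.
have ch : cintegrable leb h by apply: sqint_prod; [exact: L2sq|exact: boxi_sqint].
have h0 : {ae leb, forall t, h t = 0}.
  apply: (@bexp_total _ _ L a h L0 ch) => [t tD|eta].
    by rewrite /h boxiE (negPf tD) conjcE /= oppr0 mulr0.
  have : box_scale%:C%C * cintegral leb (fun t => h t * bexp L eta t) = 0.
    rewrite -cintegralZ; last by apply: cintegrable_bcmM => //; exact: bexp_bcm.
    rewrite -[RHS](w0 (- eta)); apply: eq_cintegral => t.
    rewrite fourier_vecE !rmorphM/= conj_bexp opprK conj_realc /h; ring.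
  move/eqP; rewrite mulf_eq0 => /orP[/eqP s0|/eqP//].
  by have := scale_gt0; case: s0 => ->; rewrite ltxx.
rewrite -[LHS]/(cintegral leb (fun t => w t * (L2mul boxi_bcm v t)^*)) -(cintegral0 leb).
apply: cintegral_ae; [apply: sqint_prod; exact: L2sq| |].
  by split; exact: integrable0.
apply: filterS h0 => t; rewrite /h => e.
by rewrite -[L2mul _ _ _]/(boxi a L t * v t) rmorphM/= mulrA e mul0r.
Qed.

Lemma ip_boxi_fourier_vec (v : V) eta :
  ip (L2mul boxi_bcm v) (fourier_vec eta) = ip v (fourier_vec eta).
Proof.
apply: L2ip_eq => t; rewrite -[L2mul _ _ _]/(boxi a L t * v t) fourier_vecE.
rewrite !rmorphM/= conj_boxi -[in RHS](boxi_idem a L t); ring.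
Qed.

Lemma box_expansion (q : nat -> 'rV[int]_n) (v : V) : bijective q ->
  forall eps, 0 < eps -> exists N0, forall N, (N0 <= N)%N ->
  nrm (L2mul boxi_bcm v - \sum_(i < N) ip v (fourier_vec (q i)) *: fourier_vec (q i)) <= eps.
Proof.
move=> [q' qK q'K] eps eps0.
have ob : orthonormal ip xpredT (fun i => fourier_vec (q i)).
  by move=> i j _ _; rewrite orthonormal_fourier_vec// (can_eq qK).
have tot w : (forall i, ip w (fourier_vec (q i)) = 0) -> ip w (L2mul boxi_bcm v) = 0.
  by move=> w0; apply: fourier_vec_total => eta; rewrite -(q'K eta).
have [N0 NP] := fourier_expansion (@L2_complete _ _ _ leb) ob tot eps0.
exists N0 => N /NP; under eq_bigr do rewrite ip_boxi_fourier_vec.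
by [].
Qed.

End fourier_box.

(** * Discretization of the Weyl form *)

(** A bijection with [nat] lets lattice sums be truncated by an integer. It requires n > 0, the
    lattice being a point for n = 0. *)
Lemma int_row_enum n : (0 < n)%N -> exists q : nat -> 'rV[int]_n, bijective q.
Proof.
case: n => // n _.
have : ([set: 'rV[int]_n.+1] #= [set: nat])%card.
  rewrite card_eq_le; apply/andP; split; first exact: countableP.
  apply/infiniteP => fin; apply: infinite_nat.
  rewrite -(preimage_setT (fun k : nat => const_mx k%:Z : 'rV[int]_n.+1)).
  apply: finite_preimage fin.
  by move=> i j _ _ /rowP/(_ ord0); rewrite !mxE => -[].
move=> /card_set_bijP[f]; rewrite setTT_bijective => -[g fK gK].
by exists g; exists f.
Qed.

Section main.
Context {R : realType} (n : nat).
Local Notation leb := (rV_lebesgue (R := R) n).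
Local Notation V := (L2type leb).
Local Notation ip := (L2ip leb).
Local Notation nrm := (nrm ip).
Local Notation nrm2 := (nrm2 ip).
Local Notation phase := ('rV[R]_n * 'rV[R]_n)%type.
Implicit Types (x xi t a : 'rV[R]_n) (y eta : 'rV[int]_n) (z : phase) (e f : V).

Lemma dotvDl x t xi : dotv (x + t) xi = dotv x xi + dotv t xi.
Proof. by rewrite /dotv -big_split; apply: eq_bigr => j _; rewrite mxE mulrDl. Qed.

Lemma dotvC x t : dotv x t = dotv t x.
Proof. by apply: eq_bigr => j _; rewrite mulrC. Qed.

Lemma dotvZl (c : R) x t : dotv (c *: x) t = c * dotv x t.
Proof. by rewrite /dotv mulr_sumr; apply: eq_bigr => j _; rewrite mxE mulrA. Qed.

Lemma dotvBl x t xi : dotv (x - t) xi = dotv x xi - dotv t xi.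
Proof. by rewrite dotvDl -scaleN1r dotvZl mulN1r. Qed.

Definition floor_row t : 'rV[int]_n := \row_j Num.floor (t ord0 j).
Definition cube y t : R[i] := (floor_row t == y)%:R.
Definition int_row y : 'rV[R]_n := map_mx intr y.

Lemma cubeP y t j : floor_row t = y -> 0 <= t ord0 j - int_row y ord0 j < 1.
Proof.
move=> <-; rewrite !mxE; have := floor_itv (t ord0 j); rewrite intrD => /andP[h1 h2].
by apply/andP; split; lra.
Qed.

Lemma measurable_cube y : measurable [set t | floor_row t == y].
Proof.
rewrite (_ : [set _ | _] = \big[setI/setT]_(j < n)
    (rV_coord j @^-1` `[(y ord0 j)%:~R, (y ord0 j + 1)%:~R[)).
  apply: bigsetI_measurable => j _; rewrite -[X in measurable X]setTI.
  exact: measurable_rV_coord.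
rewrite -bigcap_seq; apply/seteqP; split => t /=.
  by move=> /eqP <- j _ /=; rewrite in_itv /= mxE floor_itv.
move=> h; apply/eqP/rowP => j; rewrite mxE.
by have := h j (mem_index_enum j); rewrite /= in_itv/= => /floor_def.
Qed.

Lemma cube_bcm y : bcm (cube y).
Proof.
split; last by exists 1 => t; rewrite /cube; case: eqP; rewrite ?nc1 ?nc0.
rewrite (_ : cube y = (fun t => (\1_[set t | floor_row t == y] t)%:C%C)).
  by apply: cmeasurable_real; apply: measurable_indic; exact: measurable_cube.
apply/funext => t; rewrite indicE /cube.
have -> : (t \in [set t | floor_row t == y]) = (floor_row t == y).
  by apply/idP/idP; rewrite inE.
by rewrite rmorph_nat.
Qed.

Variable q : nat -> 'rV[int]_n.
Hypothesis bq : bijective q.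

Lemma cube_sum Y t (F : nat -> R[i]) :
  \sum_(y < Y) cube (q y) t * F y = 0 \/
  exists2 y, (y < Y)%N & \sum_(y < Y) cube (q y) t * F y = F y.
Proof.
have [q' qK q'K] := bq.
case: (ltnP (q' (floor_row t)) Y) => h; [right|left].
  exists (q' (floor_row t)) => //; rewrite (bigD1 (Ordinal h))//= big1 ?addr0.
    by rewrite /cube q'K eqxx mul1r.
  move=> y ny; rewrite /cube; case: eqP => [e|]; last by rewrite mul0r.
  by move/eqP: ny => /=; case; apply: val_inj; rewrite /= e qK.
rewrite big1// => y _; rewrite /cube; case: eqP => [e|]; last by rewrite mul0r.
by move: h; rewrite e qK leqNgt ltn_ord.
Qed.

Lemma cube_sum_le f Y : \sum_(y < Y) nrm2 (L2mul (cube_bcm (q y)) f) <= nrm2 f.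
Proof.
have e : \sum_(y < Y) nrm2 (L2mul (cube_bcm (q y)) f) = nrm2 (\sum_(y < Y) L2mul (cube_bcm (q y)) f).
  have [q' qK q'K] := bq.
  rewrite /nrm2 ip_suml raddf_sum; apply: eq_bigr => y _.
  rewrite ip_sumr (bigD1 y)//= big1 ?addr0// => y' yy'.
  rewrite -(ip0l ip f); apply: L2ip_eq => t; rewrite /= /cube mul0r.
  case: eqP => [->|]; last by rewrite !mul0r.
  have ny : (y' == y :> nat) = false by exact: negPf yy'.
  by rewrite (can_eq qK) eq_sym ny mul0r conjcE /= oppr0 mulr0.
rewrite e -!sqr_nrm ler_pXn2r ?nnegrE ?nrm_ge0//.
apply: L2nrm_le => t; rewrite L2_sumE.
rewrite -[\sum_(y < Y) _]/(\sum_(y < Y) cube (q y) t * f t).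
by have [->|[y _ ->]] := cube_sum Y t (fun=> f t); rewrite ?nc0 ?nc_ge0.
Qed.

(** At a point t the remainder is 0 once the cube of t has been enumerated, and f dominates it. *)
Lemma cube_expansion f eps : 0 < eps -> exists Y0, forall Y, (Y0 <= Y)%N ->
  nrm (f - \sum_(y < Y) L2mul (cube_bcm (q y)) f) <= eps.
Proof.
move=> eps0; have [q' qK q'K] := bq.
pose r Y := f - \sum_(y < Y) L2mul (cube_bcm (q y)) f.
have rE Y t : r Y t = if (q' (floor_row t) < Y)%N then 0 else f t.
  rewrite -[LHS]/(f t - (\sum_(y < Y) L2mul (cube_bcm (q y)) f) t) L2_sumE.
  rewrite -[\sum_(y < Y) _]/(\sum_(y < Y) cube (q y) t * f t) -mulr_suml.
  case: ifPn => h.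
    rewrite (bigD1 (Ordinal h))//= big1 ?addr0.
      by rewrite /cube q'K eqxx mul1r subrr.
    move=> y ny; rewrite /cube; case: eqP => [e|//].
    by move/eqP: ny => /=; case; apply: val_inj; rewrite /= e qK.
  rewrite big1 ?mul0r ?subr0// => y _; rewrite /cube; case: eqP => [e|//].
  by move: h; rewrite e qK ltn_ord.
have [mf intf] := L2sq f.
have := @dominated_cvg _ _ _ leb setT measurableT (fun Y t => (nc (r Y t) ^+ 2)%:E) (cst 0%E)
  (fun t => (nc (f t) ^+ 2)%:E).
move=> /(_ _ _ _ intf _)/wrap[].
- by move=> Y; apply: measurable_nc2; case: (L2sq (r Y)).
- move=> t _; apply: (@cvg_trans _ (cst 0%E @ \oo)); last exact: cvg_cst.
  apply: near_eq_cvg; exists (q' (floor_row t)).+1 => // Y tY.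
  by rewrite rE ifT// nc0 expr0n.
- by [].
- move=> Y t _; rewrite gee0_abs ?lee_fin ?sqr_ge0// rE; case: ifP => // _.
  by rewrite nc0 expr0n sqr_ge0.
rewrite integral_cst// mul0e => cF.
have eps2 : 0 < eps ^+ 2 by exact: exprn_gt0.
have := cF (fun u : \bar R => (u < (eps ^+ 2)%:E)%E); case.
  by apply: open_nbhs_nbhs; split; [exact: open_ereal_lt_ereal|rewrite lte_fin].
move=> Y0 _ h; exists Y0 => Y YY0.
have /ltW : ((nrm2 (r Y))%:E < (eps ^+ 2)%:E)%E by rewrite L2nrm2_EFin; exact: h Y YY0.
rewrite lee_fin.
by rewrite -sqr_nrm ler_pXn2r ?nnegrE ?nrm_ge0// ltW.
Qed.

End main.

(** The reason for lam + 1 <= L: a point of a unit cube, translated by a vector with coordinates at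
    most lam, stays in the open box. *)
Lemma ltr_dist_shift (R : realFieldType) (lam L T Z Y : R) : lam + 1 <= L ->
  0 <= T - Y < 1 -> `|Z| <= lam -> `|T - Z - Y| < L.
Proof.
rewrite ler_norml ltr_norml => h /andP[h1 h2] /andP[h3 h4].
by apply/andP; split; lra.
Qed.

(** * The phase of the Schrodinger representation over a cube *)

Section approx.
Context {R : realType} (n : nat).
Local Notation leb := (rV_lebesgue (R := R) n).
Local Notation V := (L2type leb).
Local Notation ip := (L2ip leb).
Local Notation nrm := (nrm ip).
Local Notation phase := ('rV[R]_n * 'rV[R]_n)%type.
Implicit Types (x xi t a k l w : 'rV[R]_n) (y eta : 'rV[int]_n) (z : phase) (e f : V).
Local Notation int_row := (@int_row R n).
Implicit Types (p : (phase * 'rV[R]_n)%type) (lam L eps : R).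

Definition Psi p : R[i] := expi (2 * pi * dotv (p.2 - 2^-1 *: p.1.1) p.1.2).

(** As a function of z the first two terms form exp(-2 pi i sigma((k, l), z)): the signs match
    [symplectic], so that k and l become shifts of lattice points. *)
Definition fchr k l w p : R[i] :=
  expi (2 * pi * (dotv k p.1.2 - dotv l p.1.1 + dotv w p.2)).

Definition is_fchr (g : (phase * 'rV[R]_n)%type -> R[i]) :=
  exists k l w, g = fchr k l w.

Definition wbox lam : set (phase * 'rV[R]_n)%type :=
  [set p : (phase * 'rV[R]_n)%type | phase_box lam p.1 /\ forall j, `|p.2 ord0 j| <= 1].

Lemma dotv0l x : dotv 0 x = 0.
Proof. by rewrite -(scale0r x) dotvZl mul0r. Qed.

Lemma fchr1 : is_fchr (fun=> 1).
Proof.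
exists 0, 0, 0; apply/funext => p.
by rewrite /fchr !dotv0l subr0 addr0 mulr0 expi0.
Qed.

Lemma fchrM g h : is_fchr g -> is_fchr h -> is_fchr (fun p => g p * h p).
Proof.
move=> [k [l [w ->]]] [k' [l' [w' ->]]]; exists (k + k'), (l + l'), (w + w').
by apply/funext => p; rewrite /fchr -expiD !dotvDl; congr expi; ring.
Qed.

Lemma fchr_le1 g p : is_fchr g -> nc (g p) <= 1.
Proof. by move=> [k [l [w ->]]]; rewrite nc_expi. Qed.

Lemma dotv_delta (c : R) j x : dotv (c *: delta_mx ord0 j) x = c * x ord0 j.
Proof.
rewrite dotvZl /dotv (bigD1 j)//= big1 ?addr0; last first.
  by move=> i ij; rewrite !mxE (negPf ij) andbF mul0r.
by rewrite mxE !eqxx mul1r.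
Qed.

(** The combinations u_j and v_j, divided by 1 + lam, have modulus at most 1 on [wbox], so
    [wiener_coord] gives them mass 2. The phase of [Psi] is 2 pi (1 + lam)^2 times the sum of the
    u_j v_j, and [wiener_expi] concludes. The mass found depends on n and lam only. *)
Lemma Psi_wiener lam : 0 <= lam -> exists M, wiener is_fchr (wbox lam) M Psi.
Proof.
move=> lam0; set s := (1 + lam)^-1.
have s0 : 0 < s by rewrite invr_gt0; lra.
have sl : s * (1 + lam) = 1 by rewrite mulVf//; lra.
have pi0 := pi_gt0 R.
pose u (j : 'I_n) p := s * (p.2 ord0 j - 2^-1 * p.1.1 ord0 j).
pose v (j : 'I_n) p := s * p.1.2 ord0 j.
(* The frequency for which the factor 2 pi of [fchr] reproduces the scaling s. *)
pose c := s / (2 * pi).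
have c2 : 2 * pi * c = s by rewrite /c mulrC mulfVK// mulf_neq0// lt0r_neq0.
have ufchr (b : R) j p : fchr 0 ((b * c / 2) *: delta_mx ord0 j) ((b * c) *: delta_mx ord0 j) p = expi (b * u j p).
  rewrite /fchr dotv0l !dotv_delta /u -c2.
  by congr expi; ring.
have vfchr (b : R) j p : fchr ((b * c) *: delta_mx ord0 j) 0 0 p = expi (b * v j p).
  rewrite /fchr !dotv0l !dotv_delta /v -c2.
  by congr expi; ring.
have uW j : wiener is_fchr (wbox lam) 2 (fun p => (u j p)%:C%C).
  apply: (wiener_coord fchr1 fchrM fchr_le1).
  - by exists 0, ((1 * c / 2) *: delta_mx ord0 j), ((1 * c) *: delta_mx ord0 j); apply/funext => p; rewrite ufchr mul1r.
  - by exists 0, ((-1 * c / 2) *: delta_mx ord0 j), ((-1 * c) *: delta_mx ord0 j); apply/funext => p; rewrite ufchr mulN1r.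
  - move=> p [pb p2]; have [h1 _] := pb j; have h2 := p2 j.
    rewrite /u normrM (gtr0_norm s0) -[leRHS]sl ler_pM2l//.
    rewrite (le_trans (ler_normB _ _))// normrM ger0_norm ?invr_ge0//.
    lra.
have vW j : wiener is_fchr (wbox lam) 2 (fun p => (v j p)%:C%C).
  apply: (wiener_coord fchr1 fchrM fchr_le1).
  - by exists ((1 * c) *: delta_mx ord0 j), 0, 0; apply/funext => p; rewrite vfchr mul1r.
  - by exists ((-1 * c) *: delta_mx ord0 j), 0, 0; apply/funext => p; rewrite vfchr mulN1r.
  - move=> p [pb p2]; have [_ h1] := pb j.
    rewrite /v normrM (gtr0_norm s0) -[leRHS]sl ler_pM2l//; lra.
have W := wiener_sum fchr1 (index_enum 'I_n) (fun j => wiener_scale (2 * pi * (1 + lam) ^+ 2)%:C%C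
  (wienerM fchrM fchr_le1 (uW j) (vW j))).
exists (expR (\sum_(i : 'I_n) nc (2 * pi * (1 + lam) ^+ 2)%:C%C * (2 * 2))).
apply: (wiener_expi fchr1 fchrM fchr_le1).
apply: wiener_ext W => p _.
rewrite /dotv mulr_sumr rmorph_sum; apply: eq_bigr => j _.
rewrite -!rmorphM; congr (_%:C)%C; rewrite /u /v !mxE.
have -> : (2 * pi * (1 + lam) ^+ 2 * (s * (p.2 ord0 j - 2^-1 * p.1.1 ord0 j) * (s * p.1.2 ord0 j)) : R) =
  2 * pi * (s * (1 + lam)) ^+ 2 * ((p.2 ord0 j - 2^-1 * p.1.1 ord0 j) * p.1.2 ord0 j) by ring.
by rewrite sl expr1n mulr1.
Qed.

Lemma rho_phase z y t :
  expi (- pi * dotv z.1 z.2) * expi (2 * pi * dotv t z.2) =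
  expi (2 * pi * dotv (int_row y) z.2) * Psi (z, t - int_row y).
Proof.
by rewrite /Psi -!expiD !dotvBl dotvZl /=; congr expi; field.
Qed.

Lemma bexp_shift L eta t x : 0 < L -> bexp L eta (t - x) =
  bexp L eta t * expi (- (2 * pi * dotv ((2 * L)^-1 *: int_row eta) x)).
Proof.
move=> L0; rewrite /bexp -expiD; congr expi; rewrite dotvZl /dotv !mulr_sumr -sumrN -big_split/=.
by apply: eq_bigr => j _; rewrite !mxE; field; exact: lt0r_neq0.
Qed.

Definition modcube w y t : R[i] := expi (2 * pi * dotv w (t - int_row y)) * cube y t.

Lemma modcube_bcm w y : bcm (modcube w y).
Proof.
apply: bcmM; last exact: cube_bcm.
apply: bcm_expi; apply: measurable_funM; first exact: measurable_cst.
apply: measurable_dotv; first exact: measurable_cst.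
exact: measurable_rV_add.
Qed.

Lemma cube_conj y t : (cube y t : R[i])^* = cube y t.
Proof. by rewrite /cube conjcE; case: eqP => _ /=; rewrite oppr0. Qed.

Lemma ip_L2mul_cube e f y :
  ip e (L2mul (cube_bcm y) f) = ip (L2mul (cube_bcm y) e) f.
Proof.
by apply: L2ip_eq => t; rewrite /= rmorphM/= cube_conj mulrCA mulrA.
Qed.

Variables (lam L : R).
Hypotheses (lam0 : 0 <= lam) (L0 : 0 < L) (lamL : lam + 1 <= L).

Lemma boxi_cube z y t : phase_box lam z -> floor_row t = y ->
  boxi (int_row y) L (t - z.1) = 1 /\ boxi (int_row y) L t = 1.
Proof.
move=> zb ty; rewrite !boxiE; split; rewrite ifT//; apply/forallP => j;
have h := cubeP j ty.
  by have [hz _] := zb j; rewrite !mxE in h *; exact: ltr_dist_shift lamL h hz.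
by rewrite -[t ord0 j]subr0; apply: (ltr_dist_shift lamL h); rewrite normr0.
Qed.

Definition fvec y eta : V := fourier_vec (int_row y) L0 eta.
Definition hvec w y eta : V := L2mul (modcube_bcm w y) (fvec y eta).
Definition zeta y eta k l : phase :=
  (int_row y + k, (2 * L)^-1 *: int_row eta + l).

Lemma nrm_fvec y eta : nrm (fvec y eta) = 1.
Proof.
by rewrite /nrm /nrm2 (@orthonormal_fourier_vec _ _ (int_row y) L L0 eta eta)// eqxx /= sqrtr1.
Qed.

(** On the cube of y the box indicator equals 1 at t and at t - x, so [rho] multiplies the box
    exponential by a unimodular factor depending on z and by [Psi]. Replacing [Psi] by a sum of
    characters costs eps uniformly; their dependence on z goes into exp(-2 pi i sigma(zeta, z)) and
    their dependence on t into [hvec]. *)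
Lemma rho_fvec_approx (I : finType) (c : I -> R[i]) (k l w : I -> 'rV[R]_n) eps z y eta f :
  phase_box lam z -> 0 <= eps ->
  (forall p, wbox lam p -> nc (Psi p - \sum_i c i * fchr (k i) (l i) (w i) p) <= eps) ->
  nc (ip (L2rho z (fvec y eta)) (L2mul (cube_bcm y) f) -
      \sum_i c i * expi (- 2 * pi * symplectic (zeta y eta (k i) (l i)) z) *
        ip (hvec (w i) y eta) f) <= eps * nrm f.
Proof.
move=> zb eps0 Peps; rewrite ip_L2mul_cube.
have -> : \sum_i c i * expi (- 2 * pi * symplectic (zeta y eta (k i) (l i)) z) *
    ip (hvec (w i) y eta) f =
  ip (\sum_i (c i * expi (- 2 * pi * symplectic (zeta y eta (k i) (l i)) z)) *:
    hvec (w i) y eta) f.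
  by rewrite ip_suml; apply: eq_bigr => i _; rewrite ipZl.
rewrite -ipBl (le_trans (cauchy_schwarz _ _ _))// ler_wpM2r ?nrm_ge0//.
have -> : eps = nrm (eps%:C%C *: fvec y eta) by rewrite nrmZ nc_real ger0_norm// nrm_fvec mulr1.
apply: L2nrm_le => t.
set S := \sum_i _ *: _.
rewrite -[(_ - S) t]/(cube y t * (expi (- pi * dotv z.1 z.2) * expi (2 * pi * dotv t z.2) * fvec y eta (t - z.1)) - S t).
rewrite L2_sumE -[(_ *: fvec y eta) t]/(eps%:C%C * fvec y eta t) [nc (eps%:C%C * _)]ncM nc_real ger0_norm//.
under eq_bigr => i _ do rewrite -[(_ *: hvec (w i) y eta) t]/(c i * expi (- 2 * pi * symplectic (zeta y eta (k i) (l i)) z) * (modcube (w i) y t * fvec y eta t)).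
rewrite /modcube {1}/cube; case: eqP => [ty|nty]; last first.
  rewrite mul0r big1 ?subr0 ?nc0 ?mulr_ge0 ?nc_ge0// => i _.
  by rewrite /cube (introF eqP nty) !(mulr0, mul0r).
set y' := int_row y.
(* This is the symplectic character of the unshifted lattice point (y, eta / (2 L)). *)
pose th := expi (2 * pi * dotv y' z.2) * expi (- (2 * pi * dotv ((2 * L)^-1 *: int_row eta) z.1)).
have [b1 b2] := boxi_cube zb ty.
have e1 : expi (- pi * dotv z.1 z.2) * expi (2 * pi * dotv t z.2) * fvec y eta (t - z.1) =
    th * Psi (z, t - y') * fvec y eta t.
  rewrite (rho_phase z y) /fvec !fourier_vecE b1 b2 bexp_shift// /th; ring.
have e2 i : c i * expi (- 2 * pi * symplectic (zeta y eta (k i) (l i)) z) *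
    (expi (2 * pi * dotv (w i) (t - y')) * cube y t * fvec y eta t) =
    th * fvec y eta t * (c i * fchr (k i) (l i) (w i) (z, t - y')).
  rewrite /cube ty eqxx mulr1.
  have -> : expi (- 2 * pi * symplectic (zeta y eta (k i) (l i)) z) =
     th * expi (2 * pi * (dotv (k i) z.2 - dotv (l i) z.1)).
    rewrite /th -!expiD /symplectic /= (dotvC z.1) !dotvDl; congr expi; ring.
  rewrite /fchr [2 * pi * (_ + dotv (w i) _)]mulrDr [expi (_ + 2 * pi * dotv _ _)]expiD/=; ring.
rewrite e1 mul1r (eq_bigr _ (fun i _ => e2 i)) -mulr_sumr.
have nth : nc th = 1 by rewrite ncM !nc_expi mulr1.
rewrite mulrAC -mulrBr [nc (_ * (_ - _))]ncM [nc (th * _)]ncM nth mul1r mulrC ler_wpM2r ?nc_ge0//.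
apply: Peps; split => //= j.
have /andP[h1 h2] := cubeP j ty; rewrite !mxE; rewrite !mxE in h1 h2.
by rewrite ger0_norm// ltW.
Qed.

(** Seen from the cube of y, only the values of e in the box matter; this permits the use of its
    Fourier series there. *)
Lemma rho_cube_box z e f y : phase_box lam z ->
  ip (L2rho z e) (L2mul (cube_bcm y) f) =
  ip (L2rho z (L2mul (boxi_bcm (int_row y) L0) e)) (L2mul (cube_bcm y) f).
Proof.
move=> zb; apply: L2ip_eq => t.
rewrite -[L2rho z e t]/(expi (- pi * dotv z.1 z.2) * expi (2 * pi * dotv t z.2) * e (t - z.1)).
rewrite -[L2rho z _ t]/(expi (- pi * dotv z.1 z.2) * expi (2 * pi * dotv t z.2) * (boxi (int_row y) L (t - z.1) * e (t - z.1))).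
rewrite -[L2mul _ _ t]/(cube y t * f t) /cube; case: eqP => [ty|_].
  by rewrite (boxi_cube zb ty).1 !mul1r.
by rewrite mul0r rmorph0 !mulr0.
Qed.

End approx.

Lemma eventually_all (I : finType) (P : I -> nat -> Prop) :
  (forall i, exists N0, forall N, (N0 <= N)%N -> P i N) -> exists N, forall i, P i N.
Proof.
move=> /choice[g gP]; exists (\max_i g i)%N => i.
by apply: gP; exact: leq_bigmax.
Qed.

(** * Finite sums approximating the Weyl form *)

Section weyl_approx.
Context {R : realType} (n : nat).
Local Notation leb := (rV_lebesgue (R := R) n).
Local Notation V := (L2type leb).
Local Notation ip := (L2ip leb).
Local Notation nrm := (nrm ip).
Local Notation phase := ('rV[R]_n * 'rV[R]_n)%type.
Implicit Types (z : phase).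

Lemma L2rho_sub z (u : V) (N : nat) (a : nat -> R[i]) (v : nat -> V) :
  L2rho z (u - \sum_(j < N) a j *: v j) =
  L2rho z u - \sum_(j < N) a j *: L2rho z (v j).
Proof.
apply: L2eq => t; set S := \sum_(j < N) a j *: v j; set S' := \sum_(j < N) _ *: L2rho _ _.
rewrite -[LHS]/(expi (- pi * dotv z.1 z.2) * expi (2 * pi * dotv t z.2) * (u (t - z.1) - S (t - z.1))).
rewrite -[RHS]/(expi (- pi * dotv z.1 z.2) * expi (2 * pi * dotv t z.2) * u (t - z.1) - S' t).
rewrite mulrBr /S /S' !L2_sumE; set ph := expi _ * expi _; rewrite mulr_sumr; congr (_ - _); apply: eq_bigr => j _.
rewrite -[(a j *: v j) _]/(a j * v j (t - z.1)).
rewrite -[(a j *: L2rho z (v j)) t]/(a j * (ph * v j (t - z.1))).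
exact: mulrCA.
Qed.

Lemma symplectic_bcm (ze : phase) : bcm (fun z => expi (- 2 * pi * symplectic ze z)).
Proof.
apply: bcm_expi; apply: measurable_funM; first exact: measurable_cst.
apply: measurable_funB; apply: measurable_dotv; try exact: measurable_cst.
  exact: measurable_fst.
exact: measurable_snd.
Qed.

Variables (mu : complex_measure phase R) (lam L M0 : R) (q : nat -> 'rV[int]_n).
Hypotheses (lam0 : 0 <= lam) (L0 : 0 < L) (lamL : lam + 1 <= L).
Hypothesis muK : forall B, measurable B -> B `<=` ~` phase_box lam ->
  cm_Re mu B = 0%E /\ cm_Im mu B = 0%E.
Hypothesis bq : bijective q.
Hypothesis W : wiener (@is_fchr R n) (wbox lam) M0 (@Psi R n).
Local Notation fvec y j := (fvec L0 (q y) (q j)).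
Local Notation hvec w y j := (hvec L0 w (q y) (q j)).
Local Notation zeta y j k l := (zeta L (q y) (q j) k l).

(** Three errors are made under the integral: truncation of the cubes for f, truncation of the
    Fourier series of e on each box, and approximation of [Psi]. They are chosen in this order
    because each tolerance is divided by the number of terms fixed before it. The mass M0 does not
    depend on eps. *)
Lemma weyl_form_approx K (e f : 'I_K -> V) eps :
  (forall kk, nrm (e kk) = 1) -> (forall kk, nrm (f kk) = 1) -> 0 < eps ->
  exists (Y N : nat) (I : finType) (c : I -> R[i]) (k l w : I -> 'rV[R]_n),
    \sum_i nc (c i) <= M0 /\
    forall kk, nc (weyl_form mu (e kk) (f kk) -
      \sum_i \sum_(s : 'I_Y * 'I_N) c i *
        (ip (e kk) (fvec s.1 s.2) * ip (hvec (w i) s.1 s.2) (f kk)) *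
        symplectic_fourier mu (zeta s.1 s.2 (k i) (l i))) <= eps.
Proof.
move=> e1 f1 eps0.
have [M M0' MP] := cm_integral_le (measurable_phase_box lam) muK.
pose del := eps / (M + 1).
have del0 : 0 < del by rewrite divr_gt0//; lra.
have del3 : 0 < del / 3 by rewrite divr_gt0.
have [Y YP] := eventually_all (fun kk => cube_expansion bq (f kk) del3).
(* Each of the Y cubes contributes two errors of size de2, one for the Fourier series and one for
   [Psi]. *)
pose de2 := del / 3 / Y.+1%:R.
have de20 : 0 < de2 by rewrite divr_gt0.
have [N NP] := eventually_all (fun ky : 'I_K * 'I_Y =>
  box_expansion (int_row (q ky.2)) L0 (e ky.1) bq de20).
pose de3 := de2 / N.+1%:R.
have de30 : 0 < de3 by rewrite divr_gt0.
have [I [c [g [gc cM gP]]]] := W de30.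
have /choice[k /choice[l /choice[w gE]]] := gc.
have gP' p : wbox lam p -> nc (Psi p - \sum_i c i * fchr (k i) (l i) (w i) p) <= de3.
  by move=> /gP; under eq_bigr do rewrite gE.
exists Y, N, I, c, k, l, w; split => // kk.
pose chi i (s : 'I_Y * 'I_N) z := expi (- 2 * pi * symplectic (zeta s.1 s.2 (k i) (l i)) z).
pose b i (s : 'I_Y * 'I_N) := c i * (ip (e kk) (fvec s.1 s.2) * ip (hvec (w i) s.1 s.2) (f kk)).
pose A z := \sum_i \sum_s b i s * chi i s z.
have bchi i s : bcm (fun z => b i s * chi i s z) by apply: bcmZ; exact: symplectic_bcm.
have bA : bcm A by apply: bcm_sum => i; exact: bcm_sum.
have -> : \sum_i \sum_(s : 'I_Y * 'I_N) c i *
    (ip (e kk) (fvec s.1 s.2) * ip (hvec (w i) s.1 s.2) (f kk)) *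
    symplectic_fourier mu (zeta s.1 s.2 (k i) (l i)) = cm_integral mu A.
  rewrite cm_integral_sum; last by move=> i; exact: bcm_sum.
  apply: eq_bigr => i _; rewrite cm_integral_sum//; apply: eq_bigr => s _.
  by rewrite cm_integralZ//; exact: symplectic_bcm.
rewrite /weyl_form -cm_integralB//; last exact: bcm_ip_rho.
apply: le_trans (_ : M * del <= _); last first.
  by rewrite /del mulrA ler_pdivrMr; [nra|lra].
apply: MP; [apply: bcmD; [exact: bcm_ip_rho|exact: bcmN]|exact: ltW|].
move=> z zb.
pose Fy (y : nat) := L2mul (cube_bcm (q y)) (f kk).
have nFy y : nrm (Fy y) <= 1.
  rewrite -(f1 kk) -[leRHS]mul1r; apply: nrm_L2mul => // t.
  by rewrite /cube; case: eqP; rewrite ?nc1 ?nc0.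
have nRho (u v : V) : nc (ip (L2rho z u) v) <= nrm u * nrm v.
  by rewrite (le_trans (cauchy_schwarz _ _ _))// ler_wpM2r ?nrm_ge0// nrm_L2rho.
have one_y (y : 'I_Y) : nc (ip (L2rho z (e kk)) (Fy y) -
    \sum_(j < N) \sum_i b i (y, j) * chi i (y, j) z) <= 2 * de2.
  pose a j := ip (e kk) (fvec y j).
  have a1 j : nc (a j) <= 1.
    by rewrite (le_trans (cauchy_schwarz _ _ _))// e1 nrm_fvec mulr1.
  pose T := \sum_(j < N) a j * ip (L2rho z (fvec y j)) (Fy y).
  rewrite -[X in nc X](subrKA T) (le_trans (ncD _ _))//.
  have -> : 2 * de2 = de2 + de2 by ring.
  apply: lerD.
    rewrite /Fy (rho_cube_box lam0 L0 lamL (e kk) (f kk) (q y) zb) -/(Fy y).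
    have -> : T = ip (\sum_(j < N) a j *: L2rho z (fvec y j)) (Fy y).
      by rewrite ip_suml; apply: eq_bigr => j _; rewrite ipZl.
    rewrite -ipBl -(@L2rho_sub z _ N a (fun j => fvec y j)) (le_trans (nRho _ _))// -[leRHS]mulr1.
    by apply: ler_pM; rewrite ?nrm_ge0//; exact: (NP (kk, y)).
  rewrite /T -sumrB (le_trans (nc_sum _ _ _))//.
  apply: le_trans (_ : \sum_(j < N) de3 <= _); last first.
    rewrite sumr_const card_ord -mulr_natr /de3 mulrAC ler_pdivrMr//.
    by rewrite ler_pM2l// ler_nat.
  apply: ler_sum => j _.
  have -> : \sum_i b i (y, j) * chi i (y, j) z = a j * \sum_i c i * chi i (y, j) z * ip (hvec (w i) y j) (f kk).
    by rewrite mulr_sumr; apply: eq_bigr => i _; rewrite /b /a /=; ring.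
  rewrite -mulrBr ncM -[leRHS]mul1r ler_pM ?nc_ge0//.
  rewrite -[leRHS]mulr1 -(f1 kk).
  exact: (rho_fvec_approx lam0 L0 lamL (q y) (q j) (f kk) zb (ltW de30) gP').
rewrite -[ip _ _](subrK (ip (L2rho z (e kk)) (\sum_(y < Y) Fy y))) -ipBr -addrA.
rewrite (le_trans (ncD _ _))//.
have -> : del = del / 3 + 2 * (del / 3) by field.
apply: lerD.
  by rewrite (le_trans (nRho _ _))// e1 mul1r.
have -> : A z = \sum_(y < Y) \sum_(j < N) \sum_i b i (y, j) * chi i (y, j) z.
  by rewrite pair_big /A exchange_big /=; apply: eq_bigr => -[y j] _.
rewrite ip_sumr -sumrB (le_trans (nc_sum _ _ _))//.
apply: le_trans (ler_sum _ (fun y _ => one_y y)) _.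
rewrite sumr_const card_ord -(mulr_natr (2 * de2)) -mulrA ler_pM2l//.
by rewrite /de2 mulrAC ler_pdivrMr// ler_pM2l// ler_nat.
Qed.

End weyl_approx.

(** * Bessel inequalities and decay over the lattice *)

Section bessel_bounds.
Context {R : realType} (n : nat).
Local Notation leb := (rV_lebesgue (R := R) n).
Local Notation V := (L2type leb).
Local Notation ip := (L2ip leb).
Local Notation nrm := (nrm ip).
Local Notation nrm2 := (nrm2 ip).
Local Notation phase := ('rV[R]_n * 'rV[R]_n)%type.
Local Notation int_row := (@int_row R n).
Variables (L : R) (q : nat -> 'rV[int]_n).
Hypotheses (L0 : 0 < L) (bq : bijective q).
Local Notation fvec y j := (fvec L0 (q y) (q j)).
Local Notation hvec w y j := (hvec L0 w (q y) (q j)).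
Local Notation qzeta y j k l := (zeta L (q y) (q j) k l).

Lemma sum_enum (F : 'rV[int]_n -> R) Y :
  \sum_(y < Y) F (q y) = \sum_(v <- [seq q y | y <- iota 0 Y]) F v.
Proof. by rewrite big_map big_iota0. Qed.

Lemma uniq_enum Y : uniq [seq q y | y <- iota 0 Y].
Proof. by rewrite map_inj_uniq ?iota_uniq//; exact: bij_inj. Qed.

(** The indicator of a box is at most the product of the (1 + L)^2 (1 + |i - t_l|)^(-2), so the
    lattice sums bound the number of boxes over a point without counting. *)
Lemma box_overlap : exists2 B : R, 0 <= B & forall Y t,
  \sum_(y < Y) nc (boxi (int_row (q y)) L t) <= B.
Proof.
have [B1 B10 B1P] := @lattice_sum1 R 1 2 ltr01 (lexx 1) (ltr1n R 2).
have L1 : 1 <= 1 + L by rewrite lerDl ltW.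
pose B := (1 + L) `^ 2 * B1.
have B0 : 0 <= B by rewrite mulr_ge0 ?powR_ge0.
exists (B ^+ n) => [|Y t]; first exact: exprn_ge0.
pose g l (i : int) : R := if `|t ord0 l - i%:~R| < L then 1 else 0.
have e (v : 'rV[int]_n) : nc (boxi (int_row v) L t) = \prod_l g l (v ord0 l).
  rewrite /boxi nc_prod; apply: eq_bigr => l _; rewrite /ival /g mxE.
  by case: ifP; rewrite ?nc1 ?nc0.
rewrite (sum_enum (fun v => nc (boxi (int_row v) L t))).
under eq_bigr do rewrite e.
apply: lattice_sum_prod; first exact: uniq_enum.
  by move=> l i; rewrite /g; case: ifP.
move=> l s us.
apply: le_trans (_ : \sum_(i <- s) (1 + L) `^ 2 * (1 + `|1 * i%:~R + - t ord0 l|) `^ (- 2) <= _).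
  apply: ler_sum => i _; rewrite /g; case: ifPn => h; last by rewrite mulr_ge0 ?powR_ge0.
  rewrite powRN ler_pdivlMr ?powR_gt0 ?ltr_wpDr// !mul1r ge0_ler_powR ?nnegrE//.
    by rewrite addr_ge0// ltW.
  by rewrite lerD2l distrC ltW.
by rewrite -mulr_sumr ler_wpM2l ?powR_ge0//; exact: B1P.
Qed.

(** Box indicators are idempotent, so the sum of the square norms is the pairing of e with its
    product by the sum of the indicators, and this multiplier is at most B. *)
Lemma box_sum_le B e Y : 0 <= B ->
  (forall t, \sum_(y < Y) nc (boxi (int_row (q y)) L t) <= B) ->
  \sum_(y < Y) nrm2 (L2mul (boxi_bcm (int_row (q y)) L0) e) <= B * nrm2 e.
Proof.
move=> B0 BP; set g := fun y : nat => L2mul (boxi_bcm (int_row (q y)) L0) e.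
have -> : \sum_(y < Y) nrm2 (g y) = complex.Re (ip (\sum_(y < Y) g y) e).
  rewrite ip_suml raddf_sum; apply: eq_bigr => y _; congr complex.Re.
  apply: L2ip_eq => t; rewrite -[g y t]/(boxi (int_row (q y)) L t * e t).
  by rewrite rmorphM/= conj_boxi -[in RHS]boxi_idem; ring.
apply: le_trans (Re_le_nc _) _; apply: le_trans (cauchy_schwarz _ _ _) _.
rewrite -sqr_nrm expr2 mulrA ler_wpM2r ?nrm_ge0//.
have -> : B * nrm e = nrm (B%:C%C *: e) by rewrite nrmZ nc_real ger0_norm.
apply: L2nrm_le => t; rewrite L2_sumE -[(_ *: e) t]/(B%:C%C * e t).
rewrite -[\sum_(y < Y) _]/(\sum_(y < Y) boxi (int_row (q y)) L t * e t).
rewrite -mulr_suml !ncM ler_wpM2r ?nc_ge0// nc_real ger0_norm//.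
exact: le_trans (nc_sum _ _ _) (BP t).
Qed.

(** Orthonormality holds inside each box, but the boxes overlap: the constant is the overlap B. *)
Lemma fvec_bessel B e Y N : 0 <= B ->
  (forall t, \sum_(y < Y) nc (boxi (int_row (q y)) L t) <= B) ->
  \sum_(s : 'I_Y * 'I_N) nc (ip e (fvec s.1 s.2)) ^+ 2 <= B * nrm2 e.
Proof.
move=> B0 BP; apply: le_trans (box_sum_le e B0 BP).
rewrite -(pair_big xpredT xpredT (fun (y : 'I_Y) (j : 'I_N) => nc (ip e (fvec y j)) ^+ 2)).
apply: ler_sum => y _.
have eE j : ip e (fvec y j) = ip (L2mul (boxi_bcm (int_row (q y)) L0) e) (fvec y j).
  by rewrite [RHS]ip_boxi_fourier_vec.
under eq_bigr do rewrite eE.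
apply: (@bessel _ _ ip _ (index_enum 'I_N) xpredT (fun j : 'I_N => fvec y j)) => //.
  exact: index_enum_uniq.
move=> i j _ _; rewrite orthonormal_fourier_vec//.
by rewrite (inj_eq (bij_inj bq)).
Qed.

Lemma conj_modcube (w : 'rV[R]_n) y (t : 'rV[R]_n) : (modcube w y t)^* = modcube (- w) y t.
Proof.
rewrite /modcube rmorphM/= cube_conj conj_expi -(scaleN1r w) dotvZl; congr (expi _ * _); ring.
Qed.

(** The cubes are disjoint, so the constant is 1. Modulation and cut-off are moved to f, which
    leaves the orthonormal family of a box. *)
Lemma hvec_bessel f (w : 'rV[R]_n) Y N :
  \sum_(s : 'I_Y * 'I_N) nc (ip (hvec w s.1 s.2) f) ^+ 2 <= nrm2 f.
Proof.
apply: le_trans (cube_sum_le bq f Y).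
rewrite -(pair_big xpredT xpredT (fun (y : 'I_Y) (j : 'I_N) => nc (ip (hvec w y j) f) ^+ 2)).
apply: ler_sum => y _.
pose g := L2mul (modcube_bcm (- w) (q y)) f.
have e j : nc (ip (hvec w y j) f) = nc (ip g (fvec y j)).
  rewrite sip_conj ncJ; congr nc; apply: L2ip_eq => t.
  rewrite -[g t]/(modcube (- w) (q y) t * f t) -conj_modcube.
  rewrite -[hvec w y j t]/(modcube w (q y) t * fvec y j t) rmorphM/=; ring.
under eq_bigr do rewrite e.
apply: le_trans (_ : nrm2 g <= _).
  apply: (@bessel _ _ ip _ (index_enum 'I_N) xpredT (fun j : 'I_N => fvec y j)) => //.
    exact: index_enum_uniq.
  move=> i j _ _; rewrite orthonormal_fourier_vec//.
  by rewrite (inj_eq (bij_inj bq)).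
rewrite -!sqr_nrm ler_pXn2r ?nnegrE ?nrm_ge0//; apply: L2nrm_le => t.
rewrite -[g t]/(modcube (- w) (q y) t * f t) -[L2mul _ _ t]/(cube (q y) t * f t).
by rewrite /modcube !ncM nc_expi mul1r.
Qed.

Lemma nrm2_hvec (w : 'rV[R]_n) y j : nrm2 (hvec w y j) <= 1.
Proof.
have -> : 1 = nrm2 (fvec y j) by rewrite -sqr_nrm nrm_fvec expr1n.
rewrite -!sqr_nrm ler_pXn2r ?nnegrE ?nrm_ge0//; apply: L2nrm_le => t.
rewrite -[hvec w y j t]/(modcube w (q y) t * fvec y j t) ncM ler_piMl ?nc_ge0//.
by rewrite /modcube ncM nc_expi mul1r /cube; case: eqP; rewrite ?nc1 ?nc0.
Qed.

Lemma phase_norm_ge (z : phase) j :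
  `|z.1 ord0 j| <= phase_norm z /\ `|z.2 ord0 j| <= phase_norm z.
Proof.
have h (x : 'rV[R]_n) : 0 <= dotv x x by apply: sumr_ge0 => i _; rewrite -expr2 sqr_ge0.
have hx (x : 'rV[R]_n) : x ord0 j ^+ 2 <= dotv x x.
  rewrite /dotv (bigD1 j)//= -expr2 lerDl; apply: sumr_ge0 => i _.
  by rewrite -expr2 sqr_ge0.
by split; rewrite -sqrtr_sqr ler_wsqrtr//; [apply: ler_wpDr|apply: ler_wpDl].
Qed.

(** The decay is shared equally by the 2 n coordinates, each receiving the exponent s = r / (2 n) >
    1. The bound is uniform in the shifts k and l; the condition 1 <= 2 * L makes the spacing 1 / (2
    L) at most 1. *)
Lemma lattice_decay r : (0 < n)%N -> 1 <= 2 * L -> 2 * n%:R < r ->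
  exists2 D : R, 0 <= D & forall Y N k l,
  \sum_(s : 'I_Y * 'I_N) (1 + phase_norm (qzeta s.1 s.2 k l)) `^ (- r) <= D.
Proof.
move=> n0 L1 hr.
have n0' : 0 < 2 * n%:R :> R by rewrite mulr_gt0 ?ltr0n.
pose s := r / (2 * n%:R).
have s1 : 1 < s by rewrite ltr_pdivlMr// mul1r.
have s0 : 0 <= s by rewrite ltW// (lt_trans _ s1).
have [B1 B10 B1P] := @lattice_sum1 R 1 s ltr01 (lexx 1) s1.
have k0 : 0 < (2 * L)^-1 by rewrite invr_gt0 mulr_gt0.
have k1 : (2 * L)^-1 <= 1 by rewrite invf_le1// mulr_gt0.
have [B2 B20 B2P] := lattice_sum1 k0 k1 s1.
exists (B1 ^+ n * B2 ^+ n) => [|Y N k l]; first by rewrite mulr_ge0 ?exprn_ge0.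
pose g1 j (i : int) := (1 + `|1 * i%:~R + k ord0 j|) `^ (- s).
pose g2 j (i : int) := (1 + `|(2 * L)^-1 * i%:~R + l ord0 j|) `^ (- s).
have main (y eta : 'rV[int]_n) : (1 + phase_norm (zeta L y eta k l)) `^ (- r) <=
    (\prod_j g1 j (y ord0 j)) * (\prod_j g2 j (eta ord0 j)).
  set P := phase_norm _; have P0 : 0 <= P by exact: sqrtr_ge0.
  have -> : (1 + P) `^ (- r) = (\prod_(j < n) (1 + P) `^ (- s)) * (\prod_(j < n) (1 + P) `^ (- s)).
    rewrite !prodr_const card_ord -exprD -powR_mulrn ?powR_ge0// -powRrM.
    congr (_ `^ _); rewrite /s addnn -mul2n natrM; field.
    by rewrite pnatr_eq0 -lt0n.
  have mono x : 0 <= x -> x <= P -> (1 + P) `^ (- s) <= (1 + x) `^ (- s).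
    move=> x0 xP; rewrite !powRN lef_pV2 ?posrE ?powR_gt0 ?ltr_wpDr//.
    by rewrite ge0_ler_powR ?nnegrE ?addr_ge0 ?lerD2l.
  apply: ler_pM; try (by apply: prodr_ge0 => j _; exact: powR_ge0);
  apply: ler_prod => j _; rewrite powR_ge0/=; apply: mono => //.
    by have [+ _] := phase_norm_ge (zeta L y eta k l) j; rewrite /= !mxE mul1r.
  by have [_] := phase_norm_ge (zeta L y eta k l) j; rewrite /= !mxE.
apply: le_trans (ler_sum _ (fun s _ => main _ _)) _.
rewrite -(pair_big xpredT xpredT (fun (y : 'I_Y) (j : 'I_N) =>
  (\prod_i g1 i (q y ord0 i)) * (\prod_i g2 i (q j ord0 i))))/=.
under eq_bigr do rewrite -mulr_sumr.
rewrite -mulr_suml (sum_enum (fun v => \prod_i g1 i (v ord0 i))).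
rewrite (sum_enum (fun v => \prod_i g2 i (v ord0 i))).
apply: ler_pM.
- by apply: sumr_ge0 => v _; apply: prodr_ge0 => j _; exact: powR_ge0.
- by apply: sumr_ge0 => v _; apply: prodr_ge0 => j _; exact: powR_ge0.
- apply: lattice_sum_prod; [exact: uniq_enum|by move=> *; exact: powR_ge0|].
  by move=> j t ut; exact: B1P.
- apply: lattice_sum_prod; [exact: uniq_enum|by move=> *; exact: powR_ge0|].
  by move=> j t ut; exact: B2P.
Qed.

End bessel_bounds.

(** * The Schatten estimate *)

Lemma powRD_le {R : realType} (x y p : R) : 1 <= p -> 0 <= x -> 0 <= y ->
  (x + y) `^ p <= 2 `^ (p - 1) * (x `^ p + y `^ p).
Proof.
move=> p1 x0 y0.
have := @jensen_powR R bool (fun=> 1) (fun b => if b then x else y) p 2 p1.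
rewrite !big_bool !mul1r; apply => //; by case.
Qed.

Lemma half_exponent_lt {R : realFieldType} (b m p : R) : 0 < b ->
  4 * m / b < p -> 2 * m < b / 2 * p.
Proof. by move=> b0; rewrite ltr_pdivrMr// => h; lra. Qed.

Section schatten_estimate.
Context {R : realType} (n : nat).
Local Notation leb := (rV_lebesgue (R := R) n).
Local Notation V := (L2type leb).
Local Notation ip := (L2ip leb).
Local Notation phase := ('rV[R]_n * 'rV[R]_n)%type.
Variables (mu : complex_measure phase R) (lam beta C : R).
Hypotheses (n0 : (0 < n)%N) (lam0 : 0 <= lam) (beta0 : 0 < beta) (C0 : 0 < C).
Hypothesis muK : forall B, measurable B -> B `<=` ~` phase_box lam ->
  cm_Re mu B = 0%E /\ cm_Im mu B = 0%E.
Hypothesis decay : forall zeta : phase,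
  nc (symplectic_fourier mu zeta) <= C * (1 + phase_norm zeta) `^ (- (beta / 2)).

(** On the lattice |a|^p decays with exponent p beta / 2, which exceeds 2 n exactly when p > 4 n /
    beta. The constants of the approximation, of Bessel and of the lattice sum depend neither on N
    nor on the families. *)
Lemma weyl_form_summable p : 1 <= p -> 4 * n%:R / beta < p ->
  exists M, forall N (e f : nat -> V), orth ip N e -> orth ip N f ->
    \sum_(k < N) nc (weyl_form mu (e k) (f k)) `^ p <= M.
Proof.
move=> p1 hp; have [q bq] := int_row_enum n0.
have [M0 W] := @Psi_wiener R n lam lam0.
have p0 : 0 <= p by exact: le_trans p1.
pose L := lam + 1; have L0 : 0 < L by rewrite ltr_wpDl.
have L1 : 1 <= 2 * L by rewrite mulrDr mulr1 -[leLHS]add0r lerD ?mulr_ge0 ?ler1n.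
have M00 : 0 <= M0 := wiener_ge0 W.
have hr : 2 * n%:R < beta / 2 * p.
  exact: half_exponent_lt.
have [D0 D00 DP] := lattice_decay L0 bq n0 L1 hr.
have [B0 B00 BP] := box_overlap L0 bq.
(* One constant for the four Bessel bounds: the overlap B0 for the box family, 1 for the others. *)
pose B := Num.max B0 1; pose D := C `^ p * D0.
have B_ge1 : 1 <= B by rewrite le_max lexx orbT.
have D_ge0 : 0 <= D by rewrite mulr_ge0 ?powR_ge0.
exists (2 `^ (p - 1) * ((M0 * B) `^ (p - 1) * (M0 * (B * D)) + 1)).
move=> N e f oe of'.
have nrm1 (g : nat -> V) : orth ip N g -> forall k : 'I_N, nrm2 ip (g k) = 1.
  by move=> og k; rewrite /nrm2 og ?unfold_in//= eqxx.
(* The N errors eps^p <= eps add up to at most 1, whatever N is. *)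
pose eps : R := N.+1%:R^-1.
have eps0 : 0 < eps by rewrite invr_gt0.
have [Y [N' [I [c [k [l [w [cM appr]]]]]]]] := @weyl_form_approx R n mu lam L M0 q lam0 L0 (lexx _) muK bq W
  N (fun kk => e kk) (fun kk => f kk) eps
  (fun kk => etrans (congr1 Num.sqrt (nrm1 e oe kk)) (sqrtr1 R))
  (fun kk => etrans (congr1 Num.sqrt (nrm1 f of' kk)) (sqrtr1 R)) eps0.
pose al (s : 'I_Y * 'I_N') (kk : 'I_N) := nc (ip (e kk) (fvec L0 (q s.1) (q s.2))).
pose be (i : I) (s : 'I_Y * 'I_N') (kk : 'I_N) := nc (ip (hvec L0 (w i) (q s.1) (q s.2)) (f kk)).
pose a (i : I) (s : 'I_Y * 'I_N') := nc (symplectic_fourier mu (zeta L (q s.1) (q s.2) (k i) (l i))).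
pose S kk := \sum_i \sum_s nc (c i) * (al s kk * be i s kk) * a i s.
have S0 kk : 0 <= S kk.
  by apply: sumr_ge0 => i _; apply: sumr_ge0 => s _; rewrite !mulr_ge0 ?nc_ge0.
have wS (kk : 'I_N) : nc (weyl_form mu (e kk) (f kk)) <= S kk + eps.
  rewrite -[weyl_form _ _ _](subrK (\sum_i \sum_(s : 'I_Y * 'I_N') c i *
    (ip (e kk) (fvec L0 (q s.1) (q s.2)) * ip (hvec L0 (w i) (q s.1) (q s.2)) (f kk)) *
    symplectic_fourier mu (zeta L (q s.1) (q s.2) (k i) (l i)))) addrC.
  apply: le_trans (ncD _ _) _; apply: lerD; last exact: appr.
  apply: le_trans (nc_sum _ _ _) _; apply: ler_sum => i _.
  apply: le_trans (nc_sum _ _ _) _; apply: ler_sum => s _.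
  by rewrite !ncM.
have bess (g : 'I_N -> V) (u : V) : orthonormal ip xpredT g ->
    \sum_kk nc (ip u (g kk)) ^+ 2 <= nrm2 ip u.
  by move=> og; apply: (@bessel _ _ ip _ (index_enum 'I_N) xpredT g) => //; exact: index_enum_uniq.
have oe' : orthonormal ip xpredT (fun kk : 'I_N => e kk).
  by move=> i j _ _; rewrite oe ?unfold_in.
have of2 : orthonormal ip xpredT (fun kk : 'I_N => f kk).
  by move=> i j _ _; rewrite of' ?unfold_in.
have SP : \sum_kk S kk `^ p <= (M0 * B) `^ (p - 1) * (M0 * (B * D)).
  apply: discrete_schatten => //.
  - exact: le_trans B_ge1.
  - by move=> j; exact: nc_ge0.
  - by move=> i j; exact: nc_ge0.
  - by move=> i j; exact: nc_ge0.
  - by move=> i j kk; exact: nc_ge0.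
  - move=> kk; apply: le_trans (fvec_bessel L0 bq (e kk) N' B00 (BP Y)) _.
    by rewrite nrm1// mulr1 le_max lexx.
  - move=> s; under eq_bigr do rewrite /al sip_conj ncJ.
    apply: le_trans (bess _ _ oe') _; apply: le_trans B_ge1.
    by rewrite -sqr_nrm nrm_fvec expr1n.
  - move=> i kk; apply: le_trans (hvec_bessel L0 bq (f kk) (w i) Y N') _.
    by rewrite nrm1.
  - move=> i s; apply: le_trans (bess _ _ of2) _; apply: le_trans B_ge1.
    exact: nrm2_hvec.
  - move=> i; apply: le_trans (_ : \sum_(s : 'I_Y * 'I_N') C `^ p *
        (1 + phase_norm (zeta L (q s.1) (q s.2) (k i) (l i))) `^ (- (beta / 2 * p)) <= _).
      apply: ler_sum => s _; rewrite -mulNr powRrM -powRM ?powR_ge0 ?(ltW C0)//.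
      by apply: ge0_ler_powR; rewrite ?nnegrE ?nc_ge0 ?mulr_ge0 ?powR_ge0 ?(ltW C0)//; exact: decay.
    by rewrite -mulr_sumr ler_wpM2l ?powR_ge0//; exact: DP.
apply: le_trans (_ : \sum_(kk < N) 2 `^ (p - 1) * (S kk `^ p + eps) <= _).
  apply: ler_sum => kk _.
  apply: le_trans (_ : (S kk + eps) `^ p <= _).
    by apply: ge0_ler_powR; rewrite ?nnegrE ?nc_ge0 ?addr_ge0 ?(ltW eps0)//; exact: wS.
  apply: le_trans (powRD_le p1 (S0 kk) (ltW eps0)) _.
  rewrite ler_wpM2l ?powR_ge0// lerD2l.
  rewrite -[leRHS](powRr1 (ltW eps0)); apply: ger_powR => //.
  by rewrite eps0 invf_le1// ler1n.
rewrite -mulr_sumr ler_wpM2l ?powR_ge0// big_split/= lerD//.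
rewrite sumr_const card_ord -[leLHS]mulr_natr mulrC ler_pdivrMr// mul1r ler_nat.
exact: leqnSn.
Qed.

End schatten_estimate.

Theorem corollary1p5 (R : realType) (d : nat) (hd : (1 <= d)%N)
  (mu : complex_measure ('rV[R]_d * 'rV[R]_d)%type R)
  (mu_supp : compactly_supported mu)
  (beta C : R) (beta_gt0 : 0 < beta) (C_gt0 : 0 < C)
  (decay : forall zeta : 'rV[R]_d * 'rV[R]_d,
    Normc.normc (symplectic_fourier mu zeta)
      <= C * (1 + phase_norm zeta) `^ (- (beta / 2))) :
  exists L : ('rV[R]_d -> R[i]) -> ('rV[R]_d -> R[i]),
    is_weyl_operator mu L /\
    forall p : \bar R, (1 <= p)%E -> ((4 * d%:R / beta)%:E < p)%E ->
      schatten p L.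
Proof.
have [K cK muK] := mu_supp.
have [lam lam0 Klam] := compact_phase_box cK.
have muB B : measurable B -> B `<=` ~` phase_box lam ->
    cm_Re mu B = 0%E /\ cm_Im mu B = 0%E.
  by move=> mB Blam; apply: muK => // z Bz Kz; exact: Blam Bz (Klam _ Kz).
have [p [p1 hp]|L [weylL SL]] := @weyl_schatten R d mu lam
    (fun p => 1 <= p /\ 4 * d%:R / beta < p) muB.
  split; first exact: lt_le_trans p1.
  exact: (weyl_form_summable hd lam0 beta_gt0 C_gt0 muB decay p1 hp).
(* For p = +oo membership is boundedness, already contained in weylL; p = -oo contradicts 1 <= p. *)
exists L; split => // -[p| |] //; last by move=> _ _; case: weylL.
by rewrite lee_fin lte_fin => p1 hp; exact: SL.
Qed.
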